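(* Suppose that $a,b\in\left(\frac38,\frac12\right)$. Then there is a constant $C$ such that for any $u\in X_{b,1}$, $$\left\||u|^2u\right\|_{X_{-a,1}}\le C\|u\|^3_{X_{b,1}}.$$
   Context: For functions (distributions) on $\mathbb{R}_x\times\mathbb{R}_t$ with space-time Fourier transform $\hat f(\xi,\tau)$, the Bourgain norm is $\|f\|_{X_{b,s}}=\left(\int_{\mathbb{R}^2}(1+|\xi|)^{2s}(1+|\tau+\xi^2|)^{2b}|\hat f(\xi,\tau)|^2\,d\xi d\tau\right)^{1/2}$. *)

(* Defs.v *)
From mathcomp Require Import all_boot all_order all_algebra.
From mathcomp Require Import all_classical all_reals all_analysis.
From mathcomp Require Import complex.

Set Implicit Arguments.
Unset Strict Implicit.
Unset Printing Implicit Defensive.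

Import Order.TTheory GRing.Theory Num.Theory.
Import numFieldNormedType.Exports.

Local Open Scope classical_set_scope.
Local Open Scope ring_scope.
Local Open Scope complex_scope.

(* The plane carries the product of the Borel sigma-algebras and the product
   Lebesgue measure; its points are (x, t), or (xi, tau) on the Fourier side. *)
Notation plane R := (measurableTypeR R * measurableTypeR R)%type.
Notation leb2 R := ((@lebesgue_measure R) \x (@lebesgue_measure R))%E.

Definition cabs (R : realType) (z : R[i]) : R := ComplexField.Normc.normc z.

Definition RePart (R : realType) (f : plane R -> R[i]) (p : plane R) : R :=
  complex.Re (f p).
Definition ImPart (R : realType) (f : plane R -> R[i]) (p : plane R) : R :=
  complex.Im (f p).

Definition cmeasurable (R : realType) (f : plane R -> R[i]) : Prop :=
  measurable_fun setT (RePart f) /\ measurable_fun setT (ImPart f).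

Definition cintegrable (R : realType) (f : plane R -> R[i]) : Prop :=
  (leb2 R).-integrable setT (EFin \o RePart f) /\
  (leb2 R).-integrable setT (EFin \o ImPart f).

Definition cint (R : realType) (f : plane R -> R[i]) : R[i] :=
  Rintegral (leb2 R) setT (RePart f) +i* Rintegral (leb2 R) setT (ImPart f).

(* A direction is a boolean: false for the first variable, true for the
   second one.  [slice k f p] is f along the line through p in direction k. *)
Definition slice (R : realType) (k : bool) (f : plane R -> R) (p : plane R)
    (y : R) : R :=
  if k then f (p.1, y) else f (y, p.2).

Definition plane_coord (R : realType) (k : bool) (p : plane R) : R :=
  if k then p.2 else p.1.

Definition cderivable (R : realType) (k : bool) (f : plane R -> R[i])
    (p : plane R) : Prop :=
  derivable (slice k (RePart f) p) (plane_coord k p) 1 /\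
  derivable (slice k (ImPart f) p) (plane_coord k p) 1.

Definition partial (R : realType) (k : bool) (f : plane R -> R[i])
    (p : plane R) : R[i] :=
  derive1 (slice k (RePart f) p) (plane_coord k p) +i*
  derive1 (slice k (ImPart f) p) (plane_coord k p).

(* Iterated partial derivatives, indexed by words of directions. *)
Definition partials (R : realType) (w : seq bool) (f : plane R -> R[i]) :
    plane R -> R[i] :=
  foldr (@partial R) f w.

Definition decay_le (R : realType) (n : nat) (f : plane R -> R[i]) (M : R) :
    Prop :=
  forall p : plane R, (1 + `|p.1| + `|p.2|) ^+ n * cabs (f p) <= M.

(* The Schwartz space.  Boundedness of all the iterated partial derivatives,
   in every order, forces their continuity, so f is smooth. *)
Definition schwartz (R : realType) (f : plane R -> R[i]) : Prop :=
  forall w : seq bool,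
    (forall (k : bool) (p : plane R), cderivable k (partials w f) p) /\
    (forall n : nat, exists M : R, decay_le n (partials w f) M).

(* Tempered distributions; the values of T outside of the Schwartz space are
   irrelevant.  The second condition is |T phi| <= C p_N(phi), where p_N is the
   largest of the seminorms sup (1+|x|+|t|)^N |partials w phi|, size w <= N. *)
Definition tempered (R : realType) (T : (plane R -> R[i]) -> R[i]) : Prop :=
  (forall (c : R[i]) (phi psi : plane R -> R[i]),
     schwartz phi -> schwartz psi ->
     T (fun p => c * phi p + psi p) = c * T phi + T psi) /\
  (exists (N : nat) (C : R), forall phi : plane R -> R[i], schwartz phi ->
     forall M : R,
       (forall w : seq bool, (size w <= N)%N -> decay_le N (partials w phi) M) ->
       cabs (T phi) <= C * M).

Definition pairing (R : realType) (f phi : plane R -> R[i]) : R[i] :=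
  cint (fun p => f p * phi p).

(* f defines a tempered distribution, namely [pairing f]. *)
Definition tempered_fun (R : realType) (f : plane R -> R[i]) : Prop :=
  [/\ cmeasurable f,
      forall phi, schwartz phi -> cintegrable (fun p => f p * phi p)
    & tempered (pairing f)].

(* The distribution T is the function f. *)
Definition is_function (R : realType) (T : (plane R -> R[i]) -> R[i])
    (f : plane R -> R[i]) : Prop :=
  tempered_fun f /\ (forall phi, schwartz phi -> T phi = pairing f phi).

Definition cis (R : realType) (theta : R) : R[i] := cos theta +i* sin theta.

Definition fourier (R : realType) (f : plane R -> R[i]) (q : plane R) : R[i] :=
  cint (fun p => cis (- (p.1 * q.1 + p.2 * q.2)) * f p).

Definition fourier_distr (R : realType) (T : (plane R -> R[i]) -> R[i]) :
    (plane R -> R[i]) -> R[i] :=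
  fun phi => T (fourier phi).

Definition weighted_norm (R : realType) (b s : R) (g : plane R -> R[i]) :
    \bar R :=
  ((\int[leb2 R]_q
     (((1 + `|q.1|) `^ (2 * s) * (1 + `|q.2 + q.1 ^+ 2|) `^ (2 * b)
       * cabs (g q) ^+ 2)%:E)) `^ 2^-1)%E.

(* The function g = \hat T is unique up to a null set when it exists, so the
   infimum below ranges over at most one value; it is +oo when \hat T is not
   a function. *)
Definition bourgain_norm (R : realType) (b s : R)
    (T : (plane R -> R[i]) -> R[i]) : \bar R :=
  ereal_inf [set weighted_norm b s g | g in is_function (fourier_distr T)].

Definition bourgain_space (R : realType) (b s : R)
    (T : (plane R -> R[i]) -> R[i]) : Prop :=
  tempered T /\ (bourgain_norm b s T < +oo)%E.

Definition cubic (R : realType) (u : plane R -> R[i]) (p : plane R) : R[i] :=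
  (cabs (u p) ^+ 2)%:C * u p.

(* Main.v *)
(* Write sigma(xi, tau) = 1 + |tau + xi^2|, <xi> = 1 + |xi|, and g for the
   transform of U.  Since <xi> is submultiplicative, the weight <xi> can be
   distributed over the factors of g * g * g~, where g~ is the reflected
   conjugate of g, and everything rests on the bound
     sup_p int sigma(q)^(-2b) sigma(p - q)^(-2b) dq < +oo,   3/8 < b < 1/2,
   which with the Cauchy-Schwarz inequality gives |f * f|_2 <= C |sigma^b f|_2^2
   and, by duality, |sigma^(-b) (h * f~)|_2 <= C |h|_2 |sigma^b f|_2.
   Cutting g along the levels of sigma yields integrable pieces whose inverse
   transforms are controlled in L^4 by the first estimate at a smaller exponent
   (|F^-1 f|^4 = |F^-1 (f * f)|^2 and Plancherel), with geometric decay.  Their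
   sum therefore converges almost everywhere, under an integrable majorant of
   the fourth powers, to the function u which represents U.  For truncated g the
   transform of |u|^2 u is g * g * g~; both sides pass to the limit by dominated
   convergence.  Uniqueness of the function representing a distribution (test
   against gaussians, then Dynkin's pi-lambda theorem) handles every other
   representative u and identifies the infimum in the Bourgain norm. *)
Require Import Defs.
From HB Require Import structures.
From mathcomp Require Import all_boot all_order all_algebra.
From mathcomp Require Import all_classical all_reals all_analysis.
From mathcomp Require Import measurable_realfun complex ring lra.

Set Implicit Arguments.
Unset Strict Implicit.
Unset Printing Implicit Defensive.

Import Order.TTheory GRing.Theory Num.Theory.
Import numFieldNormedType.Exports.

Local Open Scope classical_set_scope.
Local Open Scope ring_scope.
Local Open Scope complex_scope.

(** * Complex-valued integration *)

(** The number 3/8 balances two integrations. Integrating sigma(q)^(-2b) sigma(p - q)^(-2b) in the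
    second variable leaves decay of any order ga < 4b - 1 in a quantity that is quadratic in the
    first variable. The remaining integral is bounded as soon as 2 ga > 1, so the requirement is 4b
    - 1 > 1/2. Duality puts the same exponent on the data and on the result. Both a and b are
    therefore lowered to min(a, b), which is harmless because sigma >= 1. A second exponent,
    strictly between 3/8 and this minimum, serves the construction of u: the gap between the two is
    what makes the pieces decay. Much of the work gives the estimate its meaning. U is only a
    distribution, while |u|^2 u needs a measurable function, and its transform has to be recognized
    as a function again. The majorant v of |u|^4 settles this: powers of |u| up to the fourth lie
    below 1 + v up to a constant, which is enough both for temperedness and for limits under the
    integral. The transform carries no normalizing factor; its constants are powers of 2 pi, kept as
    gaussian integrals. *)

Section ComplexModulus.
Context {R : realType}.
Implicit Types z w : R[i].

Lemma cabsE z : cabs z = Num.sqrt (complex.Re z ^+ 2 + complex.Im z ^+ 2).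
Proof. by case: z. Qed.

Lemma cabs_ge0 z : 0 <= cabs z.
Proof. by rewrite cabsE sqrtr_ge0. Qed.

Lemma cabsX2 z : cabs z ^+ 2 = complex.Re z ^+ 2 + complex.Im z ^+ 2.
Proof. by rewrite cabsE sqr_sqrtr// addr_ge0// sqr_ge0. Qed.

Lemma cabsM z w : cabs (z * w) = cabs z * cabs w.
Proof. exact: ComplexField.Normc.normcM. Qed.

Lemma cabsD z w : cabs (z + w) <= cabs z + cabs w.
Proof. exact: le_normcD. Qed.

Lemma cabsN z : cabs (- z) = cabs z.
Proof. exact: normcN. Qed.

Lemma cabsJ z : cabs z^* = cabs z.
Proof. by case: z => a b; rewrite !cabsE /= sqrrN. Qed.

Lemma cabs0 : cabs (0 : R[i]) = 0.
Proof. exact: ComplexField.Normc.normc0. Qed.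

Lemma cabsR (x : R) : cabs x%:C = `|x|.
Proof. by rewrite cabsE/= expr0n addr0 sqrtr_sqr. Qed.

Lemma cabs_cis (x : R) : cabs (cis x) = 1.
Proof. by rewrite cabsE /= cos2Dsin2 sqrtr1. Qed.

Lemma cabs_Re z : `|complex.Re z| <= cabs z.
Proof.
rewrite cabsE -sqrtr_sqr ler_sqrt ?addr_ge0 ?sqr_ge0//.
by rewrite lerDl sqr_ge0.
Qed.

Lemma cabs_Im z : `|complex.Im z| <= cabs z.
Proof.
rewrite cabsE -sqrtr_sqr ler_sqrt ?addr_ge0 ?sqr_ge0//.
by rewrite lerDr sqr_ge0.
Qed.

Lemma cabs_le z : cabs z <= `|complex.Re z| + `|complex.Im z|.
Proof.
rewrite -[leRHS]ger0_norm ?addr_ge0// -sqrtr_sqr cabsE ler_sqrt ?sqr_ge0//.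
rewrite sqrrD !real_normK ?num_real// addrAC lerDl.
by rewrite mulrn_wge0// mulr_ge0.
Qed.

Lemma cabs_eq0 z : cabs z = 0 -> z = 0.
Proof. exact: ComplexField.Normc.eq0_normc. Qed.

Lemma cReD z w : complex.Re (z + w) = complex.Re z + complex.Re w.
Proof. by case: z => ? ?; case: w. Qed.
Lemma cImD z w : complex.Im (z + w) = complex.Im z + complex.Im w.
Proof. by case: z => ? ?; case: w. Qed.
Lemma cReM z w : complex.Re (z * w) =
  complex.Re z * complex.Re w - complex.Im z * complex.Im w.
Proof. by case: z => ? ?; case: w. Qed.
Lemma cImM z w : complex.Im (z * w) =
  complex.Re z * complex.Im w + complex.Im z * complex.Re w.
Proof. by case: z => ? ?; case: w. Qed.
Lemma cReJ z : complex.Re z^* = complex.Re z. Proof. by case: z. Qed.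
Lemma cImJ z : complex.Im z^* = - complex.Im z. Proof. by case: z. Qed.

Lemma eqcP z w : complex.Re z = complex.Re w -> complex.Im z = complex.Im w ->
  z = w.
Proof. by case: z => ? ?; case: w => ? ? /= -> ->. Qed.

Lemma cisD (x y : R) : cis (x + y) = cis x * cis y.
Proof. by apply: eqcP; rewrite ?cReM ?cImM/= ?cosD ?sinD// addrC; lra. Qed.

Lemma cisN (x : R) : cis (- x) = (cis x)^*.
Proof. by apply: eqcP; rewrite ?cReJ ?cImJ/= ?cosN ?sinN. Qed.

Lemma cis0 : cis (0 : R) = 1.
Proof. by apply: eqcP; rewrite /= ?cos0 ?sin0. Qed.

End ComplexModulus.

(** * Measurability of real expressions *)

Section MeasurabilityRules.
Context d (T : measurableType d) {R : realType}.
Implicit Types f g : T -> R.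
Local Notation mf := (measurable_fun [set: T]).

Lemma mfD f g : mf f -> mf g -> mf (fun x => f x + g x).
Proof. exact: measurable_funD. Qed.
Lemma mfB f g : mf f -> mf g -> mf (fun x => f x - g x).
Proof. exact: measurable_funB. Qed.
Lemma mfM f g : mf f -> mf g -> mf (fun x => f x * g x).
Proof. exact: measurable_funM. Qed.
Lemma mfN f : mf f -> mf (fun x => - f x).
Proof. exact: measurable_funN. Qed.
Lemma mfX f n : mf f -> mf (fun x => f x ^+ n).
Proof. exact: measurable_funX. Qed.
Lemma mf_norm f : mf f -> mf (fun x => `|f x|).
Proof. exact: measurableT_comp. Qed.
Lemma mf_powR f r : mf f -> mf (fun x => f x `^ r).
Proof. by move=> h; exact: (@measurableT_comp _ _ _ _ _ _ (@powR R ^~ r)). Qed.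
Lemma mf_expR f : mf f -> mf (fun x => expR (f x)).
Proof. by move=> h; exact: (@measurableT_comp _ _ _ _ _ _ (@expR R)). Qed.
Lemma mf_EFin f : mf f -> mf (fun x => (f x)%:E).
Proof. by move=> h; exact/measurable_EFinP. Qed.
End MeasurabilityRules.

Lemma mf_fst d1 d2 (T1 : measurableType d1) (T2 : measurableType d2) :
  measurable_fun [set: T1 * T2] (fun p => p.1).
Proof. exact: measurable_fst. Qed.
Lemma mf_snd d1 d2 (T1 : measurableType d1) (T2 : measurableType d2) :
  measurable_fun [set: T1 * T2] (fun p => p.2).
Proof. exact: measurable_snd. Qed.

(** The rule is chosen by the syntactic shape of the body and the leaves are closed by [assumption];
    this is why measurability facts are pushed into the context just before a call. *)
Ltac mfun := repeat lazymatch goal with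
  | |- measurable_fun _ (fun x => EFin (@?f x)) => apply: mf_EFin
  | |- measurable_fun _ (fun x => (@?f x + - (@?g x))%R) => apply: mfB
  | |- measurable_fun _ (fun x => (@?f x + @?g x)%R) => apply: mfD
  | |- measurable_fun _ (fun x => (@?f x * @?g x)%R) => apply: mfM
  | |- measurable_fun _ (fun x => (- (@?f x))%R) => apply: mfN
  | |- measurable_fun _ (fun x => (@?f x) ^+ _) => apply: mfX
  | |- measurable_fun _ (fun x => `|@?f x|%R) => apply: mf_norm
  | |- measurable_fun _ (fun x => (@?f x) `^ _) => apply: mf_powR
  | |- measurable_fun _ (fun x => expR (@?f x)) => apply: mf_expR
  | |- measurable_fun _ (fun x => x) => exact: measurable_id
  | |- measurable_fun _ (fun x => x.1) => exact: mf_fst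
  | |- measurable_fun _ (fun x => x.2) => exact: mf_snd
  | |- measurable_fun _ (fun x => ?c) => exact: measurable_cst
  | |- _ => assumption
  end.

Section ComplexIntegral.
Context d (T : measurableType d) {R : realType}.
Implicit Types (f g : T -> R[i]).

Definition cmeas f := measurable_fun setT (fun x => complex.Re (f x)) /\
  measurable_fun setT (fun x => complex.Im (f x)).

Lemma cmeasD f g : cmeas f -> cmeas g -> cmeas (fun x => f x + g x).
Proof.
move=> [f1 f2] [g1 g2]; split.
  by under eq_fun do rewrite cReD; exact: measurable_funD.
by under eq_fun do rewrite cImD; exact: measurable_funD.
Qed.

Lemma cmeasM f g : cmeas f -> cmeas g -> cmeas (fun x => f x * g x).
Proof.
move=> [f1 f2] [g1 g2]; split.
  by under eq_fun do rewrite cReM; apply: measurable_funB; exact: measurable_funM.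
by under eq_fun do rewrite cImM; apply: measurable_funD; exact: measurable_funM.
Qed.

Lemma cmeasJ f : cmeas f -> cmeas (fun x => (f x)^*).
Proof.
move=> [f1 f2]; split; first by under eq_fun do rewrite cReJ.
by under eq_fun do rewrite cImJ; exact: measurable_funN.
Qed.

Lemma cmeas_cst (c : R[i]) : cmeas (fun=> c).
Proof. by split; exact: measurable_cst. Qed.

Lemma cmeasR (f : T -> R) : measurable_fun setT f -> cmeas (fun x => (f x)%:C).
Proof. by move=> mf; split => //=; exact: measurable_cst. Qed.

Lemma cmeas_cis (f : T -> R) : measurable_fun setT f -> cmeas (fun x => cis (f x)).
Proof.
move=> mf; split => /=; apply: measurableT_comp => //.
  by apply: continuous_measurable_fun; exact: continuous_cos.
by apply: continuous_measurable_fun; exact: continuous_sin.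
Qed.

Lemma measurable_cabs f : cmeas f -> measurable_fun setT (fun x => cabs (f x)).
Proof.
move=> [f1 f2]; under eq_fun do rewrite cabsE.
apply: measurableT_comp; first exact: (continuous_measurable_fun (@sqrt_continuous R)).
by apply: measurable_funD; exact: measurable_funX.
Qed.

Variable mu : {measure set T -> \bar R}.

(** Convertible to [cint] when [mu] is [leb2 R], so results proved here apply to [fourier] and
    [pairing] as they stand. The measure is left free in order to cover slices and products. *)
Definition cintg f : R[i] :=
  Rintegral mu setT (fun x => complex.Re (f x)) +i*
  Rintegral mu setT (fun x => complex.Im (f x)).

Definition L1 f := cmeas f /\ (\int[mu]_x (cabs (f x))%:E < +oo)%E.

Lemma L1_le f (g : T -> R) : cmeas f -> measurable_fun setT g ->
  (forall x, cabs (f x) <= g x) -> (\int[mu]_x (g x)%:E < +oo)%E -> L1 f.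
Proof.
move=> mf mg fg gy; split => //; apply: le_lt_trans gy.
apply: ge0_le_integral => //.
- by move=> x _; rewrite lee_fin cabs_ge0.
- by apply/measurable_EFinP; exact: measurable_cabs.
- exact/measurable_EFinP.
- by move=> x _; rewrite lee_fin.
Qed.

Lemma L1_Re f : L1 f -> mu.-integrable setT (fun x => (complex.Re (f x))%:E).
Proof.
move=> [mf fy]; apply/integrableP; split; first exact/measurable_EFinP/mf.1.
apply: le_lt_trans fy; apply: ge0_le_integral => //.
- by apply/measurable_EFinP; apply: measurableT_comp => //; exact: mf.1.
- by apply/measurable_EFinP; exact: measurable_cabs.
- by move=> x _; rewrite lee_fin cabs_Re.
Qed.

Lemma L1_Im f : L1 f -> mu.-integrable setT (fun x => (complex.Im (f x))%:E).
Proof.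
move=> [mf fy]; apply/integrableP; split; first exact/measurable_EFinP/mf.2.
apply: le_lt_trans fy; apply: ge0_le_integral => //.
- by apply/measurable_EFinP; apply: measurableT_comp => //; exact: mf.2.
- by apply/measurable_EFinP; exact: measurable_cabs.
- by move=> x _; rewrite lee_fin cabs_Im.
Qed.

Lemma integrable_L1 f : mu.-integrable setT (fun x => (complex.Re (f x))%:E) ->
  mu.-integrable setT (fun x => (complex.Im (f x))%:E) -> L1 f.
Proof.
move=> i1 i2; have [/measurable_EFinP m1 _] := integrableP _ _ _ i1.
have [/measurable_EFinP m2 _] := integrableP _ _ _ i2.
split; first by [].
have := integrableD measurableT (integrable_abse i1) (integrable_abse i2).
move=> /integrableP[_]; apply: le_lt_trans; apply: ge0_le_integral => //.
- by move=> x _; rewrite lee_fin cabs_ge0.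
- by apply/measurable_EFinP; exact: measurable_cabs.
- apply: measurableT_comp => //; apply: emeasurable_funD; apply: measurableT_comp => //;
  exact/measurable_EFinP.
- move=> x _; rewrite gee0_abs ?adde_ge0//=.
  by rewrite -EFinD lee_fin cabs_le.
Qed.

Lemma L1D f g : L1 f -> L1 g -> L1 (fun x => f x + g x).
Proof.
move=> [mf fy] [mg gy].
apply: (@L1_le _ (fun x => cabs (f x) + cabs (g x))).
- exact: cmeasD.
- by apply: measurable_funD; exact: measurable_cabs.
- by move=> x; exact: cabsD.
- under eq_integral do rewrite EFinD.
  rewrite ge0_integralD//.
  + exact: lte_add_pinfty.
  + by move=> x _; rewrite lee_fin cabs_ge0.
  + by apply/measurable_EFinP; exact: measurable_cabs.
  + by move=> x _; rewrite lee_fin cabs_ge0.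
  + by apply/measurable_EFinP; exact: measurable_cabs.
Qed.

Lemma L1_mulb (h : T -> R[i]) (M : R) f : cmeas h -> (forall x, cabs (h x) <= M) ->
  L1 f -> L1 (fun x => h x * f x).
Proof.
move=> mh hM [mf fy]; apply: (@L1_le _ (fun x => `|M| * cabs (f x))).
- exact: cmeasM.
- by apply: measurable_funM => //; exact: measurable_cabs.
- move=> x; rewrite cabsM ler_wpM2r ?cabs_ge0//.
  by rewrite (le_trans (hM x))// ler_norm.
- under eq_integral do rewrite EFinM.
  rewrite ge0_integralZl//.
  + by rewrite lte_mul_pinfty// lee_fin.
  + by apply/measurable_EFinP; exact: measurable_cabs.
  + by move=> x _; rewrite lee_fin cabs_ge0.
Qed.

Lemma L1Z (c : R[i]) f : L1 f -> L1 (fun x => c * f x).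
Proof.
by apply: (@L1_mulb (fun=> c) (cabs c)) => //; exact: cmeas_cst.
Qed.

Lemma L1J f : L1 f -> L1 (fun x => (f x)^*).
Proof.
move=> [mf fy]; split; first exact: cmeasJ.
by under eq_integral do rewrite cabsJ.
Qed.

Lemma cintgD f g : L1 f -> L1 g ->
  cintg (fun x => f x + g x) = cintg f + cintg g.
Proof.
move=> Lf Lg; apply: eqcP => /=; rewrite ?cReD ?cImD/= -RintegralD//.
- by apply: eq_Rintegral => x _; rewrite cReD.
- exact: L1_Re.
- exact: L1_Re.
- by apply: eq_Rintegral => x _; rewrite cImD.
- exact: L1_Im.
- exact: L1_Im.
Qed.

Lemma cintgZ (c : R[i]) f : L1 f -> cintg (fun x => c * f x) = c * cintg f.
Proof.
move=> Lf; have [i1 i2] := (L1_Re Lf, L1_Im Lf); apply: eqcP; rewrite ?cReM ?cImM/=.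
  under eq_Rintegral do rewrite cReM.
  by rewrite RintegralB ?RintegralZl//;
    [exact: (integrableZl measurableT _ i1)|exact: (integrableZl measurableT _ i2)].
under eq_Rintegral do rewrite cImM.
by rewrite RintegralD ?RintegralZl//;
  [exact: (integrableZl measurableT _ i2)|exact: (integrableZl measurableT _ i1)].
Qed.

Lemma cintgJ f : L1 f -> cintg (fun x => (f x)^*) = (cintg f)^*.
Proof.
move=> Lf; apply: eqcP; rewrite ?cReJ ?cImJ/=.
  by apply: eq_Rintegral => x _; rewrite cReJ.
rewrite -mulN1r -RintegralZl//; last exact: L1_Im.
by apply: eq_Rintegral => x _; rewrite cImJ mulN1r.
Qed.

Lemma cintgR (f : T -> R) :
  cintg (fun x => (f x)%:C) = (Rintegral mu setT f)%:C.
Proof. by rewrite /cintg/= /Rintegral integral0. Qed.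

(* Rotating [cintg f] onto the positive half-line reduces the estimate to a
   real integral. *)
Lemma cabs_cintg f : cmeas f ->
  ((cabs (cintg f))%:E <= \int[mu]_x (cabs (f x))%:E)%E.
Proof.
move=> mf; have [fy|] := boolP (\int[mu]_x (cabs (f x))%:E < +oo)%E; last first.
  by rewrite -leNgt leye_eq => /eqP ->; rewrite leey.
have Lf : L1 f by [].
have [->|] := eqVneq (cintg f) 0.
  by rewrite cabs0 integral_ge0// => x _; rewrite lee_fin cabs_ge0.
set z := cintg f => z0.
have cz0 : cabs z != 0 by apply: contra z0 => /eqP/cabs_eq0/eqP.
pose c : R[i] := z^* * (cabs z)^-1%:C.
have cc : cabs c = 1.
  by rewrite cabsM cabsJ cabsR ger0_norm ?invr_ge0 ?cabs_ge0// divff.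
have cE : complex.Re (c * z) = cabs z.
  rewrite /c !cReM !cImM cReJ cImJ; set r := (cabs z)^-1.
  rewrite -[complex.Re r%:C]/r -[complex.Im r%:C]/0.
  rewrite [LHS](_ : _ = (complex.Re z ^+ 2 + complex.Im z ^+ 2) * r); last by ring.
  by rewrite -cabsX2 expr2 mulfK.
rewrite -cE /z -cintgZ//.
have Lc : L1 (fun x => c * f x) by exact: L1Z.
rewrite /= /Rintegral fineK; last by apply: integrable_fin_num => //; exact: L1_Re.
apply: le_trans (lee_abs _) _.
apply: le_trans (le_abse_integral _ _ _) _ => //.
  by apply/measurable_EFinP; exact: Lc.1.1.
apply: ge0_le_integral => //.
- by apply/measurable_EFinP; apply: measurableT_comp => //; exact: Lc.1.1.
- by apply/measurable_EFinP; exact: measurable_cabs.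
- move=> x _; rewrite lee_fin.
  by rewrite (le_trans (cabs_Re _))// cabsM cc mul1r.
Qed.

Lemma ae_eq_Rintegral (f g : T -> R) : measurable_fun setT f ->
  measurable_fun setT g -> {ae mu, forall x, f x = g x} ->
  Rintegral mu setT f = Rintegral mu setT g.
Proof.
move=> mf mg fg; congr fine; apply: ae_eq_integral => //.
- exact/measurable_EFinP.
- exact/measurable_EFinP.
- by apply: filterS fg => x -> _.
Qed.

Lemma ae_eq_cintg f g : cmeas f -> cmeas g -> {ae mu, forall x, f x = g x} ->
  cintg f = cintg g.
Proof.
move=> [f1 f2] [g1 g2] fg; rewrite /cintg; congr (_ +i* _);
  by apply: ae_eq_Rintegral => //; apply: filterS fg => x ->.
Qed.

Lemma eq_cintg f g : f =1 g -> cintg f = cintg g.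
Proof. by move=> /funext ->. Qed.

(** Componentwise, to match the componentwise definition of [cintg]. *)
Definition ccvg (u : nat -> R[i]) (l : R[i]) :=
  complex.Re (u n) @[n --> \oo] --> complex.Re l /\
  complex.Im (u n) @[n --> \oo] --> complex.Im l.

Lemma Rintegral_dominated (f_ : nat -> T -> R) (f g : T -> R) :
  (forall n, measurable_fun setT (f_ n)) -> measurable_fun setT f ->
  measurable_fun setT g ->
  {ae mu, forall x, f_ n x @[n --> \oo] --> f x} ->
  {ae mu, forall x n, `|f_ n x| <= g x} ->
  (\int[mu]_x (g x)%:E < +oo)%E -> (forall x, 0 <= g x) ->
  mu.-integrable setT (EFin \o f) /\
  Rintegral mu setT (f_ n) @[n --> \oo] --> Rintegral mu setT f.
Proof.
move=> mf_ mf mg f_f f_g gy g0.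
have ig : mu.-integrable setT (EFin \o g).
  apply/integrableP; split; first exact/measurable_EFinP.
  by under eq_integral do rewrite gee0_abs ?lee_fin//.
have h1 n : measurable_fun setT (fun x => (f_ n x)%:E) by exact/measurable_EFinP.
have h2 : measurable_fun setT (fun x => (f x)%:E) by exact/measurable_EFinP.
have h3 : {ae mu, forall x, setT x -> (f_ n x)%:E @[n --> \oo] --> (f x)%:E}.
  by apply: filterS f_f => x h _; apply: cvg_EFin => //; exact: nearW.
have h4 : {ae mu, forall x n, setT x -> (`|(f_ n x)%:E| <= (EFin \o g) x)%E}.
  by apply: filterS f_g => x h n _; rewrite lee_fin.
have [iR _ cR] := @dominated_convergence _ _ _ mu setT measurableT
  (fun n x => (f_ n x)%:E) _ _ h1 h2 h3 ig h4.
by split => //; apply: fine_cvg; rewrite fineK//; exact: integrable_fin_num.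
Qed.

Lemma cintg_dominated (f_ : nat -> T -> R[i]) f (g : T -> R) :
  (forall n, cmeas (f_ n)) -> cmeas f -> measurable_fun setT g ->
  {ae mu, forall x, ccvg (f_^~ x) (f x)} ->
  {ae mu, forall x n, cabs (f_ n x) <= g x} ->
  (\int[mu]_x (g x)%:E < +oo)%E -> (forall x, 0 <= g x) ->
  L1 f /\ ccvg (fun n => cintg (f_ n)) (cintg f).
Proof.
move=> mf_ mf mg f_f f_g gy g0.
have [iR cR] : mu.-integrable setT (EFin \o (fun x => complex.Re (f x))) /\
    Rintegral mu setT (fun x => complex.Re (f_ n x)) @[n --> \oo] -->
    Rintegral mu setT (fun x => complex.Re (f x)).
  apply: (Rintegral_dominated _ _ mg) => //.
  - by move=> n; exact: (mf_ n).1.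
  - exact: mf.1.
  - by apply: filterS f_f => x [].
  - by apply: filterS f_g => x h n; rewrite (le_trans (cabs_Re _)).
have [iI cI] : mu.-integrable setT (EFin \o (fun x => complex.Im (f x))) /\
    Rintegral mu setT (fun x => complex.Im (f_ n x)) @[n --> \oo] -->
    Rintegral mu setT (fun x => complex.Im (f x)).
  apply: (Rintegral_dominated _ _ mg) => //.
  - by move=> n; exact: (mf_ n).2.
  - exact: mf.2.
  - by apply: filterS f_f => x [].
  - by apply: filterS f_g => x h n; rewrite (le_trans (cabs_Im _)).
by split; first exact: integrable_L1.
Qed.

End ComplexIntegral.

(** * Fubini for complex-valued functions *)

Section ComplexFubini.
Context d1 d2 (T1 : measurableType d1) (T2 : measurableType d2) {R : realType}.
Variables (m1 : {sigma_finite_measure set T1 -> \bar R}).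
Variables (m2 : {sigma_finite_measure set T2 -> \bar R}).

(** Measurability of f suffices: the integrals of the positive and negative parts are measurable by
    Tonelli, and [fine] of their difference is measurable even on slices that are not integrable. *)
Lemma measurable_Rintegral1 (f : T1 * T2 -> R) : measurable_fun setT f ->
  measurable_fun setT (fun x => Rintegral m2 setT (fun y => f (x, y))).
Proof.
move=> mf; apply: measurableT_comp => //.
have -> : (fun x => \int[m2]_y (f (x, y))%:E)%E =
    (fun x => \int[m2]_y (EFin \o f)^\+%E (x, y) - \int[m2]_y (EFin \o f)^\-%E (x, y))%E.
  apply/funext => x; rewrite [LHS]integralE.
  by congr (_ - _)%E; apply: eq_integral => y _; rewrite ?funeposE ?funenegE.
have mEf : measurable_fun setT (EFin \o f) by exact/measurable_EFinP.
apply: emeasurable_funB.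
  by apply: (measurable_fun_fubini_tonelli_F (EFin \o f)^\+%E) => //;
    exact: measurable_funepos.
by apply: (measurable_fun_fubini_tonelli_F (EFin \o f)^\-%E) => //;
  exact: measurable_funeneg.
Qed.

Lemma measurable_Rintegral2 (f : T1 * T2 -> R) : measurable_fun setT f ->
  measurable_fun setT (fun y => Rintegral m1 setT (fun x => f (x, y))).
Proof.
move=> mf; apply: measurableT_comp => //.
have -> : (fun y => \int[m1]_x (f (x, y))%:E)%E =
    (fun y => \int[m1]_x (EFin \o f)^\+%E (x, y) - \int[m1]_x (EFin \o f)^\-%E (x, y))%E.
  apply/funext => x; rewrite [LHS]integralE.
  by congr (_ - _)%E; apply: eq_integral => y _; rewrite ?funeposE ?funenegE.
have mEf : measurable_fun setT (EFin \o f) by exact/measurable_EFinP.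
apply: emeasurable_funB.
  by apply: (measurable_fun_fubini_tonelli_G (EFin \o f)^\+%E) => //;
    exact: measurable_funepos.
by apply: (measurable_fun_fubini_tonelli_G (EFin \o f)^\-%E) => //;
  exact: measurable_funeneg.
Qed.

Lemma cmeas_cintg1 (f : T1 * T2 -> R[i]) : cmeas f ->
  cmeas (fun x => cintg m2 (fun y => f (x, y))).
Proof.
by move=> [f1 f2]; split; [exact: (measurable_Rintegral1 f1)|
  exact: (measurable_Rintegral1 f2)].
Qed.

Lemma cmeas_cintg2 (f : T1 * T2 -> R[i]) : cmeas f ->
  cmeas (fun y => cintg m1 (fun x => f (x, y))).
Proof.
by move=> [f1 f2]; split; [exact: (measurable_Rintegral2 f1)|
  exact: (measurable_Rintegral2 f2)].
Qed.

Lemma integrable_fubini_G (f : T1 * T2 -> \bar R) :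
  (m1 \x m2)%E.-integrable setT f -> m2.-integrable setT (fubini_G m1 f).
Proof.
move=> fi; have [mf _] := integrableP _ _ _ fi.
apply/integrableP; split; first exact: (measurable_fubini_G fi).
apply: le_lt_trans ((integrable21ltyP m1 m2 mf).1 fi); apply: ge0_le_integral => //.
- by apply: measurableT_comp => //; exact: (measurable_fubini_G fi).
- apply: (measurable_fun_fubini_tonelli_G (abse \o f)).
    exact: measurableT_comp.
  by move=> x; exact: abse_ge0.
- move=> y _; apply: le_abse_integral => //; exact: measurableT_comp mf _.
Qed.

Lemma Rintegral_Fubini (f : T1 * T2 -> R) :
  (m1 \x m2)%E.-integrable setT (EFin \o f) ->
  Rintegral m1 setT (fun x => Rintegral m2 setT (fun y => f (x, y))) =
  Rintegral m2 setT (fun y => Rintegral m1 setT (fun x => f (x, y))).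
Proof.
move=> fi; have [/measurable_EFinP mf _] := integrableP _ _ _ fi.
(* The real-valued and the extended inner integrals agree only where the latter is finite, hence
   almost everywhere. *)
transitivity (fine (\int[m1]_x \int[m2]_y (f (x, y))%:E)).
  have iF := integrable_fubini_F fi.
  congr fine; apply: ae_eq_integral => //.
  - by apply/measurable_EFinP; exact: measurable_Rintegral1.
  - exact: measurable_int iF.
  - have := integrable_ae measurableT iF; apply: filterS => x h _ /=.
    by rewrite /Rintegral fineK//; exact: h.
have iG := integrable_fubini_G fi.
rewrite (Fubini fi); congr fine; apply: ae_eq_integral => //.
- exact: measurable_int iG.
- by apply/measurable_EFinP; exact: measurable_Rintegral2.
- have := integrable_ae measurableT iG; apply: filterS => x h _ /=.
  by rewrite /Rintegral fineK//; exact: h.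
Qed.

Lemma cintg_Fubini (f : T1 * T2 -> R[i]) : L1 (m1 \x m2)%E f ->
  cintg m1 (fun x => cintg m2 (fun y => f (x, y))) =
  cintg m2 (fun y => cintg m1 (fun x => f (x, y))).
Proof.
move=> Lf; rewrite /cintg/=; congr (_ +i* _).
  exact: (Rintegral_Fubini (L1_Re Lf)).
exact: (Rintegral_Fubini (L1_Im Lf)).
Qed.

Lemma measurable_ecabs d (T : measurableType d) (f : T -> R[i]) : cmeas f ->
  measurable_fun setT (fun x => (cabs (f x))%:E).
Proof. by move=> mf; apply/measurable_EFinP; exact: measurable_cabs. Qed.

Lemma L1_prod (f : T1 * T2 -> R[i]) : cmeas f ->
  (\int[m1]_x \int[m2]_y (cabs (f (x, y)))%:E < +oo)%E -> L1 (m1 \x m2)%E f.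
Proof.
move=> mf fy; split => //; rewrite fubini_tonelli1//; first exact: measurable_ecabs.
by move=> x; rewrite lee_fin cabs_ge0.
Qed.

Lemma L1_cintg1 (f : T1 * T2 -> R[i]) : L1 (m1 \x m2)%E f ->
  L1 m1 (fun x => cintg m2 (fun y => f (x, y))).
Proof.
move=> [mf fy]; split; first exact: cmeas_cintg1.
have mF : measurable_fun setT (fun x => \int[m2]_y (cabs (f (x, y)))%:E)%E.
  apply: (measurable_fun_fubini_tonelli_F (fun z => (cabs (f z))%:E)) => //.
    exact: measurable_ecabs.
  by move=> x; rewrite lee_fin cabs_ge0.
rewrite fubini_tonelli1// in fy; last 2 first.
- exact: measurable_ecabs.
- by move=> x; rewrite lee_fin cabs_ge0.
apply: le_lt_trans fy; apply: ge0_le_integral => //.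
- by move=> x _; rewrite lee_fin cabs_ge0.
- by apply: measurable_ecabs; exact: cmeas_cintg1.
- move=> x _; apply: cabs_cintg.
  by split; [apply: (measurableT_comp mf.1)|apply: (measurableT_comp mf.2)].
Qed.

End ComplexFubini.

Lemma cmeas_comp d1 d2 (T1 : measurableType d1) (T2 : measurableType d2)
    (R : realType) (f : T2 -> R[i]) (h : T1 -> T2) :
  cmeas f -> measurable_fun setT h -> cmeas (f \o h).
Proof.
by move=> [f1 f2] mh; split; [exact: (measurableT_comp f1)|exact: (measurableT_comp f2)].
Qed.

(** * Affine changes of variables *)

Section Affine.
Context {R : realType}.
Local Notation mu := (@lebesgue_measure R).

Definition affine (c d : R) (x : measurableTypeR R) : measurableTypeR R :=
  c * x + d.

Lemma measurable_affine c d : measurable_fun setT (affine c d).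
Proof. by apply: measurable_funD => //; exact: measurable_funM. Qed.

Definition affine_measure (c d : R) : {measure set (measurableTypeR R) -> \bar R}.
Proof.
unshelve refine (pushforward mu (affine c d) : {measure set _ -> \bar R}).
exact: measurable_affine.
Defined.

(** Both sides are measures that agree on half-open intervals, and this determines Lebesgue
    measure. *)
Lemma lebesgue_measure_affine (c : {nonneg R}) d (A : set (measurableTypeR R)) :
  0 < c%:num -> measurable A ->
  mu A = mscale c (affine_measure c%:num d) A.
Proof.
move=> c0; apply: lebesgue_measure_unique => _ [[a b]] _ <-.
transitivity (c%:num%:E * mu [set` `]((a - d) / c%:num)%R, ((b - d) / c%:num)%R]])%E; last first.
  congr (_ * mu _)%E; apply/seteqP; split => x /=; rewrite !in_itv/= /affine
    ltr_pdivrMr// ler_pdivlMr// ltrBlDr lerBrDr (mulrC x)//.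
rewrite !lebesgue_measure_itv/= !lte_fin ltr_pM2r ?invr_gt0// ltrD2r.
case: ifPn => ab; last by rewrite mule0.
rewrite -!EFinB -EFinM; congr EFin.
by rewrite -mulrBl mulrC divfK ?gt_eqF//; lra.
Qed.

Lemma ge0_integral_affine_pos (c d : R) (f : R -> \bar R) : 0 < c ->
  measurable_fun setT f -> (forall x, 0 <= f x)%E ->
  (\int[mu]_x f x = c%:E * \int[mu]_x f (c * x + d)%R)%E.
Proof.
move=> c0 mf f0.
pose k : {nonneg R} := NngNum (ltW c0).
transitivity (\int[mscale k (affine_measure c d)]_x f x)%E.
  by apply: eq_measure_integral => A mA _; exact: lebesgue_measure_affine.
rewrite ge0_integral_mscale//; congr (_ * _)%E.
by rewrite ge0_integral_pushforward//; exact: measurable_affine.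
Qed.

Lemma ge0_integralN (f : R -> \bar R) :
  measurable_fun setT f -> (forall x, 0 <= f x)%E ->
  (\int[mu]_x f (- x)%R = \int[mu]_x f x)%E.
Proof.
move=> mf f0.
transitivity (\int[pushforward mu (-%R : _ -> measurableTypeR R)]_x f x)%E.
  by rewrite ge0_integral_pushforward.
by apply: eq_measure_integral => A mA _; exact: lebesgue_measureN.
Qed.

Lemma ge0_integral_affine (c d : R) (f : R -> \bar R) : c != 0 ->
  measurable_fun setT f -> (forall x, 0 <= f x)%E ->
  (\int[mu]_x f x = `|c|%:E * \int[mu]_x f (c * x + d)%R)%E.
Proof.
move=> c0 mf f0; have [c1|c1|/eqP] := ltgtP c 0; last by rewrite (negbTE c0).
  rewrite (@ge0_integral_affine_pos (- c) d)// ?oppr_gt0//.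
  rewrite -ge0_integralN//; last first.
    by apply: (measurableT_comp mf); exact: (measurable_affine (- c) d).
  by rewrite ltr0_norm//; congr (_ * _)%E; apply: eq_integral => x _; rewrite mulrNN.
by rewrite (@ge0_integral_affine_pos c d)// gtr0_norm.
Qed.

(** One map for three uses: dilations (a = 0), translations (c = 1) and reflections (c = -1). *)
Definition paffine (c : R) (a p : plane R) : plane R :=
  (c * p.1 + a.1, c * p.2 + a.2).

Lemma measurable_paffine c a : measurable_fun setT (paffine c a).
Proof.
by apply: measurable_fun_pair => /=; apply: measurable_funD => //;
  apply: measurable_funM.
Qed.

Lemma ge0_integral_paffine (c : R) (a : plane R) (f : plane R -> \bar R) : c != 0 ->
  measurable_fun setT f -> (forall x, 0 <= f x)%E ->
  (\int[leb2 R]_p f p = (c ^+ 2)%:E * \int[leb2 R]_p f (paffine c a p))%E.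
Proof.
move=> c0 mf f0.
have mfp : measurable_fun setT (f \o paffine c a).
  by apply: (measurableT_comp mf); exact: measurable_paffine.
have F0 (h : plane R -> \bar R) x : (forall p, 0 <= h p)%E -> (0 <= fubini_F mu h x)%E.
  by move=> h0; apply: integral_ge0 => y _; exact: h0.
have mF := measurable_fun_fubini_tonelli_F f mf f0 : measurable_fun setT (fubini_F mu f).
have mG := measurable_fun_fubini_tonelli_F _ mfp (fun p => f0 _) :
  measurable_fun setT (fubini_F mu (f \o paffine c a)).
have FE x : fubini_F mu f (c * x + a.1) =
    (`|c|%:E * fubini_F mu (f \o paffine c a) x)%E.
  apply: (@ge0_integral_affine c a.2 (fun y => f (c * x + a.1, y)) c0) => //.
  exact: measurableT_comp mf _.
transitivity (`|c|%:E * (`|c|%:E * \int[mu]_x fubini_F mu (f \o paffine c a) x))%E.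
  rewrite (fubini_tonelli1 f mf f0).
  rewrite (ge0_integral_affine a.1 c0 mF (fun x => F0 f x f0)).
  congr (_ * _)%E; rewrite -ge0_integralZl//.
    by apply: eq_integral => x _; exact: FE.
  by move=> x _; exact: (F0 (f \o paffine c a) x (fun p => f0 _)).
rewrite muleA -EFinM -expr2 real_normK ?num_real//; congr (_ * _)%E.
exact: esym (fubini_tonelli1 _ mfp (fun p => f0 _)).
Qed.

Lemma Rintegral_paffine (c : R) (a : plane R) (f : plane R -> R) : c != 0 ->
  (leb2 R).-integrable setT (EFin \o f) ->
  Rintegral (leb2 R) setT f =
  c ^+ 2 * Rintegral (leb2 R) setT (fun p => f (paffine c a p)).
Proof.
move=> c0 fi.
have [mf _] := integrableP _ _ _ fi.
have mp := measurable_paffine c a.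
have mpos := measurable_funepos mf; have mneg := measurable_funeneg mf.
have fpos := integral_funepos_lt_pinfty measurableT fi.
have fneg := integral_funeneg_lt_pinfty measurableT fi.
have c2 : 0 < c ^+ 2 by rewrite exprn_even_gt0.
have key (h : plane R -> \bar R) : measurable_fun setT h -> (forall x, 0 <= h x)%E ->
    (\int[leb2 R]_p h p < +oo)%E ->
    fine (\int[leb2 R]_p h p)%E = c ^+ 2 * fine (\int[leb2 R]_p h (paffine c a p))%E
    /\ (\int[leb2 R]_p h (paffine c a p) < +oo)%E.
  move=> mh h0; rewrite (@ge0_integral_paffine c a)// => hy.
  have : (0 <= \int[leb2 R]_p h (paffine c a p))%E by apply: integral_ge0 => x _.
  move: hy; case: (\int[leb2 R]_p h (paffine c a p))%E => [r _ _|hy|//].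
    by rewrite ltry.
  by rewrite gt0_muley ?lte_fin in hy.
have [kp yp] := key _ mpos (funepos_ge0 _) fpos.
have [kn yn] := key _ mneg (funeneg_ge0 _) fneg.
rewrite /Rintegral integralE fineB; last 2 first.
- by rewrite ge0_fin_numE// integral_ge0// => x _; rewrite funepos_ge0.
- by rewrite ge0_fin_numE// integral_ge0// => x _; rewrite funeneg_ge0.
rewrite kp kn -mulrBr [in RHS]integralE; congr (_ * _).
rewrite -fineB.
- by congr fine; congr (_ - _)%E; apply: eq_integral => x _; rewrite ?funeposE ?funenegE.
- by rewrite ge0_fin_numE// integral_ge0// => x _; rewrite funepos_ge0.
- by rewrite ge0_fin_numE// integral_ge0// => x _; rewrite funeneg_ge0.
Qed.

Lemma cintg_paffine (c : R) (a : plane R) (f : plane R -> R[i]) : c != 0 ->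
  L1 (leb2 R) f ->
  cintg (leb2 R) f = (c ^+ 2)%:C * cintg (leb2 R) (fun p => f (paffine c a p)).
Proof.
move=> c0 Lf; apply: eqcP; rewrite ?cReM ?cImM/=.
  by rewrite mul0r subr0; apply: (Rintegral_paffine _ c0); exact: L1_Re.
by rewrite mul0r addr0; apply: (Rintegral_paffine _ c0); exact: L1_Im.
Qed.

Lemma L1_paffine (c : R) (a : plane R) (f : plane R -> R[i]) : c != 0 ->
  L1 (leb2 R) f -> L1 (leb2 R) (fun p => f (paffine c a p)).
Proof.
move=> c0 [mf fy]; have mp := measurable_paffine c a.
split; first exact: cmeas_comp mf mp.
move: fy; rewrite (@ge0_integral_paffine c a)//; last 2 first.
- exact: measurable_ecabs.
- by move=> x; rewrite lee_fin cabs_ge0.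
have : (0 <= \int[leb2 R]_p (cabs (f (paffine c a p)))%:E)%E.
  by apply: integral_ge0 => x _; rewrite lee_fin cabs_ge0.
have c2 : 0 < c ^+ 2 by rewrite exprn_even_gt0.
case: (\int[leb2 R]_p _)%E => [r _ _|_|//].
  by rewrite ltry.
by rewrite gt0_muley ?lte_fin.
Qed.

End Affine.

Section PlaneMeasure.
Context {R : realType}.

Lemma sigma_finite_leb2 : sigma_finite setT (leb2 R).
Proof.
have /sigma_finiteP[F [TF ndF Foo]] := sigma_finiteT (@lebesgue_measure R).
exists (fun n => F n `*` F n).
  rewrite -setXTT TF predeqE => -[x y]; split.
    move=> [/= [n _ Fnx] [k _ Fky]]; exists (maxn n k) => //; split.
    - by move: x Fnx; exact/subsetPset/ndF/leq_maxl.
    - by move: y Fky; exact/subsetPset/ndF/leq_maxr.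
  by move=> [n _ []/= ? ?]; split; exists n.
move=> k; have [? ?] := Foo k.
split; first exact: measurableX.
by rewrite product_measure1E// lte_mul_pinfty// ge0_fin_numE.
Qed.

(* [leb2 R] with its sigma-finite structure, which unification does not find:
   another canonical structure is attached to the same head symbol. *)
Definition sleb2 : {sigma_finite_measure set (plane R) -> \bar R} :=
  HB.pack_for {sigma_finite_measure set (plane R) -> \bar R} (leb2 R)
    (Measure_isSigmaFinite.Build _ _ _ (leb2 R) sigma_finite_leb2).

End PlaneMeasure.

(** * Schwartz functions *)

Section Derivation.
Context {R : realType}.
Implicit Types (f g : plane R -> R[i]) (p : plane R).

Definition upd (k : bool) p (y : R) : plane R := if k then (p.1, y) else (y, p.2).

Lemma sliceE k (h : plane R -> R) p : slice k h p = h \o upd k p.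
Proof. by case: k. Qed.

Lemma upd_id k p : upd k p (plane_coord k p) = p.
Proof. by case: k; case: p. Qed.

(** Derivability and the value of the derivative in one relation, so that the rules of calculus
    compose without side conditions; [cderP] converts back to [cderivable] and [partial]. *)
Definition cder k f p (z : R[i]) :=
  is_derive (plane_coord k p) 1 (fun y => complex.Re (f (upd k p y))) (complex.Re z) /\
  is_derive (plane_coord k p) 1 (fun y => complex.Im (f (upd k p y))) (complex.Im z).

Lemma cderP k f p z : cder k f p z -> cderivable k f p /\ partial k f p = z.
Proof.
move=> [h1 h2]; rewrite /cderivable /partial !sliceE; split.
  by split; [case: h1|case: h2].
by apply: eqcP => /=; rewrite derive1E; [case: h1|case: h2].
Qed.

Lemma cderivable_cder k f p : cderivable k f p -> cder k f p (partial k f p).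
Proof.
rewrite /cderivable /cder /partial !sliceE/= => -[h1 h2].
split; apply: DeriveDef.
- exact: h1.
- by rewrite derive1E.
- exact: h2.
- by rewrite derive1E.
Qed.

Lemma cder_eq k f p z w : z = w -> cder k f p z -> cder k f p w.
Proof. by move=> ->. Qed.

Lemma cder_cst k (c : R[i]) p : cder k (fun=> c) p 0.
Proof. by split => /=; exact: is_derive_cst. Qed.

Lemma cderD k f g p z w : cder k f p z -> cder k g p w ->
  cder k (fun q => f q + g q) p (z + w).
Proof.
move=> [f1 f2] [g1 g2]; split.
  by rewrite cReD; under eq_fun do rewrite cReD; exact: is_deriveD.
by rewrite cImD; under eq_fun do rewrite cImD; exact: is_deriveD.
Qed.

Lemma cderM k f g p z w : cder k f p z -> cder k g p w ->
  cder k (fun q => f q * g q) p (f p * w + z * g p).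
Proof.
move=> [f1 f2] [g1 g2]; split.
  rewrite cReD !cReM; under eq_fun do rewrite cReM.
  refine (is_derive_eq (is_deriveB (is_deriveM f1 g1) (is_deriveM f2 g2)) _).
  by rewrite /= upd_id /GRing.scale/=; ring.
rewrite cImD !cImM; under eq_fun do rewrite cImM.
refine (is_derive_eq (is_deriveD (is_deriveM f1 g2) (is_deriveM f2 g1)) _).
by rewrite /= upd_id /GRing.scale/=; ring.
Qed.

Lemma cder_real k (h : R -> R) j p (h' : R) :
  is_derive (plane_coord j p) 1 h h' ->
  cder k (fun q => (h (plane_coord j q))%:C) p ((k == j)%:R * h')%:C.
Proof.
move=> hd; split => /=; last exact: is_derive_cst.
by case: k j hd => -[] hd; rewrite /= ?mul1r ?mul0r//; exact: is_derive_cst.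
Qed.

Lemma cder_coord k j p :
  cder k (fun q => (plane_coord j q)%:C) p (k == j)%:R%:C.
Proof.
by rewrite -[X in X%:C]mulr1; apply: (@cder_real k id); exact: is_derive_id.
Qed.

(** A coinduction principle: [schwartz] is the largest class of derivable, rapidly decaying
    functions that is stable under [partial]. *)
Lemma schwartz_coind (S : (plane R -> R[i]) -> Prop) :
  (forall f k p, S f -> cderivable k f p) ->
  (forall f n, S f -> exists M, decay_le n f M) ->
  (forall f k, S f -> S (partial k f)) ->
  forall f, S f -> schwartz f.
Proof.
move=> Sd Sb Sp f Sf w.
have Sw : S (partials w f) by elim: w => //= k w; exact: Sp.
by split => [k p|n]; [exact: Sd|exact: Sb].
Qed.

Lemma schwartz_cderivable f k p : schwartz f -> cderivable k f p.
Proof. by move=> /(_ [::])[+ _]; exact. Qed.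

Lemma schwartz_cder f k p : schwartz f -> cder k f p (partial k f p).
Proof. by move=> /schwartz_cderivable ?; exact: cderivable_cder. Qed.

Lemma schwartz_decay f n : schwartz f -> exists M, decay_le n f M.
Proof. by move=> /(_ [::])[_]; exact. Qed.

Lemma schwartz_partial f k : schwartz f -> schwartz (partial k f).
Proof.
move=> Sf w; have := Sf (rcons w k).
by rewrite /partials foldr_rcons.
Qed.

(* When B is stable under [partial] modulo this span, its bounded members are
   Schwartz: no induction on the words of derivatives is needed. *)
Inductive coord_span (B : (plane R -> R[i]) -> Prop) : (plane R -> R[i]) -> Prop :=
| span_base f : B f -> coord_span B f
| span_coord k f : coord_span B f ->
    coord_span B (fun p => (plane_coord k p)%:C * f p)
| span_lin (c : R[i]) f g : coord_span B f -> coord_span B g ->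
    coord_span B (fun p => c * f p + g p).

Lemma decay_ge0 n f M : decay_le n f M -> 0 <= M.
Proof. by move=> /(_ (0, 0))/=; apply: le_trans; rewrite mulr_ge0 ?exprn_ge0 ?cabs_ge0. Qed.

Lemma coord_le k p : `|plane_coord k p| <= 1 + `|p.1| + `|p.2|.
Proof.
have := normr_ge0 p.1; have := normr_ge0 p.2.
by case: k => /=; lra.
Qed.

Lemma weight_ge1 (p : plane R) : 1 <= 1 + `|p.1| + `|p.2|.
Proof. by rewrite -addrA lerDl addr_ge0. Qed.

Lemma coord_span_schwartz B :
  (forall f k p, B f -> cderivable k f p) ->
  (forall f n, B f -> exists M, decay_le n f M) ->
  (forall f k, B f -> coord_span B (partial k f)) ->
  forall f, coord_span B f -> schwartz f.
Proof.
move=> Bd Bb Bp; apply: schwartz_coind.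
- move=> f k p Sf; elim: Sf p => {f} [f Bf p|j f Sf IH p|c f g _ IHf _ IHg p].
  + exact: Bd.
  + exact: (cderP (cderM (cder_coord k j p) (cderivable_cder (IH p)))).1.
  + apply: (cderP (cderD (cderM (cder_cst k c p) (cderivable_cder (IHf p)))
      (cderivable_cder (IHg p)))).1.
- move=> f n Sf; elim: Sf n => {f} [f Bf n|j f Sf IH n|c f g _ IHf _ IHg n].
  + exact: Bb.
  (* A coordinate factor costs one power of the weight. *)
  + have [M HM] := IH n.+1; exists M => p; apply: le_trans (HM p).
    rewrite cabsM cabsR mulrA ler_wpM2r ?cabs_ge0// exprSr ler_wpM2l ?coord_le//.
  + have [M1 H1] := IHf n; have [M2 H2] := IHg n.
    exists (cabs c * M1 + M2) => p.
    apply: (@le_trans _ _ ((1 + `|p.1| + `|p.2|) ^+ n * (cabs c * cabs (f p) + cabs (g p)))).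
      by rewrite ler_wpM2l// -cabsM cabsD.
    by rewrite mulrDr lerD ?H2// mulrCA ler_wpM2l ?cabs_ge0.
- move=> f k Sf.
  (* The two claims are proved together because the product and sum rules need derivability of the
     components. *)
  suff : coord_span B (partial k f) /\ forall p, cderivable k f p by case.
  elim: Sf => {f} [f Bf|j f Sf [IH dI]|c f g _ [IHf df] _ [IHg dg]].
  + by split; [exact: Bp|move=> p; exact: Bd].
  + have E p := cderP (cderM (cder_coord k j p) (cderivable_cder (dI p))).
    split; last by move=> p; exact: (E p).1.
    rewrite (_ : partial k _ = fun p => (k == j)%:R%:C * f p +
      (plane_coord j p)%:C * partial k f p).
      by apply: span_lin => //; apply: span_coord.
    by apply/funext => p; rewrite (E p).2 addrC.
  + have E p := cderP (cderD (cderM (cder_cst k c p) (cderivable_cder (df p)))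
      (cderivable_cder (dg p))).
    split; last by move=> p; exact: (E p).1.
    rewrite (_ : partial k _ = fun p => c * partial k f p + partial k g p).
      exact: span_lin.
    by apply/funext => p; rewrite (E p).2 mul0r addr0.
Qed.

Lemma schwartz_span f : coord_span (@schwartz R) f -> schwartz f.
Proof.
apply: coord_span_schwartz.
- by move=> {}f k p; exact: schwartz_cderivable.
- by move=> {}f n; exact: schwartz_decay.
- by move=> {}f k Sf; apply: span_base; exact: schwartz_partial.
Qed.

Lemma schwartz_lin (c : R[i]) f g : schwartz f -> schwartz g ->
  schwartz (fun p => c * f p + g p).
Proof. by move=> Sf Sg; apply: schwartz_span; apply: span_lin; apply: span_base. Qed.

Lemma schwartz0 : schwartz (fun=> 0 : R[i]).
Proof.
apply: (@schwartz_coind (fun f => f = (fun=> 0))) => //.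
- by move=> f k p ->; exact: (cderP (cder_cst k 0 p)).1.
- by move=> f n ->; exists 0 => p; rewrite cabs0 mulr0.
- by move=> f k ->; apply/funext => p; exact: (cderP (cder_cst k 0 p)).2.
Qed.

Lemma schwartzZ (c : R[i]) f : schwartz f -> schwartz (fun p => c * f p).
Proof.
move=> Sf; have := schwartz_lin c Sf schwartz0.
by congr schwartz; apply/funext => p; rewrite addr0.
Qed.

Lemma schwartzD f g : schwartz f -> schwartz g -> schwartz (fun p => f p + g p).
Proof.
move=> Sf Sg; have := schwartz_lin 1 Sf Sg.
by congr schwartz; apply/funext => p; rewrite mul1r.
Qed.

Lemma schwartz_coord k f : schwartz f ->
  schwartz (fun p => (plane_coord k p)%:C * f p).
Proof. by move=> Sf; apply: schwartz_span; apply: span_coord; apply: span_base. Qed.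

End Derivation.

(** * Joint measurability from separate continuity *)

Section Caratheodory.
Context {R : realType}.

Lemma measurable_floor_eq (z : int) (n : nat) :
  measurable [set x : measurableTypeR R | Num.floor (n.+1%:R * x) = z].
Proof.
rewrite (_ : [set _ | _] = `[(z%:~R / n.+1%:R : R), ((z + 1)%:~R / n.+1%:R)[%classic).
  exact: measurable_itv.
apply/seteqP; split => x /=.
  move=> <-; rewrite in_itv/= ler_pdivrMr// ltr_pdivlMr// (mulrC x).
  by rewrite floor_le_tmp/= ?num_real// floorD1_gt.
rewrite in_itv/= ler_pdivrMr// ltr_pdivlMr// (mulrC x) => ?.
exact: floor_def.
Qed.

(** Derivability along coordinate lines yields only separate continuity. Freezing the first variable
    on the grid of mesh 1/(n+1) gives functions whose preimages are countable unions of rectangles,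
    and continuity in the first variable makes them converge to f. *)
Lemma measurable_caratheodory (f : plane R -> R) :
  (forall x, continuous (fun t => f (x, t))) ->
  (forall t, continuous (fun x => f (x, t))) -> measurable_fun setT f.
Proof.
move=> c2 c1.
pose r (n : nat) (x : R) : R := (Num.floor (n.+1%:R * x))%:~R / n.+1%:R.
have rx x : r n x @[n --> \oo] --> x.
  apply/cvgrPdist_le => e e0; near=> n.
  have n0 : (0 : R) < n.+1%:R by rewrite ltr0n.
  have h1 : ((Num.floor (n.+1%:R * x))%:~R : R) <= n.+1%:R * x by apply: floor_le_tmp.
  have h2 : n.+1%:R * x < ((Num.floor (n.+1%:R * x) + 1)%:~R : R) by apply: floorD1_gt.
  rewrite intrD in h2.
  have h3 : (n.+1%:R : R)^-1 <= e.
    rewrite -[e]invrK lef_pV2 ?posrE ?invr_gt0//.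
    rewrite (@le_trans _ _ n%:R)// ?ler_nat//.
    by near: n; exact: nbhs_infty_ger.
  rewrite ger0_norm /r; last by rewrite subr_ge0 ler_pdivrMr// (mulrC x).
  apply: le_trans h3; rewrite lerBlDr -[X in X + _]mul1r -mulrDl.
  rewrite ler_pdivlMr// (mulrC x); lra.
apply: (@measurable_fun_cvg _ (plane R) R setT (fun n p => f (r n p.1, p.2))); last first.
  move=> [x t] _; exact: (@continuous_cvg _ _ _ _ _ _ (fun y => f (y, t)) x (c1 t x)).
move=> n _ Y mY; rewrite setTI.
rewrite (_ : _ @^-1` _ = \bigcup_(z : int)
  ([set x : measurableTypeR R | Num.floor (n.+1%:R * x) = z] `*`
   [set t : measurableTypeR R | Y (f (z%:~R / n.+1%:R, t))])).
  apply: countable_bigcupT_measurable; first exact: countableP.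
  move=> z; apply: measurableX; first exact: measurable_floor_eq.
  have := @continuous_measurable_fun R _ (c2 (z%:~R / n.+1%:R)) measurableT Y mY.
  by rewrite setTI.
apply/seteqP; split => [[x t]/= h|[x t] [z _ []]/= <-//].
by exists (Num.floor (n.+1%:R * x)).
Unshelve. all: by end_near. Qed.

Lemma cderivable_cmeas (f : plane R -> R[i]) :
  (forall k p, cderivable k f p) -> cmeas f.
Proof.
move=> df; split.
  apply: measurable_caratheodory => [x t|t x]; apply: differentiable_continuous;
    apply/derivable1_diffP.
    by have [+ _] := df true (x, t); rewrite sliceE.
  by have [+ _] := df false (x, t); rewrite sliceE.
apply: measurable_caratheodory => [x t|t x]; apply: differentiable_continuous;
  apply/derivable1_diffP.
  by have [_] := df true (x, t); rewrite sliceE.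
by have [_] := df false (x, t); rewrite sliceE.
Qed.

Lemma schwartz_cmeas (f : plane R -> R[i]) : schwartz f -> cmeas f.
Proof. by move=> Sf; apply: cderivable_cmeas => k p; exact: schwartz_cderivable. Qed.

End Caratheodory.

(** * Integrable weights *)

Section Weights.
Context {R : realType}.
Local Notation mu := (@lebesgue_measure R).

Lemma continuous_bracket_powR (r : R) : continuous (fun x : R => (1 + `|x|) `^ r).
Proof.
move=> x; have x0 : 0 < 1 + `|x| by rewrite ltr_pwDl.
apply: (@continuous_comp _ _ _ (fun x : R => 1 + `|x|) (@powR R ^~ r)).
  by apply: cvgD; [exact: cvg_cst|exact: norm_continuous].
apply/differentiable_continuous/derivable1_diffP.
have [h _] := is_derive1_powR r x0; exact: h.
Qed.

Lemma measurable_bracket_powR (r : R) :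
  measurable_fun setT (fun x : R => (1 + `|x|) `^ r).
Proof. by apply: continuous_measurable_fun; exact: continuous_bracket_powR. Qed.

Lemma cvg_bracket_powR (s : R) : 0 < s ->
  (1 + x) `^ (- s) @[x --> +oo] --> (0 : R).
Proof.
move=> s0; apply/cvgrPdist_le => e e0; near=> x.
rewrite sub0r normrN ger0_norm ?powR_ge0//.
have y0 : 0 < e `^ (- s^-1) by rewrite powR_gt0.
have yx : e `^ (- s^-1) <= 1 + x.
  apply: (@le_trans _ _ x); last by rewrite lerDr.
  by near: x; apply: nbhs_pinfty_ge; rewrite num_real.
rewrite powRN -[leRHS]invrK lef_pV2 ?posrE ?invr_gt0// ?powR_gt0 ?(lt_le_trans y0)//.
have -> : e^-1 = (e `^ (- s^-1)) `^ s.
  by rewrite -powRrM mulNr mulVf ?gt_eqF// powR_inv1// ltW.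
by rewrite ge0_ler_powR// ?nnegrE ?ltW// (lt_le_trans y0).
Unshelve. all: by end_near. Qed.

Lemma integral_bracket_powR_lty (r : R) : 1 < r ->
  (\int[mu]_x ((1 + `|x|) `^ (- r))%:E < +oo)%E.
Proof.
move=> r1; rewrite ge0_symfun_integralT; last 3 first.
- by move=> x; exact: powR_ge0.
- exact: continuous_bracket_powR.
- by move=> x /=; rewrite normrN.
pose F (x : R) : R := - (r - 1)^-1 * (1 + x) `^ (- (r - 1)).
have r10 : 0 < r - 1 by rewrite subr_gt0.
have dF (x : R) : 0 <= x -> is_derive x 1 F ((1 + x) `^ (- r)).
  move=> x0; have x1 : 0 < 1 + x by rewrite ltr_pwDl.
  have d1 : is_derive x 1 (fun y : R => 1 + y) 1.
    by have := is_deriveD (is_derive_cst (1 : R) x 1) (is_derive_id x 1); rewrite add0r.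
  have d2 := is_derive1_powR (- (r - 1)) x1.
  have d3 := @is_derive1_comp _ (@powR R ^~ (- (r - 1))) (fun y : R => 1 + y) x _ _ d2 d1.
  have d4 := is_deriveZ (- (r - 1)^-1) d3.
  refine (is_derive_eq d4 _).
  rewrite /GRing.scale/= mulr1 mulrA mulrNN mulVf ?gt_eqF// mul1r.
  by congr (_ `^ _); ring.
rewrite -set_itvcy.
have -> : (\int[mu]_(x in `[0%R, +oo[) ((1 + `|x|) `^ (- r))%R%:E =
    \int[mu]_(x in `[0%R, +oo[) ((1 + x) `^ (- r))%R%:E)%E.
  apply: eq_integral => x.
  by rewrite inE/= in_itv/= andbT => x0; rewrite ger0_norm.
rewrite (@ge0_continuous_FTC2y _ (fun x => (1 + x) `^ (- r)) F 0 0)//.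
- by rewrite -EFinB lte_mul_pinfty// ltry.
- by move=> x _; exact: powR_ge0.
- apply: (@subspace_eq_continuous _ _ _ (fun x : R => (1 + `|x|) `^ (- r))).
    by move=> x; rewrite inE/= in_itv/= andbT => x0; rewrite ger0_norm.
  by apply: continuous_subspaceT; exact: continuous_bracket_powR.
- rewrite -[X in _ --> X](mulr0 (- (r - 1)^-1)).
  by apply: cvgM; [exact: cvg_cst|exact: cvg_bracket_powR].
- by move=> x x0; have [] := dF x (ltW x0).
- apply: cvg_at_right_filter; apply: differentiable_continuous; apply/derivable1_diffP.
  by have [] := dF 0 (lexx _).
- move=> x; rewrite in_itv/= andbT => x0; rewrite derive1E.
  by have [] := dF x (ltW x0).
Qed.

Lemma plane_weight_lty (r s : R) : 1 < r -> 1 < s ->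
  (\int[leb2 R]_p ((1 + `|p.1|) `^ (- r) * (1 + `|p.2|) `^ (- s))%:E < +oo)%E.
Proof.
move=> r1 s1; have ms := measurable_bracket_powR (- s).
have mr := measurable_bracket_powR (- r).
rewrite fubini_tonelli1; last 2 first.
- by mfun.
- by move=> p; rewrite lee_fin mulr_ge0 ?powR_ge0.
have ws0 : (0 <= \int[mu]_y ((1 + `|y|) `^ (- s))%:E)%E.
  by apply: integral_ge0 => y _; rewrite lee_fin powR_ge0.
have -> : (\int[mu]_x fubini_F mu
      (fun p : plane R => ((1 + `|p.1|) `^ (- r) * (1 + `|p.2|) `^ (- s))%:E) x =
    \int[mu]_x ((\int[mu]_y ((1 + `|y|) `^ (- s))%:E) * ((1 + `|x|) `^ (- r))%:E))%E.
  apply: eq_integral => x _; rewrite muleC /fubini_F/=.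
  rewrite -(@ge0_integralZl _ _ _ mu setT measurableT (fun y => ((1 + `|y|) `^ (- s))%:E))//.
  exact/measurable_EFinP.
rewrite (@ge0_integralZl _ _ _ mu setT measurableT (fun y => ((1 + `|y|) `^ (- r))%:E))//.
- rewrite lte_mul_pinfty ?integral_bracket_powR_lty//.
  by rewrite ge0_fin_numE ?integral_bracket_powR_lty.
- exact/measurable_EFinP.
Qed.

(** A fourth power because (1 + |x| + |t|)^2 dominates (1 + |x|)(1 + |t|), so that the inverse lies
    below a product of two integrable inverse squares. *)
Definition pweight (p : plane R) : R := (1 + `|p.1| + `|p.2|) ^+ 4.

Lemma pweight_gt0 p : 0 < pweight p.
Proof. by rewrite exprn_gt0// (lt_le_trans ltr01)// weight_ge1. Qed.

Lemma measurable_pweightV : measurable_fun setT (fun p : plane R => (pweight p)^-1).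
Proof.
have -> : (fun p : plane R => (pweight p)^-1) =
    (fun p => (1 + `|p.1| + `|p.2|) `^ (-4)).
  by apply/funext => p; rewrite powR_invn// (le_trans ler01)// weight_ge1.
by mfun.
Qed.

Lemma pweightV_lty : (\int[leb2 R]_p (pweight p)^-1%:E < +oo)%E.
Proof.
have h : 1 < 2 :> R by rewrite ltr1n.
apply: le_lt_trans (plane_weight_lty h h).
apply: ge0_le_integral => //.
- by move=> p _; rewrite lee_fin invr_ge0 ltW// pweight_gt0.
- by apply/measurable_EFinP; exact: measurable_pweightV.
- by mfun.
move=> p _; rewrite lee_fin !powR_invn//.
rewrite -invfM lef_pV2 ?posrE ?pweight_gt0 ?mulr_gt0 ?exprn_gt0 ?ltr_pwDl//.
rewrite -exprMn /pweight (_ : 4 = 2 * 2)%N// exprM.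
rewrite lerXn2r ?nnegrE ?sqr_ge0 ?mulr_ge0 ?addr_ge0//.
have := normr_ge0 p.1; have := normr_ge0 p.2.
set x := `|p.1|; set y := `|p.2| => y0 x0.
rewrite -subr_ge0 (_ : _ - _ = x + y + x ^+ 2 + y ^+ 2 + x * y); last by ring.
by rewrite !addr_ge0 ?mulr_ge0 ?sqr_ge0.
Qed.

Lemma decay_L1 (f : plane R -> R[i]) M : cmeas f -> decay_le 4 f M -> L1 (leb2 R) f.
Proof.
move=> mf fM; apply: (@L1_le _ _ _ _ _ (fun p => M * (pweight p)^-1)) => //.
- by apply: measurable_funM => //; exact: measurable_pweightV.
- by move=> p; rewrite ler_pdivlMr ?pweight_gt0// mulrC; exact: fM.
- have M0 := decay_ge0 fM; under eq_integral do rewrite EFinM.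
  rewrite ge0_integralZl//.
  + by rewrite lte_mul_pinfty ?lee_fin// pweightV_lty.
  + by apply/measurable_EFinP; exact: measurable_pweightV.
  + by move=> p _; rewrite lee_fin invr_ge0 ltW// pweight_gt0.
Qed.

Lemma schwartz_L1 (f : plane R -> R[i]) : schwartz f -> L1 (leb2 R) f.
Proof.
move=> Sf; have [M fM] := schwartz_decay 4 Sf.
by apply: decay_L1 fM; exact: schwartz_cmeas.
Qed.

Lemma schwartz_bounded (f : plane R -> R[i]) : schwartz f ->
  exists M, 0 <= M /\ forall p, cabs (f p) <= M.
Proof.
move=> Sf; have [M fM] := schwartz_decay 0 Sf.
by exists M; split => [|p]; [exact: decay_ge0 fM|have := fM p; rewrite expr0 mul1r].
Qed.

End Weights.

(** * Vanishing of the integral of a derivative *)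

Section IntegralOfDerivative.
Context {R : realType}.
Local Notation mu := (@lebesgue_measure R).

(** On [-n-1, n+1] the integral is a difference of boundary values of F, each O(1/n) by the decay
    assumption, while dominated convergence recovers the full integral. *)
Lemma integral_derive0 (F f : R -> R) (M : R) :
  (forall x : R, is_derive x 1 F (f x)) -> continuous f ->
  mu.-integrable setT (EFin \o f) ->
  (forall x, `|F x| * (1 + `|x|) <= M) -> Rintegral mu setT f = 0.
Proof.
move=> dF cf fi FM.
pose A (n : nat) : set R := [set` `[- n.+1%:R, n.+1%:R]].
have mA n : measurable (A n) by exact: measurable_itv.
have mf : measurable_fun setT f by exact: continuous_measurable_fun.
have mfA n : measurable_fun setT (f \_ (A n)).
  by apply/(measurable_restrictT _ (mA n)); exact: measurable_funTS.
have cA : {ae mu, forall x : R, (f \_ (A n)) x @[n --> \oo] --> f x}.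
  apply: aeW => x; apply: cvg_near_cst; near=> n.
  rewrite patchE mem_set// /A/= in_itv/= -ler_norml.
  by rewrite (@le_trans _ _ n%:R)// ?ler_nat//; near: n; exact: nbhs_infty_ger.
have dA : {ae mu, forall x n, `|(f \_ (A n)) x| <= `|f x|}.
  by apply: aeW => x n; rewrite patchE; case: ifP => //; rewrite normr0.
have iy : (\int[mu]_x `|f x|%:E < +oo)%E by have /integrableP[_] := fi.
have [_ +] := @Rintegral_dominated _ _ _ mu _ _ _ mfA mf (mf_norm mf) cA dA iy (fun x => normr_ge0 _).
move=> /cvg_lim <-//; apply/cvg_lim => //.
have -> : (fun n => Rintegral mu setT (f \_ (A n))) =
    (fun n => F n.+1%:R - F (- n.+1%:R)).
  apply/funext => n; rewrite -Rintegral_mkcond /Rintegral.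
  rewrite (@continuous_FTC2 _ f F)//.
  - by rewrite -subr_gt0 opprK addr_gt0.
  - exact: continuous_subspaceT.
  - have cF : continuous F.
      move=> x; apply: differentiable_continuous; apply/derivable1_diffP.
      by have [] := dF x.
    split; first by move=> x _; have [] := dF x.
      by apply: cvg_at_right_filter; exact: cF.
    by apply: cvg_at_left_filter; exact: cF.
  - by move=> x _; rewrite derive1E; have [] := dF x.
have M0 : 0 <= M by apply: le_trans (FM 0); rewrite mulr_ge0.
apply/cvgrPdist_le => e e0; near=> n.
have n0 : (0 : R) < 1 + n.+1%:R by rewrite addr_gt0.
have h (s : R) : `|s| = 1 -> `|F (s * n.+1%:R)| <= M / (1 + n.+1%:R).
  move=> s1; rewrite ler_pdivlMr//; apply: le_trans (FM (s * n.+1%:R)).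
  by rewrite normrM s1 mul1r [`|n.+1%:R|]ger0_norm.
have := h 1 (normr1 _); have := h (-1) (normrN1 _); rewrite mul1r mulN1r => h1 h2.
rewrite sub0r normrN; apply: le_trans (ler_normB _ _) _.
apply: le_trans (lerD h2 h1) _.
rewrite -mulrDl ler_pdivrMr// -ler_pdivrMl//.
rewrite (@le_trans _ _ n%:R)//; first by near: n; exact: nbhs_infty_ger.
by rewrite -natr1; lra.
Unshelve. all: end_near. Qed.

Lemma Rintegral_prod1 (f : plane R -> R) :
  (leb2 R).-integrable setT (EFin \o f) ->
  Rintegral (leb2 R) setT f =
  Rintegral mu setT (fun x => Rintegral mu setT (fun y => f (x, y))).
Proof.
move=> fi; have iF := integrable_fubini_F fi.
rewrite {1}/Rintegral -(integral12_prod_meas1 fi); congr fine.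
apply: ae_eq_integral => //.
- exact: measurable_int iF.
- apply/measurable_EFinP; apply: measurable_Rintegral1.
  by have /integrableP[/measurable_EFinP] := fi.
- have := integrable_ae measurableT iF; apply: filterS => x h _ /=.
  by rewrite /Rintegral fineK//; exact: h.
Qed.

Lemma Rintegral_prod2 (f : plane R -> R) :
  (leb2 R).-integrable setT (EFin \o f) ->
  Rintegral (leb2 R) setT f =
  Rintegral mu setT (fun y => Rintegral mu setT (fun x => f (x, y))).
Proof. by move=> fi; rewrite (Rintegral_prod1 fi) (Rintegral_Fubini fi). Qed.

(** Fubini with the direction of derivation innermost: on almost every line the slice is integrable,
    and there the previous case gives zero. *)
Lemma Rintegral_partial0 k (H h : plane R -> R) (M : R) :
  (forall p, is_derive (plane_coord k p) 1 (fun y => H (upd k p y)) (h p)) ->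
  (forall p, continuous (fun y => h (upd k p y))) ->
  (leb2 R).-integrable setT (EFin \o h) ->
  (forall p, `|H p| * (1 + `|p.1| + `|p.2|) <= M) ->
  Rintegral (leb2 R) setT h = 0.
Proof.
move=> dH ch hi HM.
have M1 x y : `|H (x, y)| * (1 + `|x|) <= M.
  by apply: le_trans (HM (x, y)); rewrite ler_wpM2l//= lerDl.
have M2 x y : `|H (x, y)| * (1 + `|y|) <= M.
  by apply: le_trans (HM (x, y)); rewrite ler_wpM2l//= addrAC lerDl.
have [mh _] := integrableP _ _ _ hi; have {}mh := (measurable_EFinP _ _).1 mh.
have R0 (g : R -> R) : measurable_fun setT g -> {ae mu, forall x, g x = 0} ->
    Rintegral mu setT g = 0.
  move=> mg g0; rewrite (@ae_eq_Rintegral _ _ _ mu g (fun=> 0))//.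
  by rewrite /Rintegral integral0.
case: k dH ch => dH ch.
  rewrite (Rintegral_prod1 hi); apply: R0; first exact: measurable_Rintegral1.
  have := ae_integrable1 hi; apply: filterS => x hx.
  by apply: (@integral_derive0 (fun y => H (x, y)) (fun y => h (x, y)) M
    (fun y => dH (x, y)) (ch (x, 0)) hx) => y; exact: M2.
rewrite (Rintegral_prod2 hi); apply: R0; first exact: measurable_Rintegral2.
have := ae_integrable2 hi; apply: filterS => y hy.
by apply: (@integral_derive0 (fun x => H (x, y)) (fun x => h (x, y)) M
  (fun x => dH (x, y)) (ch (0, y)) hy) => x; exact: M1.
Qed.

End IntegralOfDerivative.

(** * The Fourier transform *)

Section FourierSchwartz.
Context {R : realType}.
Implicit Types (f : plane R -> R[i]) (p q : plane R).

Lemma coord_upd k p (y : R) : plane_coord k (upd k p y) = y.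
Proof. by case: k. Qed.

Lemma upd_upd k p (y z : R) : upd k (upd k p y) z = upd k p z.
Proof. by case: k. Qed.

Definition dot p q : R := p.1 * q.1 + p.2 * q.2.

Lemma fourierE f q :
  fourier f q = cintg (leb2 R) (fun p => cis (- dot p q) * f p).
Proof. by []. Qed.

Lemma dot_upd p k q y :
  dot p (upd k q y) = plane_coord k p * y + plane_coord (~~ k) p * plane_coord (~~ k) q.
Proof. by case: k; rewrite /dot/=// addrC. Qed.

Lemma dotC p q : dot p q = dot q p.
Proof. by rewrite /dot mulrC (mulrC p.2). Qed.

Lemma cmeas_cis_dot q : cmeas (fun p => cis (- dot p q)).
Proof. by apply: cmeas_cis; rewrite /dot; mfun. Qed.

Lemma L1_cisM f q : L1 (leb2 R) f -> L1 (leb2 R) (fun p => cis (- dot p q) * f p).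
Proof.
by apply: (@L1_mulb _ _ _ _ _ 1); [exact: cmeas_cis_dot|move=> p; rewrite cabs_cis].
Qed.

Lemma fourier_le f q : cmeas f ->
  ((cabs (fourier f q))%:E <= \int[leb2 R]_p (cabs (f p))%:E)%E.
Proof.
move=> mf; rewrite fourierE; apply: le_trans (cabs_cintg _ _) _.
  by apply: cmeasM => //; exact: cmeas_cis_dot.
by under eq_integral do rewrite cabsM cabs_cis mul1r.
Qed.

Lemma cmeas_fourier f : cmeas f -> cmeas (fourier f).
Proof.
move=> mf.
have h : cmeas (fun z : plane R * plane R => cis (- dot z.1 z.2) * f z.1).
  apply: cmeasM; last exact: (cmeas_comp mf (@mf_fst _ _ _ _)).
  apply: cmeas_cis; apply: mfN; apply: mfD; apply: mfM.
  - exact: (measurableT_comp measurable_fst measurable_fst).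
  - exact: (measurableT_comp measurable_fst measurable_snd).
  - exact: (measurableT_comp measurable_snd measurable_fst).
  - exact: (measurableT_comp measurable_snd measurable_snd).
exact: (cmeas_cintg2 sleb2 h).
Qed.

Lemma fourierZ (c : R[i]) f q : L1 (leb2 R) f ->
  fourier (fun p => c * f p) q = c * fourier f q.
Proof.
move=> Lf; rewrite !fourierE -cintgZ; last exact: L1_cisM.
by apply: eq_cintg => p; rewrite mulrCA.
Qed.

Lemma fourierD f g q : L1 (leb2 R) f -> L1 (leb2 R) g ->
  fourier (fun p => f p + g p) q = fourier f q + fourier g q.
Proof.
move=> Lf Lg; rewrite !fourierE -cintgD; [|exact: L1_cisM..].
by apply: eq_cintg => p; rewrite mulrDr.
Qed.

Lemma cder_cis k (t : plane R -> R) q (t' : R) :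
  is_derive (plane_coord k q) 1 (fun y => t (upd k q y)) t' ->
  cder k (fun q => cis (t q)) q ('i * t'%:C * cis (t q)).
Proof.
move=> dt; have dc := is_derive1_comp (is_derive_cos _) dt.
have ds := is_derive1_comp (is_derive_sin _) dt.
split.
  by refine (is_derive_eq dc _); rewrite upd_id !(cReM, cImM)/=; ring.
by refine (is_derive_eq ds _); rewrite upd_id !(cReM, cImM)/=; ring.
Qed.

Lemma is_derive_dot k p q :
  is_derive (plane_coord k q) 1 (fun y => - dot p (upd k q y)) (- plane_coord k p).
Proof.
have -> : (fun y => - dot p (upd k q y)) =
    (fun y => - (plane_coord k p * y + plane_coord (~~ k) p * plane_coord (~~ k) q)).
  by apply/funext => y; rewrite dot_upd.
refine (is_derive_eq (is_deriveN (is_deriveD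
  (is_deriveZ (plane_coord k p) (is_derive_id _ _)) (is_derive_cst _ _ _))) _).
by rewrite addr0 /GRing.scale/= mulr1.
Qed.

Lemma cder_cis_dot k p q :
  cder k (fun q => cis (- dot p q)) q (- 'i * (plane_coord k p)%:C * cis (- dot p q)).
Proof.
apply: cder_eq (cder_cis (is_derive_dot k p q)).
by apply: eqcP; rewrite !(cReM, cImM)/=; ring.
Qed.

Lemma cder_fourier f k q : L1 (leb2 R) f ->
  L1 (leb2 R) (fun p => (plane_coord k p)%:C * f p) ->
  cder k (fourier f) q (fourier (fun p => - 'i * ((plane_coord k p)%:C * f p)) q).
Proof.
move=> Lf Lxf.
have dE p r : cder k (fun q => cis (- dot p q) * f p) r
    (cis (- dot p r) * (- 'i * ((plane_coord k p)%:C * f p))).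
  apply: cder_eq (cderM (cder_cis_dot k p r) (cder_cst k (f p) r)).
  by rewrite mulr0 add0r; ring.
have [my iy] := Lxf.
have iG : (leb2 R).-integrable setT (EFin \o (fun p => cabs ((plane_coord k p)%:C * f p))).
  apply/integrableP; split; first exact: measurable_ecabs.
  by under eq_integral do rewrite gee0_abs ?lee_fin ?cabs_ge0//.
have Lq r : L1 (leb2 R) (fun p => cis (- dot p r) * f p) by exact: L1_cisM.
have G0 p : 0 <= cabs ((plane_coord k p)%:C * f p) by exact: cabs_ge0.
have Gi r p : cabs (cis (- dot p r) * (- 'i * ((plane_coord k p)%:C * f p))) <=
    cabs ((plane_coord k p)%:C * f p).
  rewrite cabsM cabs_cis mul1r (cabsM (- 'i)) cabsN [cabs 'i]cabsE/=.
  by rewrite expr0n expr1n/= add0r sqrtr1 mul1r.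
set y0 := plane_coord k q.
(* The dominating function is independent of the frequency, so any open interval around [y0]
   serves. *)
have Iy : `]y0 - 1, y0 + 1[%classic y0 by rewrite /= in_itv/= ltrBlDr ltrDl ltr01.
split.
  pose F (y : R) (p : plane R) := complex.Re (cis (- dot p (upd k q y)) * f p).
  have dF (y : R) p : is_derive y 1 (F ^~ p)
      (complex.Re (cis (- dot p (upd k q y)) * (- 'i * ((plane_coord k p)%:C * f p)))).
    have [+ _] := dE p (upd k q y); rewrite coord_upd.
    by congr is_derive; apply/funext => z; rewrite /F upd_upd.
  have dF1 y p : partial1of2 F y p =
      complex.Re (cis (- dot p (upd k q y)) * (- 'i * ((plane_coord k p)%:C * f p))).
    by rewrite partial1of2E; have [] := dF y p.
  have h1 (y : R) : `]y0 - 1, y0 + 1[%classic y ->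
    (leb2 R).-integrable setT (EFin \o F y) by move=> _; exact: L1_Re.
  have h2 (y : R) p : `]y0 - 1, y0 + 1[%classic y -> [set: plane R] p ->
    derivable (F ^~ p) y 1 by move=> _ _; have [] := dF y p.
  have h3 (y : R) p : `]y0 - 1, y0 + 1[%classic y -> [set: plane R] p ->
      `|partial1of2 F y p| <= cabs ((plane_coord k p)%:C * f p).
    by move=> _ _; rewrite dF1; apply: le_trans (cabs_Re _) _; exact: Gi.
  apply: DeriveDef.
    exact: (@derivable_under_integral _ _ _ (leb2 R) F setT measurableT y0 _ _ Iy h1 h2 _ G0 iG h3).
  rewrite -derive1E.
  rewrite (@differentiation_under_integral _ _ _ (leb2 R) F setT measurableT y0 _ _ Iy h1 h2 _ G0 iG h3).
  by apply: eq_Rintegral => p _; rewrite dF1 upd_id.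
pose F (y : R) (p : plane R) := complex.Im (cis (- dot p (upd k q y)) * f p).
have dF (y : R) p : is_derive y 1 (F ^~ p)
    (complex.Im (cis (- dot p (upd k q y)) * (- 'i * ((plane_coord k p)%:C * f p)))).
  have [_] := dE p (upd k q y); rewrite coord_upd.
  by congr is_derive; apply/funext => z; rewrite /F upd_upd.
have dF1 y p : partial1of2 F y p =
    complex.Im (cis (- dot p (upd k q y)) * (- 'i * ((plane_coord k p)%:C * f p))).
  by rewrite partial1of2E; have [] := dF y p.
have h1 (y : R) : `]y0 - 1, y0 + 1[%classic y ->
  (leb2 R).-integrable setT (EFin \o F y) by move=> _; exact: L1_Im.
have h2 (y : R) p : `]y0 - 1, y0 + 1[%classic y -> [set: plane R] p ->
  derivable (F ^~ p) y 1 by move=> _ _; have [] := dF y p.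
have h3 (y : R) p : `]y0 - 1, y0 + 1[%classic y -> [set: plane R] p ->
    `|partial1of2 F y p| <= cabs ((plane_coord k p)%:C * f p).
  by move=> _ _; rewrite dF1; apply: le_trans (cabs_Im _) _; exact: Gi.
apply: DeriveDef.
  exact: (@derivable_under_integral _ _ _ (leb2 R) F setT measurableT y0 _ _ Iy h1 h2 _ G0 iG h3).
rewrite -derive1E.
rewrite (@differentiation_under_integral _ _ _ (leb2 R) F setT measurableT y0 _ _ Iy h1 h2 _ G0 iG h3).
by apply: eq_Rintegral => p _; rewrite dF1 upd_id.
Qed.

End FourierSchwartz.

Section FourierDerivatives.
Context {R : realType}.
Implicit Types (f : plane R -> R[i]) (p q : plane R).

Lemma cabs_i : cabs ('i : R[i]) = 1.
Proof. by rewrite cabsE/= expr0n expr1n/= add0r sqrtr1. Qed.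

Lemma cder_continuous k f : (forall p, exists z, cder k f p z) -> forall p,
  continuous (fun y => complex.Re (f (upd k p y))) /\
  continuous (fun y => complex.Im (f (upd k p y))).
Proof.
move=> df p; split=> y; apply: differentiable_continuous; apply/derivable1_diffP;
  have [z [d1 d2]] := df (upd k p y); rewrite coord_upd in d1 d2.
  have [h _] := d1.
  have E : (fun v => complex.Re (f (upd k (upd k p y) v))) =
    (fun v => complex.Re (f (upd k p v))) by apply/funext => v; rewrite upd_upd.
  by rewrite E in h.
have [h _] := d2.
have E : (fun v => complex.Im (f (upd k (upd k p y) v))) =
  (fun v => complex.Im (f (upd k p v))) by apply/funext => v; rewrite upd_upd.
by rewrite E in h.
Qed.

Lemma cintg_partial0 k (H h : plane R -> R[i]) (M : R) :
  (forall p, cder k H p (h p)) -> (forall p, exists z, cder k h p z) ->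
  L1 (leb2 R) h -> decay_le 1 H M -> cintg (leb2 R) h = 0.
Proof.
move=> dH dh Lh HM; have ch := cder_continuous dh.
have HM' p : cabs (H p) * (1 + `|p.1| + `|p.2|) <= M.
  by rewrite mulrC -[X in X * _]expr1; exact: HM.
apply: eqcP => /=.
  apply: (@Rintegral_partial0 _ k (fun p => complex.Re (H p)) _ M).
  - by move=> p; exact: (dH p).1.
  - by move=> p; exact: (ch p).1.
  - exact: L1_Re.
  - by move=> p; apply: le_trans (HM' p); rewrite ler_wpM2r ?cabs_Re ?addr_ge0.
apply: (@Rintegral_partial0 _ k (fun p => complex.Im (H p)) _ M).
- by move=> p; exact: (dH p).2.
- by move=> p; exact: (ch p).2.
- exact: L1_Im.
- by move=> p; apply: le_trans (HM' p); rewrite ler_wpM2r ?cabs_Im ?addr_ge0.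
Qed.

(** Integration by parts, in the form that the derivative [h] of the product of f with the character
    integrates to zero. *)
Lemma fourier_partial f k q : schwartz f ->
  fourier (partial k f) q = 'i * (plane_coord k q)%:C * fourier f q.
Proof.
move=> Sf; have Sdf := schwartz_partial k Sf.
have [Lf Ldf] := (schwartz_L1 Sf, schwartz_L1 Sdf).
pose e p : R[i] := cis (- dot p q).
have de p : cder k e p (- 'i * (plane_coord k q)%:C * e p).
  have -> : e = fun p => cis (- dot q p).
    by apply/funext => r; rewrite /e dotC.
  exact: cder_cis_dot.
pose h p := e p * partial k f p + - 'i * (plane_coord k q)%:C * (e p * f p).
have dH p : cder k (fun p => e p * f p) p (h p).
  apply: cder_eq (cderM (de p) (schwartz_cder k p Sf)).
  by rewrite /h; congr (_ + _); rewrite mulrA.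
have dh p : exists z, cder k h p z.
  eexists; apply: cderD; first exact: cderM (de p) (schwartz_cder k p Sdf).
  by apply: cderM; [exact: cder_cst|exact: dH].
have Le : L1 (leb2 R) (fun p => e p * f p) by exact: L1_cisM.
have Lh : L1 (leb2 R) h by apply: L1D; [exact: L1_cisM|exact: L1Z].
have [M fM] := schwartz_decay 1 Sf.
have HM : decay_le 1 (fun p => e p * f p) M.
  by move=> p; rewrite cabsM cabs_cis mul1r; exact: fM.
have := cintg_partial0 dH dh Lh HM.
rewrite /h cintgD ?cintgZ//; [|exact: L1_cisM|exact: L1Z].
by move=> /eqP; rewrite addr_eq0 !mulNr opprK => /eqP.
Qed.

(** Coinduction on the class of transforms of Schwartz functions. It is stable under [partial] by
    [cder_fourier], and each power of the weight is traded for one derivative through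
    [fourier_partial]. *)
Lemma schwartz_fourier f : schwartz f -> schwartz (fourier f).
Proof.
move=> Sf; apply: (@schwartz_coind _ (fun g => exists2 h, schwartz h & g = fourier h));
  last by exists f.
- move=> _ k q [h Sh ->].
  by apply: (cderP (cder_fourier _ _ _)).1; apply: schwartz_L1 => //;
    exact: schwartz_coord.
- move=> _ n [h Sh ->]; elim: n h Sh => [h Sh|n IH h Sh].
    exists (fine (\int[leb2 R]_p (cabs (h p))%:E)) => q.
    rewrite expr0 mul1r -lee_fin fineK; first exact: fourier_le (schwartz_cmeas Sh).
    have [_ hy] := schwartz_L1 Sh; rewrite ge0_fin_numE//.
    by apply: integral_ge0 => p _; rewrite lee_fin cabs_ge0.
  have [M0 H0] := IH h Sh.
  have [M1 H1] := IH _ (schwartz_partial false Sh).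
  have [M2 H2] := IH _ (schwartz_partial true Sh).
  exists (M0 + M1 + M2) => q.
  rewrite exprSr -mulrA.
  apply: le_trans (lerD (lerD (H0 q) (H1 q)) (H2 q)).
  rewrite !fourier_partial// !cabsM cabs_i !cabsR.
  by rewrite !mul1r -!mulrDr !mulrDl mul1r.
- move=> _ k [h Sh ->]; exists (fun p => - 'i * ((plane_coord k p)%:C * h p)).
    by apply: schwartzZ; exact: schwartz_coord.
  apply/funext => q; apply: (cderP (cder_fourier _ _ _)).2; apply: schwartz_L1 => //.
  exact: schwartz_coord.
Qed.

End FourierDerivatives.

(** * Gaussians as Schwartz functions *)

Section Gaussian.
Context {R : realType}.
Implicit Types (p q : plane R).

Definition gauss2 (al be : R) (a p : plane R) : R :=
  expR (- (al * (p.1 - a.1) ^+ 2 + be * (p.2 - a.2) ^+ 2)).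

Lemma bracket_gauss_bounded (al a : R) (n : nat) : 0 < al ->
  exists M, forall x : R, (1 + `|x|) ^+ n * expR (- (al * (x - a) ^+ 2)) <= M.
Proof.
(* The power is below n! e^(1 + |x|). Then |x| <= |a| + |x - a|, and completing the square absorbs
   |x - a| into al (x - a)^2 at the price of 1/(4 al). *)
move=> al0; exists (n`!%:R * expR (1 + `|a| + (4 * al)^-1)) => x.
have y0 : 0 <= 1 + `|x| by rewrite addr_ge0.
have h1 : (1 + `|x|) ^+ n <= n`!%:R * expR (1 + `|x|).
  case: n => [|n]; first by rewrite expr0 fact0 mul1r -expR0 ler_expR.
  rewrite -ler_pdivrMl ?ltr0n ?fact_gt0//.
  apply: le_trans (expR_ge1Dxn n y0).
  by rewrite mulrC lerDr.
apply: (@le_trans _ _ (n`!%:R * expR (1 + `|x|) * expR (- (al * (x - a) ^+ 2)))).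
  by rewrite ler_wpM2r// expR_ge0.
rewrite -mulrA -expRD ler_wpM2l// ler_expR.
have h2 : `|x| <= `|x - a| + `|a| by rewrite -[X in `|X| <= _](subrK a) ler_normD.
have h3 : `|x - a| <= al * (x - a) ^+ 2 + (4 * al)^-1.
  rewrite -(real_normK (num_real (x - a))) -subr_ge0.
  rewrite (_ : _ - _ = al * (`|x - a| - (2 * al)^-1) ^+ 2).
    by rewrite mulr_ge0 ?sqr_ge0// ltW.
  by field; rewrite gt_eqF.
lra.
Qed.

Lemma cder_gauss2 (al be : R) (a p : plane R) k :
  cder k (fun p => (gauss2 al be a p)%:C) p
    (- (2 * (if k then be else al) * (plane_coord k p - plane_coord k a)) *
     gauss2 al be a p)%:C.
Proof.
pose co k := if k then be else al.
pose rest := co (~~ k) * (plane_coord (~~ k) p - plane_coord (~~ k) a) ^+ 2.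
have gE (y : R) : gauss2 al be a (upd k p y) =
    expR (- (co k * (y - plane_coord k a) ^+ 2 + rest)).
  by rewrite /gauss2 /rest /co; case: k {rest} => //=; rewrite addrC.
have dl : is_derive (plane_coord k p) 1
    (fun y : R => - (co k * (y - plane_coord k a) ^+ 2 + rest))
    (- (2 * co k * (plane_coord k p - plane_coord k a))).
  have d1 := is_deriveB (is_derive_id (plane_coord k p) (1:R))
    (is_derive_cst (plane_coord k a) (plane_coord k p) (1:R)).
  have d2 := is_deriveN (is_deriveD (is_deriveZ (co k) (is_deriveX 2 d1))
    (is_derive_cst rest (plane_coord k p) (1:R))).
  refine (is_derive_eq d2 _).
  rewrite /GRing.scale/= subr0 addr0 expr1 mulr1.
  transitivity (- (co k * (2 * (plane_coord k p - plane_coord k a)))) => //.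
  by ring.
have de := is_derive1_comp (is_derive_expR _) dl.
split => /=; last exact: is_derive_cst.
rewrite (_ : (fun y => _) = expR \o
    (fun y : R => - (co k * (y - plane_coord k a) ^+ 2 + rest))); last first.
  by apply/funext => y; rewrite gE.
refine (is_derive_eq de _).
by rewrite -gE upd_id /co; ring.
Qed.

Lemma schwartz_gauss2 (al be : R) (a : plane R) : 0 < al -> 0 < be ->
  schwartz (fun p => (gauss2 al be a p)%:C).
Proof.
move=> al0 be0.
pose g p : R[i] := (gauss2 al be a p)%:C.
pose co k := if k then be else al.
have dg k p : cder k g p ((- (2 * co k))%:C * ((plane_coord k p)%:C * g p) +
    ((2 * co k * plane_coord k a)%:C * g p)).
  apply: cder_eq (cder_gauss2 al be a p k).
  by apply: eqcP; rewrite !(cReD, cImD, cReM, cImM)/= /co; ring.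
apply: (@coord_span_schwartz _ (fun f => f = g)); last by apply: span_base.
- by move=> _ k p ->; exact: (cderP (dg k p)).1.
- move=> _ n ->.
  have [M1 H1] := bracket_gauss_bounded a.1 n al0.
  have [M2 H2] := bracket_gauss_bounded a.2 n be0.
  exists (M1 * M2) => p.
  rewrite cabsR [`|gauss2 _ _ _ _|]ger0_norm ?expR_ge0// /gauss2 opprD expRD.
  have h : (1 + `|p.1| + `|p.2|) ^+ n <= (1 + `|p.1|) ^+ n * (1 + `|p.2|) ^+ n.
    rewrite -exprMn lerXn2r ?nnegrE ?mulr_ge0 ?addr_ge0//.
    have := mulr_ge0 (normr_ge0 p.1) (normr_ge0 p.2); lra.
  apply: (@le_trans _ _ ((1 + `|p.1|) ^+ n * (1 + `|p.2|) ^+ n *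
    (expR (- (al * (p.1 - a.1) ^+ 2)) * expR (- (be * (p.2 - a.2) ^+ 2))))).
    by rewrite ler_wpM2r// mulr_ge0 ?expR_ge0.
  rewrite mulrACA ler_pM// ?mulr_ge0 ?expR_ge0 ?exprn_ge0 ?addr_ge0//.
- move=> _ k ->.
  (* [span_lin] adds its last term with coefficient one; the [- 1] compensates for the trailing
     [g p]. *)
  rewrite (_ : partial k g = fun p =>
    (- (2 * co k))%:C * ((plane_coord k p)%:C * g p) +
    ((2 * co k * plane_coord k a - 1)%:C * g p + g p)); last first.
    apply/funext => p; rewrite (cderP (dg k p)).2.
    by apply: eqcP; rewrite !(cReD, cImD, cReM, cImM)/=; ring.
  apply: span_lin; first by apply: span_coord; apply: span_base.
  by apply: span_lin; apply: span_base.
Qed.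

End Gaussian.

(** * Bounded kernels and the multiplication formula *)

Section Kernel.
Context {R : realType}.
Implicit Types (f g : plane R -> R[i]) (p q : plane R).
Local Notation C := R[i].

Lemma L1_tensor (k : plane R * plane R -> C) (M : R) f g :
  cmeas k -> (forall z, cabs (k z) <= M) -> L1 (leb2 R) f -> L1 (leb2 R) g ->
  L1 (sleb2 \x sleb2)%E (fun z => k z * (f z.1 * g z.2)).
Proof.
move=> mk kM [mf fy] [mg gy].
have mfg : cmeas (fun z : plane R * plane R => f z.1 * g z.2).
  by apply: cmeasM; [exact: (cmeas_comp mf (@mf_fst _ _ _ _))|
                     exact: (cmeas_comp mg (@mf_snd _ _ _ _))].
apply: (@L1_mulb _ _ _ _ k M) => //.
apply: (@L1_prod _ _ _ _ _ sleb2 sleb2) => //.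
have g0 : (0 <= \int[leb2 R]_y (cabs (g y))%:E)%E.
  by apply: integral_ge0 => y _; rewrite lee_fin cabs_ge0.
rewrite [ltLHS](_ : _ = \int[leb2 R]_x
    ((\int[leb2 R]_y (cabs (g y))%:E) * (cabs (f x))%:E))%E; last first.
  apply: eq_integral => x _; rewrite muleC -ge0_integralZl//.
  - by apply: eq_integral => y _ /=; rewrite cabsM EFinM.
  - exact: measurable_ecabs.
  - by move=> y _; rewrite lee_fin cabs_ge0.
  - by rewrite lee_fin cabs_ge0.
rewrite ge0_integralZl//.
- by rewrite lte_mul_pinfty// ge0_fin_numE.
- exact: measurable_ecabs.
- by move=> x _; rewrite lee_fin cabs_ge0.
Qed.

(** The common source of both multiplication formulas and of the transfer of a gaussian average from
    one factor to the other in [kills_rect]. *)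
Lemma fubini_kernel (k : plane R * plane R -> C) (M : R) f g :
  cmeas k -> (forall z, cabs (k z) <= M) -> L1 (leb2 R) f -> L1 (leb2 R) g ->
  cintg (leb2 R) (fun x => f x * cintg (leb2 R) (fun y => k (x, y) * g y)) =
  cintg (leb2 R) (fun y => g y * cintg (leb2 R) (fun x => k (x, y) * f x)).
Proof.
move=> mk kM Lf Lg; have LT := L1_tensor mk kM Lf Lg.
have mk1 x : cmeas (fun y => k (x, y)).
  by apply: (cmeas_comp mk); exact: pair1_measurable.
have mk2 y : cmeas (fun x => k (x, y)).
  by apply: (cmeas_comp mk); exact: pair2_measurable.
transitivity (cintg sleb2 (fun x => cintg sleb2 (fun y => k (x, y) * (f x * g y)))).
  apply: eq_cintg => x; rewrite -cintgZ.
    by apply: eq_cintg => y; rewrite mulrCA.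
  exact: (L1_mulb (mk1 x)).
rewrite (cintg_Fubini LT); apply: eq_cintg => y; rewrite -cintgZ.
  by apply: eq_cintg => x /=; rewrite mulrA mulrC.
exact: (L1_mulb (mk2 y)).
Qed.

Lemma cmeas_cis_dot2 (s : R) :
  cmeas (fun z : plane R * plane R => cis (s * dot z.1 z.2)).
Proof.
apply: cmeas_cis; apply: mfM; first exact: measurable_cst.
apply: mfD; apply: mfM.
- exact: (measurableT_comp measurable_fst measurable_fst).
- exact: (measurableT_comp measurable_fst measurable_snd).
- exact: (measurableT_comp measurable_snd measurable_fst).
- exact: (measurableT_comp measurable_snd measurable_snd).
Qed.

(* Without the normalizing factor, see [fourierK]. *)
Definition ifourier f q : C := cintg (leb2 R) (fun p => cis (dot p q) * f p).

Definition popp p : plane R := (- p.1, - p.2).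

Lemma dotNr p q : dot p (popp q) = - dot p q.
Proof. by rewrite /dot/= !mulrN opprD. Qed.

Lemma ifourierE f q : ifourier f q = fourier f (popp q).
Proof. by apply: eq_cintg => p; rewrite -/(dot p (popp q)) dotNr opprK. Qed.

Lemma popK p : popp (popp p) = p.
Proof. by case: p => x y; rewrite /popp/= !opprK. Qed.

Lemma fourier_popp f q : fourier f q = ifourier f (popp q).
Proof. by rewrite ifourierE popK. Qed.

Lemma fourier_mult f g : L1 (leb2 R) f -> L1 (leb2 R) g ->
  cintg (leb2 R) (fun x => f x * fourier g x) =
  cintg (leb2 R) (fun y => g y * fourier f y).
Proof.
move=> Lf Lg.
have h z : cabs (cis (-1 * dot z.1 z.2) : C) <= 1 by rewrite cabs_cis.
have := fubini_kernel (cmeas_cis_dot2 (-1)) h Lf Lg => /= E.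
transitivity (cintg (leb2 R) (fun x => f x *
    cintg (leb2 R) (fun y => cis (-1 * dot x y) * g y))).
  by apply: eq_cintg => x; congr (_ * _); apply: eq_cintg => y; rewrite mulN1r dotC.
rewrite E; apply: eq_cintg => y; congr (_ * _).
by apply: eq_cintg => x; rewrite mulN1r.
Qed.

Lemma ifourier_mult f g : L1 (leb2 R) f -> L1 (leb2 R) g ->
  cintg (leb2 R) (fun x => f x * ifourier g x) =
  cintg (leb2 R) (fun y => g y * ifourier f y).
Proof.
move=> Lf Lg.
have h z : cabs (cis (1 * dot z.1 z.2) : C) <= 1 by rewrite cabs_cis.
have := fubini_kernel (cmeas_cis_dot2 1) h Lf Lg => /= E.
transitivity (cintg (leb2 R) (fun x => f x *
    cintg (leb2 R) (fun y => cis (1 * dot x y) * g y))).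
  by apply: eq_cintg => x; congr (_ * _); apply: eq_cintg => y; rewrite mul1r dotC.
rewrite E; apply: eq_cintg => y; congr (_ * _).
by apply: eq_cintg => x; rewrite mul1r.
Qed.

End Kernel.

(** * Gaussian regularization and inversion *)

Section GaussianTransform.
Context {R : realType}.
Implicit Types (f g : plane R -> R[i]) (p q : plane R).

Definition gauss p : R := gauss2 2^-1 2^-1 (0, 0) p.
Definition gaussc p : R[i] := (gauss p)%:C.

Lemma gaussE p : gauss p = expR (- ((p.1 ^+ 2 + p.2 ^+ 2) / 2)).
Proof. by rewrite /gauss /gauss2/= !subr0; congr expR; ring. Qed.

Lemma gauss_gt0 p : 0 < gauss p.
Proof. exact: expR_gt0. Qed.

Lemma gauss_le1 p : gauss p <= 1.
Proof.
rewrite gaussE expR_le1 oppr_le0 divr_ge0// addr_ge0// sqr_ge0//.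
Qed.

Lemma schwartz_gaussc : schwartz gaussc.
Proof. by apply: schwartz_gauss2; rewrite invr_gt0. Qed.

Lemma measurable_gauss : measurable_fun setT gauss.
Proof. exact: (schwartz_cmeas schwartz_gaussc).1. Qed.

Lemma partial_gaussc k p : partial k gaussc p = - ((plane_coord k p)%:C * gaussc p).
Proof.
rewrite (cderP (cder_gauss2 2^-1 2^-1 (0, 0) p k)).2.
apply: eqcP; rewrite ?cReM ?cImM/=; last by rewrite mulr0 mul0r addr0 oppr0.
by case: k => /=; rewrite subr0 mulfV// mul1r mulNr mul0r subr0.
Qed.

(** This is 2 pi, carried symbolically. *)
Definition gauss_mass : R := Rintegral (leb2 R) setT gauss.

Lemma gauss_lty : (\int[leb2 R]_p (gauss p)%:E < +oo)%E.
Proof.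
have [_] := schwartz_L1 schwartz_gaussc.
by under eq_integral do rewrite cabsR ger0_norm ?(ltW (gauss_gt0 _))//.
Qed.

Lemma gauss_massE : (\int[leb2 R]_p (gauss p)%:E)%E = gauss_mass%:E.
Proof.
rewrite /gauss_mass /Rintegral fineK// ge0_fin_numE ?gauss_lty//.
by apply: integral_ge0 => p _; rewrite lee_fin ltW// gauss_gt0.
Qed.

Lemma gauss_mass_gt0 : 0 < gauss_mass.
Proof.
rewrite -lte_fin -gauss_massE.
have l1 : @lebesgue_measure R [set` `[0%R, 1%R]] = 1%E.
  by rewrite lebesgue_measure_itv/= lte_fin ltr01 -EFinB subr0.
(* On the unit square the exponent is at least -1, so the mass is at least e^(-1). *)
pose A : set (plane R) := [set` `[0%R, 1%R]] `*` [set` `[0%R, 1%R]].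
have mu1 : leb2 R A = 1%E.
  rewrite product_measure1E; [|exact: measurable_itv..].
  by transitivity (1 * 1 : \bar R)%E; [congr (_ * _)%E; exact: l1|rewrite mule1].
have mA : measurable A by exact: measurableX.
have iA : (\int[leb2 R]_(p in A) (expR (-1))%:E = (expR (-1))%:E)%E.
  rewrite integral_cst//; transitivity ((expR (-1 : R))%:E * 1)%E; last by rewrite mule1.
  by congr (_ * _)%E; exact: mu1.
apply: (@lt_le_trans _ _ (\int[leb2 R]_(p in A) (expR (-1))%:E)%E).
  by rewrite iA lte_fin expR_gt0.
rewrite [leLHS](integral_mkcond A); apply: ge0_le_integral => //.
- by move=> p _; rewrite patchE; case: ifP => // _; rewrite lee_fin expR_ge0.
- by apply/(measurable_restrictT _ mA); exact: measurable_cst.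
- by apply: mf_EFin; exact: measurable_gauss.
move=> p _; rewrite patchE; case: ifPn => [|_]; last by rewrite lee_fin ltW// gauss_gt0.
rewrite inE/= => -[]/=; rewrite !in_itv/= => /andP[x0 x1] /andP[y0 y1].
rewrite lee_fin gaussE ler_expR lerN2 ler_pdivrMr// mul1r.
by rewrite (_ : 2 = 1 + 1)// lerD// expr_le1.
Qed.

(** The transform F satisfies the same equations as the gaussian, d_k F = - q_k F. Hence e^(|q|^2/2)
    F has vanishing partial derivatives and equals its value at the origin, which is the total
    mass. *)
Lemma fourier_gaussc q : fourier gaussc q = (gauss_mass * gauss q)%:C.
Proof.
have SG := schwartz_gaussc; have LG := schwartz_L1 SG.
pose E p : R[i] := (expR ((p.1 ^+ 2 + p.2 ^+ 2) / 2))%:C.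
have dE k p : cder k E p ((plane_coord k p)%:C * E p).
  pose rest := plane_coord (~~ k) p ^+ 2 / 2.
  have EE (y : R) : expR (((upd k p y).1 ^+ 2 + (upd k p y).2 ^+ 2) / 2) =
      expR (y ^+ 2 / 2 + rest).
    by congr expR; rewrite /rest; case: k {rest} => /=; ring.
  have dl : is_derive (plane_coord k p) 1 (fun y : R => y ^+ 2 / 2 + rest)
      (plane_coord k p).
    have := is_deriveD (is_deriveM (is_deriveX 2 (is_derive_id (plane_coord k p) (1:R)))
       (is_derive_cst (2^-1 : R) (plane_coord k p) (1:R)))
       (is_derive_cst rest (plane_coord k p) (1:R)).
    move=> h; refine (is_derive_eq h _); rewrite /GRing.scale/= mulr0 add0r addr0 expr1.
    by rewrite mulr1 mulrA mulVf// mul1r.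
  have de := is_derive1_comp (is_derive_expR _) dl.
  split => /=; last by refine (is_derive_eq (is_derive_cst _ _ _) _); ring.
  rewrite (_ : (fun y => _) = expR \o (fun y : R => y ^+ 2 / 2 + rest)); last first.
    by apply/funext => y; rewrite EE.
  by refine (is_derive_eq de _); rewrite -EE upd_id; ring.
have dF k p : cder k (fourier gaussc) p (- ((plane_coord k p)%:C * fourier gaussc p)).
  apply: cder_eq (cder_fourier _ LG (schwartz_L1 (schwartz_coord k SG))).
  transitivity (fourier (fun r => 'i * partial k gaussc r) p).
    by congr (fourier _ p); apply/funext => r; rewrite partial_gaussc mulNr mulrN.
  rewrite fourierZ ?fourier_partial//; last exact/schwartz_L1/schwartz_partial.
  by rewrite mulrA mulrA -expr2 sqr_i mulN1r mulNr.
have dQ k p : cder k (fun r => E r * fourier gaussc r) p 0.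
  by apply: cder_eq (cderM (dE k p) (dF k p)); ring.
have cst k p (y z : R) : E (upd k p y) * fourier gaussc (upd k p y) =
    E (upd k p z) * fourier gaussc (upd k p z).
  have h w := dQ k (upd k p w).
  apply: eqcP.
    apply: (@is_derive_0_is_cst _ (fun w => complex.Re (E (upd k p w) * fourier gaussc (upd k p w)))) => w.
    by have [+ _] := h w; rewrite coord_upd; under eq_fun do rewrite upd_upd.
  apply: (@is_derive_0_is_cst _ (fun w => complex.Im (E (upd k p w) * fourier gaussc (upd k p w)))) => w.
  by have [_ +] := h w; rewrite coord_upd; under eq_fun do rewrite upd_upd.
have : E q * fourier gaussc q = gauss_mass%:C.
  have := cst false q q.1 0; have := cst true (0, q.2) q.2 0 => /=.
  rewrite -surjective_pairing => -> ->.
  rewrite /E/= expr0n/= addr0 mul0r expR0 mul1r fourierE -cintgR.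
  by apply: eq_cintg => p; rewrite /dot/= !mulr0 addr0 oppr0 cis0 mul1r.
move=> h.
have EG : gaussc q * E q = 1.
  apply: eqcP; rewrite ?cReM ?cImM/=; last by rewrite mulr0 mul0r addr0.
  by rewrite gaussE mulr0 subr0 -expRD addNr expR0.
by rewrite mulrC rmorphM/= -h mulrA EG mul1r.
Qed.

End GaussianTransform.

(** * Integrals of nonnegative functions *)

Section NonnegIntegral.
Context d (T : measurableType d) {R : realType} (mu : {measure set T -> \bar R}).
Implicit Types f g : T -> R.
Local Notation mf := (measurable_fun [set: T]).

Lemma integral_EFin_ge0 f : (forall x, 0 <= f x) -> (0 <= \int[mu]_x (f x)%:E)%E.
Proof. by move=> f0; apply: integral_ge0 => x _; rewrite lee_fin. Qed.

Lemma integral_EFinD f g : mf f -> mf g -> (forall x, 0 <= f x) -> (forall x, 0 <= g x) ->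
  (\int[mu]_x (f x + g x)%:E = \int[mu]_x (f x)%:E + \int[mu]_x (g x)%:E)%E.
Proof.
move=> ? ? f0 g0; under eq_integral do rewrite EFinD.
by rewrite ge0_integralD//; (try exact/measurable_EFinP) => x _; rewrite lee_fin.
Qed.

Lemma integral_EFinZ f (k : R) : mf f -> (forall x, 0 <= f x) -> 0 <= k ->
  (\int[mu]_x (k * f x)%:E = k%:E * \int[mu]_x (f x)%:E)%E.
Proof.
move=> ? f0 k0; under eq_integral do rewrite EFinM.
rewrite ge0_integralZl//; first exact/measurable_EFinP.
by move=> x _; rewrite lee_fin.
Qed.

Lemma integral_EFin_le f g : mf f -> mf g -> (forall x, 0 <= f x) ->
  (forall x, f x <= g x) -> (\int[mu]_x (f x)%:E <= \int[mu]_x (g x)%:E)%E.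
Proof.
move=> ? ? f0 fg; apply: ge0_le_integral => //.
- by move=> x _; rewrite lee_fin.
- exact/measurable_EFinP.
- exact/measurable_EFinP.
- by move=> x _; rewrite lee_fin.
Qed.

(** Removes approximations from uniform bounds: the gaussian damping in [plancherel_le] and the
    truncation in [self_bound]. *)
Lemma fatou_le (f_ : nat -> T -> \bar R) (f : T -> \bar R) (B : \bar R) :
  (forall n, mf (f_ n)) -> mf f -> (forall n x, 0 <= f_ n x)%E ->
  (forall x, 0 <= f x)%E ->
  {ae mu, forall x, f_ n x @[n --> \oo] --> f x} ->
  (forall n, \int[mu]_x f_ n x <= B)%E -> (\int[mu]_x f x <= B)%E.
Proof.
move=> mf_ mf f_0 f0 f_f fB.
apply: (@le_trans _ _ (\int[mu]_x limn_einf (f_^~ x))%E).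
  rewrite le_eqVlt; apply/orP; left; apply/eqP; apply: ge0_ae_eq_integral => //.
  - under eq_fun do rewrite /limn_einf.
    apply: measurableT_comp => //; apply: measurable_fun_limn_esup => n.
    exact: measurableT_comp.
  - move=> x _; rewrite limn_einf_lim; apply: lime_ge; first exact: is_cvg_einfs.
    apply: nearW => n; rewrite /einfs; apply: le_ereal_inf_tmp => _ [m _ <-].
    exact: f_0.
  - apply: filterS f_f => x h _; have [-> _] := cvg_limn_einf_sup h; by [].
apply: le_trans (fatou mu measurableT mf_ (fun n x _ => f_0 n x)) _.
apply: le_trans (limn_einf_sup _) _; rewrite limn_esup_lim.
apply: lime_le; first exact: is_cvg_esups.
by apply: nearW => n; apply: ge_ereal_sup => _ [m _ <-].
Qed.

End NonnegIntegral.

Section ComplexLimits.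
Context {R : realType}.
Implicit Types (u v : nat -> R[i]) (l m : R[i]).

Lemma ccvgM u v l m : ccvg u l -> ccvg v m -> ccvg (fun n => u n * v n) (l * m).
Proof.
move=> [u1 u2] [v1 v2]; split.
  by under eq_fun do rewrite cReM; rewrite cReM; apply: cvgB; exact: cvgM.
by under eq_fun do rewrite cImM; rewrite cImM; apply: cvgD; exact: cvgM.
Qed.

Lemma ccvg_cst l : ccvg (fun=> l) l.
Proof. by split; exact: cvg_cst. Qed.

Lemma ccvgR (a : nat -> R) (r : R) : a n @[n --> \oo] --> r ->
  ccvg (fun n => (a n)%:C) r%:C.
Proof. by move=> h; split => //=; exact: cvg_cst. Qed.

Lemma ccvgJ u l : ccvg u l -> ccvg (fun n => (u n)^*) l^*.
Proof.
move=> [u1 u2]; split; first by under eq_fun do rewrite cReJ; rewrite cReJ.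
by under eq_fun do rewrite cImJ; rewrite cImJ; exact: cvgN.
Qed.

Lemma ccvg_unique u l m : ccvg u l -> ccvg u m -> l = m.
Proof.
move=> [u1 u2] [v1 v2].
by apply: eqcP; [exact: cvg_unique u1 v1|exact: cvg_unique u2 v2].
Qed.

Lemma ccvg_eq u v l : u =1 v -> ccvg u l -> ccvg v l.
Proof. by move=> /funext ->. Qed.

End ComplexLimits.

(** * Gauss summation and Fourier inversion *)

Section Regularization.
Context {R : realType}.
Implicit Types (f g : plane R -> R[i]) (p q : plane R).

Lemma lipschitz_of_derive (F F' : R -> R) (M : R) :
  (forall x : R, is_derive x 1 F (F' x)) -> (forall x, `|F' x| <= M) ->
  forall x y, `|F x - F y| <= M * `|x - y|.
Proof.
move=> dF FM; have cF : continuous F.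
  move=> x; apply: differentiable_continuous; apply/derivable1_diffP.
  by have [] := dF x.
move=> x y; wlog xy : x y / x <= y.
  by move=> h; have [/h//|/ltW/h] := leP x y; rewrite distrC (distrC y).
rewrite distrC (distrC x).
have [c _ ->] := @MVT_segment _ F F' x y xy (fun z _ => dF z) (continuous_subspaceT cF).
by rewrite normrM ler_wpM2r.
Qed.

Definition eps (n : nat) : R := n.+1%:R^-1.

Lemma eps_gt0 n : 0 < eps n. Proof. by rewrite invr_gt0. Qed.

Lemma cvg_mulr_eps (c : R) : c * eps n @[n --> \oo] --> 0.
Proof.
by rewrite -[X in _ --> X](mulr0 c); apply: cvgM; [exact: cvg_cst|exact: cvg_harmonic].
Qed.

Lemma paffine0 (c : R) p : paffine c (0, 0) p = (c * p.1, c * p.2).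
Proof. by rewrite /paffine/= !addr0. Qed.

(** Both coordinates move in this limit, which separate continuity does not control. Bounded partial
    derivatives do, by passing through the corner point (q.1, eps n * p.2 + q.2). *)
Lemma cvg_partial_bounded (h : plane R -> R) (M : R) (h' : bool -> plane R -> R) q p :
  (forall k p, is_derive (plane_coord k p) 1 (fun y => h (upd k p y)) (h' k p)) ->
  (forall k p, `|h' k p| <= M) ->
  h (paffine (eps n) q p) @[n --> \oo] --> h q.
Proof.
move=> dh hM.
have lip k r (y z : R) : `|h (upd k r y) - h (upd k r z)| <= M * `|y - z|.
  apply: (@lipschitz_of_derive (fun y => h (upd k r y)) (fun y => h' k (upd k r y))) => x; last exact: hM.
  by have := dh k (upd k r x); rewrite coord_upd; under eq_fun do rewrite upd_upd.
apply/subr_cvg0; apply: norm_cvg0.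
apply: (@squeeze_cvgr _ _ _ _ (fun=> 0) (fun n => M * (`|p.1| + `|p.2|) * eps n)).
- apply: nearW => n; rewrite normr_ge0/=.
  apply: (@le_trans _ _ (`|h (paffine (eps n) q p) - h (q.1, eps n * p.2 + q.2)| +
     `|h (q.1, eps n * p.2 + q.2) - h q|)).
    by rewrite -[X in `|X| <= _](subrKA (h (q.1, eps n * p.2 + q.2))) ler_normD.
  rewrite mulrDr mulrDl; apply: lerD.
    rewrite (_ : M * _ * _ = M * `|(eps n * p.1 + q.1) - q.1|).
      exact: (lip false (q.1, eps n * p.2 + q.2) (eps n * p.1 + q.1) q.1).
    by rewrite addrK normrM (gtr0_norm (eps_gt0 n)); ring.
  rewrite (_ : M * _ * _ = M * `|(eps n * p.2 + q.2) - q.2|).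
    have := lip true q (eps n * p.2 + q.2) q.2.
    by rewrite /= -surjective_pairing.
  by rewrite addrK normrM (gtr0_norm (eps_gt0 n)); ring.
- exact: cvg_cst.
- exact: cvg_mulr_eps.
Qed.

Lemma schwartz_cvg f q p : schwartz f -> ccvg (fun n => f (paffine (eps n) q p)) (f q).
Proof.
move=> Sf; have [M0 [M00 H0]] := schwartz_bounded (schwartz_partial false Sf).
have [M1 [M10 H1]] := schwartz_bounded (schwartz_partial true Sf).
have H k r : cabs (partial k f r) <= M0 + M1.
  by case: k; [apply: le_trans (H1 r) _; rewrite lerDr|
               apply: le_trans (H0 r) _; rewrite lerDl].
split.
  apply: (@cvg_partial_bounded (fun p => complex.Re (f p)) (M0 + M1)
    (fun k p => complex.Re (partial k f p))).
  - by move=> k r; exact: (schwartz_cder k r Sf).1.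
  - by move=> k r; apply: le_trans (cabs_Re _) (H k r).
apply: (@cvg_partial_bounded (fun p => complex.Im (f p)) (M0 + M1)
  (fun k p => complex.Im (partial k f p))).
- by move=> k r; exact: (schwartz_cder k r Sf).2.
- by move=> k r; apply: le_trans (cabs_Im _) (H k r).
Qed.

Definition psub p q : plane R := (p.1 - q.1, p.2 - q.2).

(* The transform of the dilated gaussian [fun x => gauss (eps n * x)]. *)
Definition gauss_kernel (n : nat) p : R :=
  gauss_mass * (n.+1%:R ^+ 2 * gauss (paffine n.+1%:R (0, 0) p)).

Lemma gauss_kernel_ge0 n p : 0 <= gauss_kernel n p.
Proof.
by rewrite !mulr_ge0 ?(ltW gauss_mass_gt0)// ?sqr_ge0// ltW// gauss_gt0.
Qed.

Definition gauss_eps (n : nat) p : R := gauss (paffine (eps n) (0, 0) p).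

Lemma L1_gauss_eps n : L1 (leb2 R) (fun p => (gauss_eps n p)%:C).
Proof.
apply: (@L1_paffine _ (eps n) (0, 0) gaussc); first by rewrite gt_eqF ?eps_gt0.
exact: schwartz_L1 schwartz_gaussc.
Qed.

Lemma measurable_gauss_eps n : measurable_fun setT (gauss_eps n).
Proof. exact: (L1_gauss_eps n).1.1. Qed.

Lemma gauss_eps_ge0 n p : 0 <= gauss_eps n p.
Proof. by rewrite ltW// gauss_gt0. Qed.

Lemma gauss_eps_le1 n p : gauss_eps n p <= 1.
Proof. exact: gauss_le1. Qed.

Lemma gauss0 : gauss (0, 0) = 1 :> R.
Proof. by rewrite gaussE/= expr0n/= addr0 mul0r oppr0 expR0. Qed.

Lemma cvg_gauss_eps p : gauss_eps n p @[n --> \oo] --> (1 : R).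
Proof. by rewrite -gauss0; exact: (schwartz_cvg (0, 0) p schwartz_gaussc).1. Qed.

Lemma fourier_gauss_eps n q :
  fourier (fun p => (gauss_eps n p)%:C) q = (gauss_kernel n q)%:C.
Proof.
have n0 : n.+1%:R != 0 :> R by rewrite pnatr_eq0.
rewrite fourierE (@cintg_paffine _ n.+1%:R (0, 0))//; last first.
  by apply: L1_cisM; exact: L1_gauss_eps.
rewrite (_ : cintg _ _ = fourier gaussc (paffine n.+1%:R (0, 0) q)).
  by rewrite fourier_gaussc -rmorphM/= /gauss_kernel mulrCA.
apply: eq_cintg => p; rewrite !paffine0 /gauss_eps; congr (cis _ * _).
  by rewrite /dot/=; ring.
by rewrite /gaussc paffine0/= /eps !mulKf// -surjective_pairing.
Qed.

(** The multiplication formula against a modulated, dilated gaussian: damping the inverse transform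
    of [fourier f] amounts to averaging f with the kernel centred at q. *)
Lemma regularize f n q : L1 (leb2 R) f ->
  cintg (leb2 R) (fun x => (cis (dot x q) * (gauss_eps n x)%:C) * fourier f x) =
  cintg (leb2 R) (fun y => f y * (gauss_kernel n (psub y q))%:C).
Proof.
move=> Lf; rewrite fourier_mult//; last first.
  apply: (@L1_mulb _ _ _ _ _ 1); last exact: L1_gauss_eps.
    by apply: cmeas_cis; rewrite /dot; mfun.
  by move=> x; rewrite cabs_cis.
apply: eq_cintg => y; rewrite -fourier_gauss_eps; congr (_ * _).
apply: eq_cintg => x; rewrite mulrA -cisD; congr (cis _ * _).
by rewrite /dot/=; ring.
Qed.

Lemma measurable_psub q : measurable_fun setT (fun p => psub p q).
Proof. by apply: measurable_fun_pair => /=; mfun. Qed.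

Lemma measurable_gauss_kernel n : measurable_fun setT (gauss_kernel n).
Proof.
have mg := measurableT_comp (@measurable_gauss R) (@measurable_paffine R n.+1%:R (0, 0)).
by apply: mfM; [exact: measurable_cst|apply: mfM => //; exact: measurable_cst].
Qed.

Lemma cmeas_gauss_kernel n q : cmeas (fun y => (gauss_kernel n (psub y q))%:C).
Proof.
by apply: cmeasR; apply: (measurableT_comp (measurable_gauss_kernel n)); exact: measurable_psub.
Qed.

Lemma L1_mul_gauss_kernel f n q : L1 (leb2 R) f ->
  L1 (leb2 R) (fun y => f y * (gauss_kernel n (psub y q))%:C).
Proof.
move=> Lf; under eq_fun do rewrite mulrC.
apply: (@L1_mulb _ _ _ _ _ (gauss_mass * n.+1%:R ^+ 2)) => //.
  exact: cmeas_gauss_kernel.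
move=> y; rewrite cabsR ger0_norm ?gauss_kernel_ge0// /gauss_kernel mulrA ler_piMr//.
  by rewrite mulr_ge0 ?sqr_ge0// ltW// gauss_mass_gt0.
exact: gauss_le1.
Qed.

(** This is (2 pi)^2, the constant of unnormalized inversion and of Plancherel. *)
Definition kappa : R := gauss_mass ^+ 2.

Lemma kappa_gt0 : 0 < kappa. Proof. by rewrite exprn_gt0// gauss_mass_gt0. Qed.

(** Both sides of [regularize] pass to the limit. On the left the damping tends to one; on the
    right, rescaling around q turns the kernel into a fixed gaussian of mass [kappa], integrated
    against values of f that tend to f q. *)
Lemma fourierK f q : schwartz f -> ifourier (fourier f) q = kappa%:C * f q.
Proof.
move=> Sf; have Lf := schwartz_L1 Sf; have SF := schwartz_fourier Sf.
have LF := schwartz_L1 SF.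
have [M [M0 fM]] := schwartz_bounded Sf.
have e0 n : eps n != 0 by rewrite gt_eqF ?eps_gt0.
have mfp n : cmeas (fun p => f (paffine (eps n) q p)).
  by apply: (cmeas_comp (schwartz_cmeas Sf)); exact: measurable_paffine.
have c1 : ccvg (fun n => cintg (leb2 R)
    (fun x => (cis (dot x q) * (gauss_eps n x)%:C) * fourier f x))
    (ifourier (fourier f) q).
  have mcis : cmeas (fun x : plane R => cis (dot x q)).
    by apply: cmeas_cis; rewrite /dot; mfun.
  apply: (@cintg_dominated _ _ _ _ _ _ (fun x => cabs (fourier f x)) _ _ _ _ _ LF.2 _).2.
  - move=> n; apply: cmeasM; last exact: LF.1.
    by apply: cmeasM => //; apply: cmeasR; exact: measurable_gauss_eps.
  - exact: (cmeasM mcis LF.1).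
  - exact: measurable_cabs LF.1.
  - apply: aeW => x; rewrite -[X in ccvg _ (X * _)]mulr1.
    apply: ccvgM (ccvg_cst _); apply: ccvgM (ccvg_cst _) _.
    exact: (ccvgR (cvg_gauss_eps x)).
  - apply: aeW => x n; rewrite !cabsM cabs_cis mul1r cabsR ger0_norm ?gauss_eps_ge0//.
    by rewrite ler_piMl ?cabs_ge0 ?gauss_eps_le1.
  - by move=> x; exact: cabs_ge0.
have c2 : ccvg (fun n => cintg (leb2 R)
    (fun z => f (paffine (eps n) q z) * (gauss_mass * gauss z)%:C))
    (cintg (leb2 R) (fun z => f q * (gauss_mass * gauss z)%:C)).
  have mg := @measurable_gauss R; have gm := ltW (@gauss_mass_gt0 R).
  have my : (\int[leb2 R]_x (M * gauss_mass * gauss x)%:E < +oo)%E.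
    have MM0 : 0 <= M * gauss_mass by exact: mulr_ge0.
    by rewrite (integral_EFinZ _ mg (fun x => ltW (gauss_gt0 x)) MM0) gauss_massE ltry.
  apply: (@cintg_dominated _ _ _ _ _ _ (fun x => M * gauss_mass * gauss x) _ _ _ _ _ my _).2.
  - by move=> n; apply: cmeasM => //; apply: cmeasR; mfun.
  - by apply: cmeasM; [exact: cmeas_cst|apply: cmeasR; mfun].
  - by mfun.
  - by apply: aeW => x; exact: ccvgM (schwartz_cvg q x Sf) (ccvg_cst _).
  - apply: aeW => x n; rewrite cabsM cabsR ger0_norm ?mulr_ge0 ?(ltW (gauss_gt0 _))//.
    by rewrite -mulrA ler_wpM2r ?mulr_ge0 ?(ltW (gauss_gt0 _)).
  - by move=> x; rewrite !mulr_ge0 ?(ltW (gauss_gt0 _)).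
have E n : cintg (leb2 R) (fun x => (cis (dot x q) * (gauss_eps n x)%:C) * fourier f x) =
    cintg (leb2 R) (fun z => f (paffine (eps n) q z) * (gauss_mass * gauss z)%:C).
  rewrite regularize// (@cintg_paffine _ (eps n) q)//; last first.
    exact: L1_mul_gauss_kernel.
  rewrite -cintgZ; last exact: (L1_paffine q (e0 n) (L1_mul_gauss_kernel n q Lf)).
  apply: eq_cintg => z; rewrite mulrCA; congr (_ * _).
  rewrite -rmorphM/= /gauss_kernel /eps; congr (_%:C).
  rewrite mulrCA; congr (gauss_mass * _).
  rewrite mulrA -exprMn mulVf ?pnatr_eq0// expr1n mul1r; congr (gauss _).
  by rewrite paffine0 /psub/= !addrK !mulVKf ?pnatr_eq0// -surjective_pairing.
rewrite (ccvg_unique c1 (ccvg_eq (fun n => esym (E n)) c2)).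
have Eg : (fun z => (gauss_mass * gauss z)%:C) = (fun z => gauss_mass%:C * gaussc z) :> (plane R -> R[i]).
  by apply/funext => z; rewrite rmorphM.
have Lg := schwartz_L1 (@schwartz_gaussc R).
rewrite cintgZ Eg; last exact: L1Z.
by rewrite cintgZ// cintgR -rmorphM/= -expr2 mulrC.
Qed.

End Regularization.

(** * Tonelli, translations and Schur's test on the plane *)

Section PlaneTools.
Context {R : realType}.
Implicit Types (p q : plane R).

Lemma mf_fstc d (T : measurableType d) (h : T -> plane R) :
  measurable_fun setT h -> measurable_fun setT (fun x => (h x).1).
Proof. by move=> mh; exact: (measurableT_comp measurable_fst mh). Qed.

Lemma mf_sndc d (T : measurableType d) (h : T -> plane R) :
  measurable_fun setT h -> measurable_fun setT (fun x => (h x).2).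
Proof. by move=> mh; exact: (measurableT_comp measurable_snd mh). Qed.

Lemma measurable_psubf d (T : measurableType d) (h k : T -> plane R) :
  measurable_fun setT h -> measurable_fun setT k ->
  measurable_fun setT (fun x => psub (h x) (k x)).
Proof.
by move=> mh mk; apply: measurable_fun_pair => /=; apply: mfB;
  [exact: mf_fstc|exact: mf_fstc|exact: mf_sndc|exact: mf_sndc].
Qed.

Lemma mf_comp d (T : measurableType d) (f : plane R -> R) (h : T -> plane R) :
  measurable_fun setT f -> measurable_fun setT h ->
  measurable_fun setT (fun x => f (h x)).
Proof. by move=> mf mh; exact: (measurableT_comp mf mh). Qed.

Lemma tonelli (F : plane R * plane R -> R) : measurable_fun setT F ->
  (forall z, 0 <= F z) ->
  (\int[leb2 R]_p \int[leb2 R]_q (F (p, q))%:E =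
   \int[leb2 R]_q \int[leb2 R]_p (F (p, q))%:E)%E.
Proof.
move=> mF F0; apply: (@fubini_tonelli _ _ _ _ _ sleb2 sleb2 (fun z => (F z)%:E)).
  exact/measurable_EFinP.
by move=> z; rewrite lee_fin.
Qed.

Lemma measurable_integral2 (F : plane R * plane R -> R) : measurable_fun setT F ->
  (forall z, 0 <= F z) ->
  measurable_fun setT (fun p => \int[leb2 R]_q (F (p, q))%:E)%E.
Proof.
move=> mF F0.
apply: (@measurable_fun_fubini_tonelli_F _ _ _ _ _ sleb2 (fun z => (F z)%:E)).
  exact/measurable_EFinP.
by move=> z; rewrite lee_fin.
Qed.

Lemma integral_psubl (f : plane R -> R) p : measurable_fun setT f ->
  (forall q, 0 <= f q) ->
  (\int[leb2 R]_q (f (psub q p))%:E = \int[leb2 R]_q (f q)%:E)%E.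
Proof.
move=> mf f0.
rewrite [RHS](@ge0_integral_paffine _ 1 (- p.1, - p.2))//.
- rewrite expr1n mul1e; apply: eq_integral => q _.
  by rewrite /paffine/= !mul1r.
- exact/measurable_EFinP.
Qed.

Lemma integral_psubr (f : plane R -> R) p : measurable_fun setT f ->
  (forall q, 0 <= f q) ->
  (\int[leb2 R]_q (f (psub p q))%:E = \int[leb2 R]_q (f q)%:E)%E.
Proof.
move=> mf f0.
rewrite [RHS](@ge0_integral_paffine _ (-1) p)//.
- rewrite sqrrN expr1n mul1e; apply: eq_integral => q _.
  by rewrite /paffine/= !mulN1r addrC [- q.2 + _]addrC.
- exact/measurable_EFinP.
Qed.

Lemma integral_gauss_kernel n : (\int[leb2 R]_p (gauss_kernel n p)%:E = (@kappa R)%:E)%E.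
Proof.
have n0 : n.+1%:R != 0 :> R by rewrite pnatr_eq0.
have mg := @measurable_gauss R; have gm := ltW (@gauss_mass_gt0 R).
have mgk : measurable_fun setT (fun p => gauss (paffine n.+1%:R (0, 0) p) : R).
  exact: (measurableT_comp mg (@measurable_paffine R n.+1%:R (0, 0))).
have g0 (p : plane R) : 0 <= gauss p by rewrite ltW// gauss_gt0.
rewrite /gauss_kernel integral_EFinZ//; last 2 first.
- by apply: mfM => //; exact: measurable_cst.
- by move=> p; rewrite mulr_ge0// sqr_ge0.
rewrite integral_EFinZ ?sqr_ge0//.
rewrite -(@ge0_integral_paffine _ n.+1%:R (0, 0) (fun p => (gauss p)%:E))//.
- by rewrite gauss_massE -EFinM /kappa expr2.
- exact/measurable_EFinP.
Qed.

(** Schur's test: 2 G(p) G(q) <= G(p)^2 + G(q)^2 splits the form into two integrals, in each of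
    which K is integrated alone and contributes its mass c. *)
Lemma schur_convolution (G K : plane R -> R) (c : R) :
  measurable_fun setT G -> measurable_fun setT K ->
  (forall p, 0 <= G p) -> (forall p, 0 <= K p) -> 0 <= c ->
  (\int[leb2 R]_p (K p)%:E = c%:E)%E ->
  (\int[leb2 R]_p \int[leb2 R]_q (G p * (G q * K (psub q p)))%:E <=
   c%:E * \int[leb2 R]_p (G p ^+ 2)%:E)%E.
Proof.
move=> mG mK G0 K0 c0 Kc.
have mG1 := @mf_comp _ _ G _ mG (@mf_fst _ _ (plane R) (plane R)).
have mG2 := @mf_comp _ _ G _ mG (@mf_snd _ _ (plane R) (plane R)).
have mKs := @mf_comp _ _ K _ mK (measurable_psubf (@mf_snd _ _ (plane R) (plane R))
  (@mf_fst _ _ (plane R) (plane R))).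
have half0 : 0 <= 2^-1 :> R by rewrite invr_ge0.
pose F1 (z : plane R * plane R) := 2^-1 * (G z.1 ^+ 2 * K (psub z.2 z.1)).
pose F2 (z : plane R * plane R) := 2^-1 * (G z.2 ^+ 2 * K (psub z.2 z.1)).
have mF1 : measurable_fun setT F1 by rewrite /F1; mfun.
have mF2 : measurable_fun setT F2 by rewrite /F2; mfun.
have F10 z : 0 <= F1 z by rewrite mulr_ge0// mulr_ge0// sqr_ge0.
have F20 z : 0 <= F2 z by rewrite mulr_ge0// mulr_ge0// sqr_ge0.
have s1 (F : plane R * plane R -> R) p : measurable_fun setT F ->
    measurable_fun setT (fun q => F (p, q)).
  by move=> mF; exact: (measurableT_comp mF (pair1_measurable p)).
have s2 (F : plane R * plane R -> R) q : measurable_fun setT F ->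
    measurable_fun setT (fun p => F (p, q)).
  by move=> mF; exact: (measurableT_comp mF (pair2_measurable q)).
have mG2' : measurable_fun setT (fun p => G p ^+ 2) by mfun.
have I1 : (\int[leb2 R]_p \int[leb2 R]_q (F1 (p, q))%:E =
    (2^-1 * c)%:E * \int[leb2 R]_p (G p ^+ 2)%:E)%E.
  rewrite -integral_EFinZ ?mulr_ge0//; last by move=> p; rewrite sqr_ge0.
  apply: eq_integral => p _.
  have mKp : measurable_fun setT (fun q => K (psub q p)).
    exact: (s1 (fun z => K (psub z.2 z.1)) p mKs).
  rewrite /F1/= integral_EFinZ//; last 2 first.
  - by mfun.
  - by move=> q; rewrite mulr_ge0// sqr_ge0.
  rewrite integral_EFinZ ?sqr_ge0// integral_psubl// Kc -!EFinM.
  by congr EFin; ring.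
have I2 : (\int[leb2 R]_p \int[leb2 R]_q (F2 (p, q))%:E =
    (2^-1 * c)%:E * \int[leb2 R]_p (G p ^+ 2)%:E)%E.
  rewrite (tonelli mF2 F20) -(@integral_EFinZ _ _ _ _ (fun p => G p ^+ 2) (2^-1 * c))//;
    [|by move=> p; rewrite sqr_ge0|by rewrite mulr_ge0].
  apply: eq_integral => q _.
  have mKp : measurable_fun setT (fun p => K (psub q p)).
    exact: (s2 (fun z => K (psub z.2 z.1)) q mKs).
  rewrite /F2/= integral_EFinZ//; last 2 first.
  - by mfun.
  - by move=> p; rewrite mulr_ge0// sqr_ge0.
  rewrite integral_EFinZ ?sqr_ge0// integral_psubr// Kc -!EFinM.
  by congr EFin; ring.
apply: (@le_trans _ _ (\int[leb2 R]_p \int[leb2 R]_q (F1 (p, q))%:E +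
    \int[leb2 R]_p \int[leb2 R]_q (F2 (p, q))%:E)%E); last first.
  rewrite I1 I2 -ge0_muleDl ?lee_fin ?mulr_ge0// -EFinD.
  by rewrite (_ : 2^-1 * c + 2^-1 * c = c)//; lra.
rewrite -ge0_integralD//; last 4 first.
- by move=> p _; apply: integral_EFin_ge0.
- exact: measurable_integral2.
- by move=> p _; apply: integral_EFin_ge0.
- exact: measurable_integral2.
have mF : measurable_fun setT (fun z : plane R * plane R => G z.1 * (G z.2 * K (psub z.2 z.1))).
  by mfun.
apply: ge0_le_integral; first exact: measurableT.
- by move=> p _; apply: integral_EFin_ge0 => q; rewrite !mulr_ge0.
- by apply: (measurable_integral2 mF) => z; rewrite !mulr_ge0.
- by apply: emeasurable_funD; exact: measurable_integral2.
move=> p _; rewrite -integral_EFinD//; [|exact: (s1 _ _ mF1)|exact: (s1 _ _ mF2)].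
apply: integral_EFin_le.
- exact: (s1 _ p mF).
- by apply: mfD; [exact: (s1 _ _ mF1)|exact: (s1 _ _ mF2)].
- by move=> q; rewrite !mulr_ge0.
move=> q; rewrite /F1 /F2/=; have k0 := K0 (psub q p); set k := K _ in k0 *.
rewrite -subr_ge0 (_ : _ - _ = 2^-1 * (k * (G p - G q) ^+ 2)); last by field.
by rewrite mulr_ge0// mulr_ge0// sqr_ge0.
Qed.

End PlaneTools.

(** * Plancherel inequality and convolution *)

Section Plancherel.
Context {R : realType}.
Implicit Types (f g : plane R -> R[i]) (p q : plane R).

(** Damp |fourier g|^2 by [gauss_eps n]. The multiplication formula moves the damped conjugate
    transform onto g, where by [regularize] it becomes the conjugate of a gaussian average of g.
    Schur's test bounds the result uniformly in n, and Fatou removes the damping. *)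
Lemma plancherel_le g : L1 (leb2 R) g ->
  (\int[leb2 R]_x (cabs (fourier g x) ^+ 2)%:E <=
   (@kappa R)%:E * \int[leb2 R]_y (cabs (g y) ^+ 2)%:E)%E.
Proof.
move=> Lg; have mg := Lg.1; have mFg := cmeas_fourier mg.
have macg := measurable_cabs mg; have macF := measurable_cabs mFg.
pose B := fine (\int[leb2 R]_p (cabs (g p))%:E).
have FB q : cabs (fourier g q) <= B.
  rewrite -lee_fin fineK; first exact: fourier_le.
  by rewrite ge0_fin_numE ?Lg.2//; apply: integral_EFin_ge0 => p; exact: cabs_ge0.
apply: (@fatou_le _ _ _ _ (fun n x => (gauss_eps n x * cabs (fourier g x) ^+ 2)%:E)).
- by move=> n; have := @measurable_gauss_eps R n; move=> ?; mfun.
- by mfun.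
- by move=> n x; rewrite lee_fin mulr_ge0 ?gauss_eps_ge0 ?sqr_ge0.
- by move=> x; rewrite lee_fin sqr_ge0.
- apply: aeW => x; apply: cvg_EFin; first exact: nearW.
  rewrite -[X in _ --> X]mul1r; apply: cvgM; first exact: cvg_gauss_eps.
  exact: cvg_cst.
move=> n; pose f x := (gauss_eps n x)%:C * (fourier g x)^*.
have Lf : L1 (leb2 R) f.
  rewrite /f; under eq_fun do rewrite mulrC.
  apply: (@L1_mulb _ _ _ _ _ B); [exact: cmeasJ|by move=> x; rewrite cabsJ|].
  exact: L1_gauss_eps.
have E1 : cintg (leb2 R) (fun x => f x * fourier g x) =
    (Rintegral (leb2 R) setT (fun x => gauss_eps n x * cabs (fourier g x) ^+ 2))%:C.
  rewrite -cintgR; apply: eq_cintg => x; rewrite /f cabsX2.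
  by apply: eqcP; rewrite !(cReM, cImM, cReJ, cImJ)/=; ring.
have E2 y : fourier f y =
    (cintg (leb2 R) (fun y' => g y' * (gauss_kernel n (psub y' y))%:C))^*.
  rewrite -regularize//.
  have Lgf : L1 (leb2 R) (fun x => cis (dot x y) * (gauss_eps n x)%:C * fourier g x).
    under eq_fun do rewrite mulrC.
    apply: (@L1_mulb _ _ _ _ _ B) => //.
    apply: (@L1_mulb _ _ _ _ _ 1); last exact: L1_gauss_eps.
      by apply: cmeas_cis; rewrite /dot; mfun.
    by move=> x; rewrite cabs_cis.
  rewrite -(cintgJ Lgf); apply: eq_cintg => x.
  rewrite /f -/(dot x y); apply: eqcP;
    by rewrite !(cReM, cImM, cReJ, cImJ)/= cosN sinN; ring.
have LfF : L1 (leb2 R) (fun x => f x * fourier g x).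
  by under eq_fun do rewrite mulrC; exact: (@L1_mulb _ _ _ _ _ B).
have cE x : cabs (f x * fourier g x) = gauss_eps n x * cabs (fourier g x) ^+ 2.
  by rewrite !cabsM cabsJ cabsR ger0_norm ?gauss_eps_ge0// -mulrA expr2.
have ge0F x : 0 <= gauss_eps n x * cabs (fourier g x) ^+ 2.
  by rewrite mulr_ge0 ?gauss_eps_ge0 ?sqr_ge0.
have mK y : measurable_fun setT (fun y' : plane R => gauss_kernel n (psub y' y)).
  exact: (measurableT_comp (@measurable_gauss_kernel R n) (measurable_psub y)).
have -> : (\int[leb2 R]_x (gauss_eps n x * cabs (fourier g x) ^+ 2)%:E =
    (cabs (cintg (leb2 R) (fun y => g y * fourier f y)))%:E)%E.
  rewrite -fourier_mult// E1 cabsR ger0_norm; last exact: Rintegral_ge0.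
  rewrite /Rintegral fineK// ge0_fin_numE; last exact: integral_EFin_ge0.
  by have := LfF.2; under eq_integral do rewrite cE.
have mgFf : cmeas (fun y => g y * fourier f y).
  exact: (cmeasM mg (cmeas_fourier Lf.1)).
apply: le_trans (cabs_cintg _ mgFf) _.
apply: le_trans (@schur_convolution R (fun p => cabs (g p)) (gauss_kernel n) (@kappa R)
  macg (@measurable_gauss_kernel R n) (fun p => cabs_ge0 _) (gauss_kernel_ge0 n)
  (ltW (@kappa_gt0 R)) (@integral_gauss_kernel R n)).
have mT : measurable_fun setT (fun z : plane R * plane R =>
    cabs (g z.1) * (cabs (g z.2) * gauss_kernel n (psub z.2 z.1))).
  have h1 := @mf_comp _ _ _ (fun p => cabs (g p)) _ macg (@mf_fst _ _ (plane R) (plane R)).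
  have h2 := @mf_comp _ _ _ (fun p => cabs (g p)) _ macg (@mf_snd _ _ (plane R) (plane R)).
  have h3 := @mf_comp _ _ _ (gauss_kernel n) _ (@measurable_gauss_kernel R n)
    (measurable_psubf (@mf_snd _ _ (plane R) (plane R)) (@mf_fst _ _ (plane R) (plane R))).
  by mfun.
have T0 (z : plane R * plane R) :
    0 <= cabs (g z.1) * (cabs (g z.2) * gauss_kernel n (psub z.2 z.1)).
  apply: mulr_ge0; first exact: cabs_ge0.
  by apply: mulr_ge0; [exact: cabs_ge0|exact: gauss_kernel_ge0].
apply: ge0_le_integral; first exact: measurableT.
- by move=> y _; rewrite lee_fin cabs_ge0.
- exact: measurable_ecabs.
- exact: (measurable_integral2 mT T0).
move=> y _; rewrite integral_EFinZ ?cabs_ge0//; last 2 first.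
- exact: mfM.
- by move=> q; apply: mulr_ge0; [exact: cabs_ge0|exact: gauss_kernel_ge0].
rewrite cabsM EFinM lee_wpmul2l ?lee_fin ?cabs_ge0//.
rewrite E2 cabsJ; apply: le_trans (cabs_cintg _ _) _.
  by apply: cmeasM => //; exact: cmeas_gauss_kernel.
rewrite le_eqVlt; apply/orP; left; apply/eqP; apply: eq_integral => q _.
by rewrite cabsM cabsR ger0_norm ?gauss_kernel_ge0.
Qed.

End Plancherel.

Lemma ae_L1_1 d1 d2 (T1 : measurableType d1) (T2 : measurableType d2) (R : realType)
    (m1 : {sigma_finite_measure set T1 -> \bar R})
    (m2 : {sigma_finite_measure set T2 -> \bar R}) (f : T1 * T2 -> R[i]) :
  L1 (m1 \x m2)%E f -> {ae m1, forall x, L1 m2 (fun y => f (x, y))}.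
Proof.
move=> Lf.
have := ae_integrable1 (L1_Im Lf); have := ae_integrable1 (L1_Re Lf).
apply: filterS2 => x h1 h2; exact: integrable_L1.
Qed.

(** * Convolution and reflected conjugate under the inverse transform *)

Section Convolution.
Context {R : realType}.
Implicit Types (f g : plane R -> R[i]) (p q : plane R).

Definition cconv f g q : R[i] := cintg (leb2 R) (fun p => f p * g (psub q p)).

Definition cref g q : R[i] := (g (popp q))^*.

Lemma cJM (z w : R[i]) : (z * w)^* = z^*%C * w^*%C.
Proof. by apply: eqcP; rewrite !(cReM, cImM, cReJ, cImJ); ring. Qed.

Lemma cmeas_conv_kernel f g : cmeas f -> cmeas g ->
  cmeas (fun z : plane R * plane R => f z.2 * g (psub z.1 z.2)).
Proof.
move=> mf mg; apply: cmeasM; first exact: (cmeas_comp mf (@mf_snd _ _ (plane R) (plane R))).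
exact: (cmeas_comp mg (measurable_psubf (@mf_fst _ _ (plane R) (plane R))
  (@mf_snd _ _ (plane R) (plane R)))).
Qed.

Lemma cmeas_cconv f g : cmeas f -> cmeas g -> cmeas (cconv f g).
Proof. by move=> mf mg; exact: (cmeas_cintg1 sleb2 (cmeas_conv_kernel mf mg)). Qed.

Lemma L1_conv_kernel f g : L1 (leb2 R) f -> L1 (leb2 R) g ->
  L1 (sleb2 \x sleb2)%E (fun z : plane R * plane R => f z.2 * g (psub z.1 z.2)).
Proof.
move=> [mf fy] [mg gy]; have mk := cmeas_conv_kernel mf mg.
have mfa := measurable_cabs mf; have mga := measurable_cabs mg.
apply: (@L1_prod _ _ _ _ _ sleb2 sleb2) => //.
rewrite (@tonelli R (fun z => cabs (f z.2 * g (psub z.1 z.2)))); last 2 first.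
- exact: measurable_cabs mk.
- by move=> z; exact: cabs_ge0.
have g0 : (0 <= \int[leb2 R]_y (cabs (g y))%:E)%E.
  by apply: integral_EFin_ge0 => y; exact: cabs_ge0.
have gfin : (\int[leb2 R]_y (cabs (g y))%:E)%E \is a fin_num by rewrite ge0_fin_numE.
have -> : (\int[leb2 R]_q \int[leb2 R]_p (cabs (f q * g (psub p q)))%:E =
    \int[leb2 R]_q (fine (\int[leb2 R]_y (cabs (g y))%:E) * cabs (f q))%:E)%E.
  apply: eq_integral => q _; under eq_integral do rewrite cabsM.
  rewrite (@integral_EFinZ _ _ _ _ (fun p => cabs (g (psub p q)))) ?cabs_ge0//; last 2 first.
  - exact: (mf_comp mga (measurable_psub q)).
  - by move=> p; exact: cabs_ge0.
  rewrite (@integral_psubl _ (fun p => cabs (g p)))//; last by move=> ?; exact: cabs_ge0.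
  by rewrite EFinM fineK// muleC.
rewrite integral_EFinZ//; last 2 first.
- by move=> x; exact: cabs_ge0.
- exact: fine_ge0.
by rewrite lte_mul_pinfty ?lee_fin ?fine_ge0.
Qed.

Lemma L1_cconv f g : L1 (leb2 R) f -> L1 (leb2 R) g -> L1 (leb2 R) (cconv f g).
Proof. by move=> Lf Lg; exact: (L1_cintg1 (L1_conv_kernel Lf Lg)). Qed.

Lemma L1_cisM_pos f q : L1 (leb2 R) f -> L1 (leb2 R) (fun p => cis (dot p q) * f p).
Proof.
apply: (@L1_mulb _ _ _ _ _ 1); last by move=> p; rewrite cabs_cis.
by apply: cmeas_cis; rewrite /dot; mfun.
Qed.

Lemma ifourier_cconv f g x : L1 (leb2 R) f -> L1 (leb2 R) g ->
  ifourier (cconv f g) x = ifourier f x * ifourier g x.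
Proof.
move=> Lf Lg; have Lk := L1_conv_kernel Lf Lg.
have mcis : cmeas (fun z : plane R * plane R => cis (dot z.1 x)).
  apply: cmeas_cis; rewrite /dot.
  have h1 := mf_fstc (@mf_fst _ _ (plane R) (plane R)).
  have h2 := mf_sndc (@mf_fst _ _ (plane R) (plane R)).
  by mfun.
have Lk' : L1 (sleb2 \x sleb2)%E (fun z : plane R * plane R =>
    cis (dot z.1 x) * (f z.2 * g (psub z.1 z.2))).
  by apply: (@L1_mulb _ _ _ _ _ 1) => // z; rewrite cabs_cis.
have mk1 q : cmeas (fun p => f p * g (psub q p)).
  have := cmeas_comp (cmeas_conv_kernel Lf.1 Lg.1) (@pair1_measurable _ _ _ (plane R) q).
  by [].
have mk2 p : L1 (leb2 R) (fun q => g (psub q p)).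
  rewrite (_ : (fun q => _) = (fun q => g (paffine 1 (- p.1, - p.2) q))).
    exact: L1_paffine (oner_neq0 _) Lg.
  by apply/funext => q; rewrite /paffine !mul1r.
have mcx : cmeas (fun q : plane R => cis (dot q x)).
  by apply: cmeas_cis; rewrite /dot; mfun.
transitivity (cintg sleb2 (fun q => cintg sleb2 (fun p =>
    cis (dot q x) * (f p * g (psub q p))))).
  (* The integrand defining the convolution at q is known to be integrable for almost every q
     only. *)
  apply: ae_eq_cintg.
  - exact: (cmeasM mcx (cmeas_cconv Lf.1 Lg.1)).
  - exact: (cmeas_cintg1 sleb2 Lk'.1).
  - by have := ae_L1_1 Lk; apply: filterS => q hq; rewrite cintgZ.
rewrite (cintg_Fubini Lk') /= mulrC -[RHS]cintgZ; last exact: L1_cisM_pos.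
apply: eq_cintg => p.
transitivity (f p * cintg (leb2 R) (fun q => cis (dot q x) * g (psub q p))).
  rewrite -cintgZ; last exact: L1_cisM_pos.
  by apply: eq_cintg => q; rewrite mulrCA.
rewrite (_ : cintg _ _ = cis (dot p x) * ifourier g x); first by ring.
rewrite (@cintg_paffine _ 1 p) ?oner_neq0//; last exact: L1_cisM_pos.
rewrite expr1n mul1r -cintgZ; last exact: L1_cisM_pos.
apply: eq_cintg => q; rewrite mulrA -cisD; congr (cis _ * g _).
  by rewrite /dot /paffine/= !mul1r; ring.
by rewrite /psub /paffine/= !mul1r !addrK -surjective_pairing.
Qed.

Lemma L1_cref g : L1 (leb2 R) g -> L1 (leb2 R) (cref g).
Proof.
move=> Lg; apply: L1J.
rewrite (_ : (fun x => _) = (fun q => g (paffine (-1) (0, 0) q))).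
  by apply: L1_paffine Lg; rewrite oppr_eq0 oner_eq0.
by apply/funext => q; rewrite paffine0 !mulN1r.
Qed.

Lemma cmeas_popp g : cmeas g -> cmeas (fun q => g (popp q)).
Proof.
move=> mg; apply: (cmeas_comp mg).
by apply: (@measurable_fun_pair _ _ _ (plane R) _ _ (fun p => - p.1) (fun p => - p.2)); mfun.
Qed.

Lemma ifourier_cref g x : L1 (leb2 R) g -> ifourier (cref g) x = (ifourier g x)^*.
Proof.
move=> Lg; have Lr := L1_cref Lg.
have n1 : -1 != 0 :> R by rewrite oppr_eq0 oner_eq0.
rewrite /ifourier (@cintg_paffine _ (-1) (0, 0))//; last exact: L1_cisM_pos.
rewrite sqrrN expr1n mul1r -cintgJ; last exact: L1_cisM_pos.
apply: eq_cintg => p; rewrite paffine0 /cref cJM -cisN; congr (cis _ * (g _)^*%C).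
  by rewrite /dot/=; ring.
by rewrite /popp/= !mulN1r !opprK -surjective_pairing.
Qed.

Lemma cubicE f p : cubic f p = f p * f p * (f p)^*%C.
Proof.
rewrite /cubic cabsX2; apply: eqcP; rewrite !(cReM, cImM, cReJ, cImJ)/=; ring.
Qed.

Lemma cubic_ifourier g : L1 (leb2 R) g ->
  cubic (ifourier g) = ifourier (cconv (cconv g g) (cref g)).
Proof.
move=> Lg; apply/funext => x; have Lr := L1_cref Lg.
rewrite cubicE (ifourier_cconv x (L1_cconv Lg Lg) Lr) (ifourier_cconv x Lg Lg).
by rewrite ifourier_cref.
Qed.

End Convolution.

(** * The kernel bound *)

Section SigmaKernel.
Context {R : realType}.
Local Notation mu := (@lebesgue_measure R).

Definition bracket_mass (r : R) : R := Rintegral mu setT (fun x => (1 + `|x|) `^ (- r)).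

Lemma bracket_massE r : 1 < r ->
  (\int[mu]_x ((1 + `|x|) `^ (- r))%:E = (bracket_mass r)%:E)%E.
Proof.
move=> r1; rewrite /bracket_mass /Rintegral fineK// ge0_fin_numE ?integral_bracket_powR_lty//.
by apply: integral_EFin_ge0 => x; exact: powR_ge0.
Qed.

Lemma bracket_mass_ge0 r : 0 <= bracket_mass r.
Proof. by apply: Rintegral_ge0 => x _; exact: powR_ge0. Qed.

Lemma integral_bracket_affine (s d r : R) : `|s| = 1 -> 1 < r ->
  (\int[mu]_x ((1 + `|s * x + d|) `^ (- r))%:E = (bracket_mass r)%:E)%E.
Proof.
move=> s1 r1; have s0 : s != 0 by rewrite -normr_eq0 s1 oner_eq0.
rewrite -(bracket_massE r1).
have mb : measurable_fun setT (fun x : R => ((1 + `|x|) `^ (- r))%:E).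
  by apply/measurable_EFinP; exact: measurable_bracket_powR.
rewrite [RHS](ge0_integral_affine d s0 mb); last by move=> x; rewrite lee_fin powR_ge0.
by rewrite s1 mul1e.
Qed.

Lemma powRN_le (x y r : R) : 0 < x -> x <= y -> 0 <= r -> y `^ (- r) <= x `^ (- r).
Proof.
move=> x0 xy r0; have y0 := lt_le_trans x0 xy.
rewrite !powRN lef_pV2 ?posrE ?powR_gt0//.
by rewrite ge0_ler_powR// nnegrE ltW.
Qed.

Lemma powRN_half (x r : R) : (x / 2) `^ (- r) = 2 `^ r * x `^ (- r) \/ x < 0.
Proof.
have [x0|] := leP 0 x; last by right.
by left; rewrite powRM// ?invr_ge0// -[in LHS]powR_inv1// -powRrM mulN1r opprK mulrC.
Qed.

(** If |s| <= |t| then |s + t| <= 2 |t|. So ga of the exponent on 1 + |t| can be handed to 1 + |s +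
    t|, and the remaining be - ga to the smaller bracket 1 + |s|. *)
Lemma bracket_product_le (be ga s t : R) : 0 <= ga -> ga <= be ->
  (1 + `|s|) `^ (- be) * (1 + `|t|) `^ (- be) <=
  2 `^ ga * (1 + `|s + t|) `^ (- ga) *
    ((1 + `|s|) `^ (- (2 * be - ga)) + (1 + `|t|) `^ (- (2 * be - ga))).
Proof.
move=> ga0 gabe.
have key (x y : R) : `|x| <= `|y| -> (1 + `|x|) `^ (- be) * (1 + `|y|) `^ (- be) <=
  2 `^ ga * (1 + `|x + y|) `^ (- ga) * (1 + `|x|) `^ (- (2 * be - ga)).
  move=> xy; have x0 : 0 < 1 + `|x| by rewrite ltr_pwDl.
  have y0 : 0 < 1 + `|y| by rewrite ltr_pwDl.
  have Sx a b : (1 + `|x|) `^ (a + b) = (1 + `|x|) `^ a * (1 + `|x|) `^ b.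
    by rewrite powRD// (gt_eqF x0) implybT.
  have Sy a b : (1 + `|y|) `^ (a + b) = (1 + `|y|) `^ a * (1 + `|y|) `^ b.
    by rewrite powRD// (gt_eqF y0) implybT.
  have h1 : (1 + `|y|) `^ (- (be - ga)) <= (1 + `|x|) `^ (- (be - ga)).
    by apply: powRN_le => //; rewrite ?lerD2l// subr_ge0.
  have h2 : (1 + `|y|) `^ (- ga) <= 2 `^ ga * (1 + `|x + y|) `^ (- ga).
    have [<-|] := powRN_half (1 + `|x + y|) ga; last by rewrite ltNge addr_ge0.
    apply: powRN_le => //.
    rewrite ler_pdivrMr//; have := ler_normD x y; lra.
  rewrite (_ : (1 + `|y|) `^ (- be) = (1 + `|y|) `^ (- ga) * (1 + `|y|) `^ (- (be - ga))); last first.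
    by rewrite -Sy; congr (_ `^ _); ring.
  rewrite (_ : - (2 * be - ga) = - be + - (be - ga)); last by ring.
  rewrite Sx mulrCA ler_pM ?mulr_ge0 ?powR_ge0//.
  by rewrite ler_wpM2l ?powR_ge0.
have [st|/ltW ts] := leP `|s| `|t|.
  apply: le_trans (key s t st) _; rewrite ler_wpM2l ?mulr_ge0 ?powR_ge0//.
  by rewrite lerDl powR_ge0.
rewrite mulrC (addrC s); apply: le_trans (key t s ts) _.
rewrite ler_wpM2l ?mulr_ge0 ?powR_ge0//.
by rewrite lerDr powR_ge0.
Qed.

(** Take m and -m to be the real roots of c + 2 y^2, or m = 0 when c >= 0. The parabola dominates 2
    (|y| - m)^2 in absolute value, so decay of order ga in it becomes decay of order 2 ga in the
    distance to the nearer of m and -m. The bound is uniform in c. *)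
Lemma parabola_bracket_le (ga c : R) : 0 <= ga ->
  exists m : R, forall y : R, (1 + `|c + 2 * y ^+ 2|) `^ (- ga) <=
    2 `^ ga * ((1 + `|y - m|) `^ (- (2 * ga)) + (1 + `|y + m|) `^ (- (2 * ga))).
Proof.
move=> ga0.
have [m [m0 hm]] : exists m : R, 0 <= m /\
    forall y, 2 * (`|y| - m) ^+ 2 <= `|c + 2 * y ^+ 2|.
  have [c0|c0] := leP 0 c.
    exists 0; split=> // y; rewrite subr0 real_normK ?num_real// ger0_norm.
      by rewrite lerDr.
    by rewrite addr_ge0// mulr_ge0// sqr_ge0.
  have s2 : Num.sqrt (- c / 2) ^+ 2 = - c / 2 by rewrite sqr_sqrtr// divr_ge0// oppr_ge0 ltW.
  exists (Num.sqrt (- c / 2)); split=> [|y]; first exact: sqrtr_ge0.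
  set m := Num.sqrt _ in s2 *; have m0 : 0 <= m by exact: sqrtr_ge0.
  have -> : c = - 2 * m ^+ 2 by rewrite s2; field.
  rewrite -(real_normK (num_real y)); set z := `|y|; have z0 : 0 <= z by exact: normr_ge0.
  rewrite (_ : - 2 * m ^+ 2 + 2 * z ^+ 2 = 2 * ((z - m) * (z + m))); last by ring.
  rewrite normrM (@ger0_norm _ 2)// ler_wpM2l// normrM (@ger0_norm _ (z + m)) ?addr_ge0//.
  rewrite -[leLHS]real_normK ?num_real// expr2 ler_wpM2l//.
  by rewrite ler_norml; apply/andP; split; lra.
exists m => y; set z := `|y| - m.
have z0 : 0 < 1 + `|z| by rewrite ltr_pwDl.
have h1 : (1 + `|z|) ^+ 2 / 2 <= 1 + `|c + 2 * y ^+ 2|.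
  rewrite ler_pdivrMr//; have := hm y; rewrite -/z -(real_normK (num_real z)).
  have := sqr_ge0 (`|z| - 1); set v := `|z|; nra.
have h2 : (1 + `|c + 2 * y ^+ 2|) `^ (- ga) <= 2 `^ ga * (1 + `|z|) `^ (- (2 * ga)).
  apply: le_trans (powRN_le _ h1 ga0) _; first by rewrite divr_gt0// exprn_gt0.
  have [->|] := powRN_half ((1 + `|z|) ^+ 2) ga; last by rewrite ltNge sqr_ge0.
  by rewrite -powR_mulrn ?(ltW z0)// -powRrM mulrN.
apply: le_trans h2 _; rewrite ler_wpM2l ?powR_ge0//.
have [y0|y0] := leP 0 y.
  by rewrite /z (ger0_norm y0) lerDl powR_ge0.
by rewrite /z (ltr0_norm y0) -opprD normrN lerDr powR_ge0.
Qed.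

Definition sigma (q : plane R) : R := 1 + `|q.2 + q.1 ^+ 2|.

Lemma sigma_ge1 q : 1 <= sigma q. Proof. by rewrite lerDl. Qed.
Lemma sigma_gt0 q : 0 < sigma q. Proof. exact: lt_le_trans (sigma_ge1 q). Qed.

Lemma measurable_sigma : measurable_fun setT sigma.
Proof. by rewrite /sigma; mfun. Qed.

(** For fixed first coordinate x, the quantities inside sigma(q) and sigma(p - q) add up to [A x],
    in which the second coordinate of q has cancelled. [bracket_product_le] thus isolates a power of
    1 + |A x| and leaves integrable brackets in the second variable. Since [A x] is a parabola in x
    centred at p.1 / 2, [parabola_bracket_le] handles what remains. *)
Lemma sigma_kernel_bound (be : R) : 3 / 4 < be -> be < 1 ->
  exists2 C : R, 0 < C & forall p : plane R,
    (\int[leb2 R]_q (sigma q `^ (- be) * sigma (psub p q) `^ (- be))%:E <= C%:E)%E.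
Proof.
(* With this [ga], the integrability conditions rho > 1 in the second variable and 2 ga > 1 in the
   first both read be > 3/4. *)
move=> b1 b2; pose ga := be - 1 / 4; pose rho := 2 * be - ga.
have rho1 : 1 < rho by rewrite /rho /ga; lra.
have ga1 : 1 < 2 * ga by rewrite /ga; lra.
have ga0 : 0 <= ga by rewrite /ga; lra.
have gabe : ga <= be by rewrite /ga; lra.
pose K1 := 2 `^ ga * (bracket_mass rho + bracket_mass rho).
have K10 : 0 <= K1 by rewrite mulr_ge0 ?powR_ge0 ?addr_ge0 ?bracket_mass_ge0.
pose C := K1 * (2 `^ ga * (bracket_mass (2 * ga) + bracket_mass (2 * ga))).
have C0 : 0 <= C by rewrite mulr_ge0 ?mulr_ge0 ?powR_ge0 ?addr_ge0 ?bracket_mass_ge0.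
exists (C + 1) => [|p]; first by rewrite ltr_wpDl.
apply: (@le_trans _ _ C%:E); last by rewrite lee_fin lerDl.
pose A (x : R) := p.2 + x ^+ 2 + (p.1 - x) ^+ 2.
have mA : measurable_fun setT A by rewrite /A; mfun.
have ms := measurable_sigma.
have mk : measurable_fun setT (fun q : plane R =>
    sigma q `^ (- be) * sigma (psub p q) `^ (- be)).
  have := mf_comp ms (measurable_psubf (@measurable_cst _ _ (plane R) (plane R) setT p)
    (@measurable_id _ (plane R) setT)).
  by move=> ?; mfun.
rewrite (@fubini_tonelli1 _ _ _ _ _ mu mu); last 2 first.
- exact/measurable_EFinP.
- by move=> q; rewrite lee_fin mulr_ge0 ?powR_ge0.
apply: (@le_trans _ _ (\int[mu]_x (K1 * (1 + `|A x|) `^ (- ga))%:E)%E).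
  apply: ge0_le_integral; first exact: measurableT.
  - by move=> x _; apply: integral_EFin_ge0 => y; rewrite mulr_ge0 ?powR_ge0.
  - apply: (@measurable_fun_fubini_tonelli_F _ _ _ _ _ mu (fun q : plane R =>
      (sigma q `^ (- be) * sigma (psub p q) `^ (- be))%:E)).
      exact/measurable_EFinP.
    by move=> q; rewrite lee_fin mulr_ge0 ?powR_ge0.
  - by mfun.
  move=> x _; pose D1 (y : R) := (1 + `|1 * y + x ^+ 2|) `^ (- rho).
  pose D2 (y : R) := (1 + `|-1 * y + (p.2 + (p.1 - x) ^+ 2)|) `^ (- rho).
  have mD1 : measurable_fun setT D1 by rewrite /D1; mfun.
  have mD2 : measurable_fun setT D2 by rewrite /D2; mfun.
  have D10 y : 0 <= D1 y by exact: powR_ge0.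
  have D20 y : 0 <= D2 y by exact: powR_ge0.
  apply: (@le_trans _ _ (\int[mu]_y (2 `^ ga * (1 + `|A x|) `^ (- ga) * (D1 y + D2 y))%:E)%E).
    apply: integral_EFin_le.
    - exact: (measurableT_comp mk (pair1_measurable x)).
    - by mfun.
    - by move=> y; rewrite mulr_ge0 ?powR_ge0.
    move=> y; have := bracket_product_le (y + x ^+ 2) ((p.2 - y) + (p.1 - x) ^+ 2) ga0 gabe.
    rewrite (_ : y + x ^+ 2 + (p.2 - y + (p.1 - x) ^+ 2) = A x); last by rewrite /A; ring.
    move=> /le_trans; apply; rewrite /D1 /D2 -/rho mul1r.
    by rewrite (_ : p.2 - y + (p.1 - x) ^+ 2 = -1 * y + (p.2 + (p.1 - x) ^+ 2))//; ring.
  rewrite integral_EFinZ ?mulr_ge0 ?powR_ge0//; [|by mfun|by move=> y; rewrite addr_ge0].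
  rewrite integral_EFinD// /D1 /D2 !integral_bracket_affine ?normrN1 ?normr1//.
  by rewrite -EFinD -EFinM lee_fin /K1; rewrite mulrAC.
have [m hm] := parabola_bracket_le (p.2 + p.1 ^+ 2 / 2) ga0.
pose B1 (x : R) := (1 + `|1 * x + (- (p.1 / 2) - m)|) `^ (- (2 * ga)).
pose B2 (x : R) := (1 + `|1 * x + (- (p.1 / 2) + m)|) `^ (- (2 * ga)).
have mB1 : measurable_fun setT B1 by rewrite /B1; mfun.
have mB2 : measurable_fun setT B2 by rewrite /B2; mfun.
have B10 x : 0 <= B1 x by exact: powR_ge0.
have B20 x : 0 <= B2 x by exact: powR_ge0.
apply: (@le_trans _ _ (\int[mu]_x (K1 * (2 `^ ga * (B1 x + B2 x)))%:E)%E).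
  apply: integral_EFin_le.
  - by mfun.
  - by mfun.
  - by move=> x; rewrite mulr_ge0// powR_ge0.
  move=> x; rewrite ler_wpM2l//; have := hm (x - p.1 / 2).
  rewrite (_ : p.2 + p.1 ^+ 2 / 2 + 2 * (x - p.1 / 2) ^+ 2 = A x); last by rewrite /A; field.
  by rewrite /B1 /B2 !mul1r !addrA.
rewrite integral_EFinZ//; [|by mfun|by move=> x; rewrite mulr_ge0 ?powR_ge0 ?addr_ge0].
rewrite integral_EFinZ ?powR_ge0//; [|by mfun|by move=> x; rewrite addr_ge0].
by rewrite integral_EFinD// /B1 /B2 !integral_bracket_affine ?normr1.
Qed.

End SigmaKernel.

(** * Convolution estimates *)

Section BilinearEstimates.
Context {R : realType}.
Implicit Types (p q : plane R).

(* Duality in L^2 without norms: testing X against truncations of itself. *)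
Lemma self_bound (X : plane R -> \bar R) (D : R) :
  measurable_fun setT X -> (forall p, 0 <= X p)%E -> 0 <= D ->
  (forall h : plane R -> R, measurable_fun setT h -> (forall p, 0 <= h p) ->
     (\int[leb2 R]_p (h p ^+ 2)%:E < +oo ->
      \int[leb2 R]_p ((h p)%:E * X p) <=
        2^-1%:E * (\int[leb2 R]_p (h p ^+ 2)%:E + D%:E))%E) ->
  (\int[leb2 R]_p (X p * X p) <= D%:E)%E.
Proof.
move=> mX X0 D0 hX.
pose w p : R := (pweight p)^-1.
have mw : measurable_fun setT w by exact: measurable_pweightV.
have w0 p : 0 < w p by rewrite invr_gt0 pweight_gt0.
have w1 p : w p <= 1 by rewrite invf_le1 ?pweight_gt0// exprn_ege1// weight_ge1.
(* Truncating at height n w makes h n finite even where X is infinite, and square integrable since w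
   is integrable and at most 1. *)
pose h (n : nat) p := fine (mine (X p) (n%:R * w p)%:E).
have hE n p : (h n p)%:E = mine (X p) (n%:R * w p)%:E.
  rewrite /h fineK// ge0_fin_numE; first by rewrite gt_min ltry orbT.
  by rewrite le_min X0 lee_fin mulr_ge0// ltW.
have h0 n p : 0 <= h n p.
  by rewrite -lee_fin hE le_min X0 lee_fin mulr_ge0// ltW.
have hw n p : h n p <= n%:R * w p by rewrite -lee_fin hE ge_min lexx orbT.
have hleX n p : ((h n p)%:E <= X p)%E by rewrite hE ge_min lexx.
have mh n : measurable_fun setT (h n).
  apply: measurableT_comp => //; apply: measurable_mine => //.
  by mfun.
have mh2 n : measurable_fun setT (fun p => h n p ^+ 2) by have := mh n; move=> ?; mfun.
have hy n : (\int[leb2 R]_p (h n p ^+ 2)%:E < +oo)%E.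
  apply: (@le_lt_trans _ _ (\int[leb2 R]_p (n%:R ^+ 2 * w p)%:E)%E).
    apply: integral_EFin_le => //; first by mfun.
      by move=> p; rewrite sqr_ge0.
    move=> p; apply: (@le_trans _ _ ((n%:R * w p) ^+ 2)).
      by rewrite lerXn2r ?nnegrE ?mulr_ge0 ?(ltW (w0 p)).
    by rewrite exprMn ler_wpM2l ?sqr_ge0// expr2 ler_piMr// ltW.
  rewrite integral_EFinZ ?sqr_ge0//; last by move=> p; rewrite ltW.
  by rewrite lte_mul_pinfty ?lee_fin ?sqr_ge0// pweightV_lty.
(* As h n <= X, testing against h n bounds its squared norm by half of itself plus D / 2. The
   squared norm is finite, so it can be absorbed. *)
have key n : (\int[leb2 R]_p (h n p ^+ 2)%:E <= D%:E)%E.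
  have := hX (h n) (mh n) (h0 n) (hy n).
  have le1 : (\int[leb2 R]_p (h n p ^+ 2)%:E <= \int[leb2 R]_p ((h n p)%:E * X p))%E.
    apply: ge0_le_integral; first exact: measurableT.
    - by move=> p _; rewrite lee_fin sqr_ge0.
    - exact/measurable_EFinP.
    - by apply: emeasurable_funM => //; exact/measurable_EFinP.
    - by move=> p _; rewrite expr2 EFinM lee_wpmul2l// lee_fin.
  move=> /(le_trans le1); have := hy n.
  have : (0 <= \int[leb2 R]_p (h n p ^+ 2)%:E)%E.
    by apply: integral_EFin_ge0 => p; rewrite sqr_ge0.
  case: (\int[leb2 R]_p (h n p ^+ 2)%:E)%E => [a|//|//] _ _.
  by rewrite -EFinD -EFinM !lee_fin => ?; lra.
apply: (@fatou_le _ _ _ _ (fun n p => (h n p ^+ 2)%:E)) => //.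
- by move=> n; exact/measurable_EFinP.
- exact: emeasurable_funM.
- by move=> n p; rewrite lee_fin sqr_ge0.
- by move=> p; rewrite mule_ge0.
apply: aeW => p; have := X0 p; case Xp : (X p) => [r| |] // r0.
  apply: cvg_near_cst; near=> n.
  suff -> : h n p = r by rewrite expr2 EFinM.
  apply: EFin_inj; rewrite hE Xp; apply/min_idPl; rewrite lee_fin.
  rewrite -ler_pdivrMr//; near: n; exact: nbhs_infty_ger.
rewrite mulyy; apply/cvgeyPge => A; near=> n.
have -> : h n p = n%:R * w p.
  by apply: EFin_inj; rewrite hE Xp; apply/min_idPr; rewrite leey.
have hn : `|A| + 1 <= n%:R * w p.
  by rewrite -ler_pdivrMr//; near: n; exact: nbhs_infty_ger.
rewrite lee_fin; apply: (le_trans (ler_norm A)); set v := n%:R * w p in hn *.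
have := normr_ge0 A; nra.
Unshelve. all: by end_near. Qed.

(** What is left over once each factor of a convolution has been multiplied by its power sigma^b.
    Its square is the kernel of [sigma_kernel_bound] at exponent 2b. *)
Definition sk (b : R) p q : R := sigma q `^ (- b) * sigma (psub p q) `^ (- b).

Lemma sk_ge0 b p q : 0 <= sk b p q.
Proof. by rewrite mulr_ge0 ?powR_ge0. Qed.

Lemma measurable_sk d (T : measurableType d) b (h k : T -> plane R) :
  measurable_fun setT h -> measurable_fun setT k ->
  measurable_fun setT (fun x => sk b (h x) (k x)).
Proof.
move=> mh mk; have h1 := mf_comp (@measurable_sigma R) mk.
have h2 := mf_comp (@measurable_sigma R) (measurable_psubf mh mk).
by rewrite /sk; mfun.
Qed.

Definition kernel_bound (b C : R) := forall p,
  (\int[leb2 R]_q (sk b p q ^+ 2)%:E <= C%:E)%E.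

Lemma kernel_boundP (b : R) : 3 / 8 < b -> b < 1 / 2 ->
  exists2 C : R, 0 < C & kernel_bound b C.
Proof.
move=> b1 b2; have h1 : 3 / 4 < 2 * b by lra.
have h2 : 2 * b < 1 by lra.
have [C C0 hC] := sigma_kernel_bound h1 h2; exists C => // p.
apply: le_trans (hC p); rewrite le_eqVlt; apply/orP; left; apply/eqP.
apply: eq_integral => q _; congr EFin; rewrite /sk exprMn.
by congr (_ * _); rewrite -powR_mulrn ?powR_ge0// -powRrM; congr (_ `^ _); ring.
Qed.

(** Cauchy-Schwarz in the form 2 x y <= lam x^2 + y^2 / lam. The squares of f and k integrate to F K
    by Tonelli, and the square of h times the kernel is controlled by [kernel_bound]. The free
    parameter lets each application choose which factor is tested, without square roots. *)
Lemma trilinear_le (h f k : plane R -> R) (b C F K lam : R) :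
  kernel_bound b C -> 0 <= C -> 0 < lam ->
  measurable_fun setT h -> measurable_fun setT f -> measurable_fun setT k ->
  (forall p, 0 <= h p) -> (forall p, 0 <= f p) -> (forall p, 0 <= k p) ->
  (\int[leb2 R]_p (f p ^+ 2)%:E = F%:E)%E -> (\int[leb2 R]_p (k p ^+ 2)%:E = K%:E)%E ->
  (\int[leb2 R]_p \int[leb2 R]_q (h p * (f q * k (psub p q) * sk b p q))%:E <=
   (2^-1 * lam * (F * K))%:E + (2^-1 / lam * C)%:E * \int[leb2 R]_p (h p ^+ 2)%:E)%E.
Proof.
move=> bC C0 lam0 mh mf mk h0 f0 k0 fF kK.
have m1 := @mf_fst _ _ (plane R) (plane R); have m2 := @mf_snd _ _ (plane R) (plane R).
have mhz := mf_comp mh m1; have mfz := mf_comp mf m2.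
have mkz := mf_comp mk (measurable_psubf m1 m2).
have msz := measurable_sk b m1 m2.
pose F0 (z : plane R * plane R) := h z.1 * (f z.2 * k (psub z.1 z.2) * sk b z.1 z.2).
pose F1 (z : plane R * plane R) := (2^-1 * lam) * (f z.2 ^+ 2 * k (psub z.1 z.2) ^+ 2).
pose F2 (z : plane R * plane R) := (2^-1 / lam) * (h z.1 ^+ 2 * sk b z.1 z.2 ^+ 2).
have l1 : 0 <= 2^-1 * lam by rewrite mulr_ge0// ltW.
have l2 : 0 <= 2^-1 / lam by rewrite divr_ge0// ltW.
have mF0 : measurable_fun setT F0 by rewrite /F0; mfun.
have mF1 : measurable_fun setT F1 by rewrite /F1; mfun.
have mF2 : measurable_fun setT F2 by rewrite /F2; mfun.
have F00 z : 0 <= F0 z by rewrite mulr_ge0// mulr_ge0 ?sk_ge0// mulr_ge0.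
have F10 z : 0 <= F1 z by rewrite mulr_ge0// mulr_ge0// sqr_ge0.
have F20 z : 0 <= F2 z by rewrite mulr_ge0// mulr_ge0// sqr_ge0.
have s1 (G : plane R * plane R -> R) p : measurable_fun setT G ->
    measurable_fun setT (fun q => G (p, q)).
  by move=> mG; exact: (measurableT_comp mG (pair1_measurable p)).
have s2 (G : plane R * plane R -> R) q : measurable_fun setT G ->
    measurable_fun setT (fun p => G (p, q)).
  by move=> mG; exact: (measurableT_comp mG (pair2_measurable q)).
have K0 : 0 <= K by rewrite -lee_fin -kK integral_EFin_ge0// => p; exact: sqr_ge0.
have I1 : (\int[leb2 R]_p \int[leb2 R]_q (F1 (p, q))%:E = (2^-1 * lam * (F * K))%:E)%E.
  rewrite (tonelli mF1 F10).
  transitivity (\int[leb2 R]_q (2^-1 * lam * K * f q ^+ 2)%:E)%E.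
    apply: eq_integral => q _; rewrite /F1/=.
    have mks : measurable_fun setT (fun p => k (psub p q)) := mf_comp mk (measurable_psub q).
    rewrite integral_EFinZ//; [|by mfun|by move=> p; rewrite mulr_ge0 ?sqr_ge0].
    rewrite integral_EFinZ ?sqr_ge0//; [|by mfun|by move=> p; rewrite sqr_ge0].
    rewrite (@integral_psubl _ (fun p => k p ^+ 2)); [|by mfun|by move=> p; rewrite sqr_ge0].
    by rewrite kK -!EFinM; congr EFin; ring.
  rewrite (integral_EFinZ _ (mfX 2 mf) (fun q => sqr_ge0 _) (mulr_ge0 l1 K0)).
  by rewrite fF -EFinM; congr EFin; ring.
have I2 : (\int[leb2 R]_p \int[leb2 R]_q (F2 (p, q))%:E <=
    (2^-1 / lam * C)%:E * \int[leb2 R]_p (h p ^+ 2)%:E)%E.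
  rewrite -(integral_EFinZ _ (mfX 2 mh) (fun q => sqr_ge0 _) (mulr_ge0 l2 C0)).
  apply: ge0_le_integral; first exact: measurableT.
  - by move=> p _; exact: integral_EFin_ge0.
  - exact: measurable_integral2.
  - by apply: mf_EFin; mfun.
  move=> p _; rewrite /F2/=.
  have msp : measurable_fun setT (fun q => sk b p q).
    exact: (s1 (fun z => sk b z.1 z.2) p msz).
  rewrite integral_EFinZ//; [|by mfun|by move=> q; rewrite mulr_ge0 ?sqr_ge0].
  rewrite integral_EFinZ ?sqr_ge0//; [|by mfun|by move=> q; rewrite sqr_ge0].
  rewrite [X in (_ <= X)%E](_ : _ = (2^-1 / lam)%:E * ((h p ^+ 2)%:E * C%:E))%E; last first.
    by rewrite -!EFinM; congr EFin; ring.
  by rewrite lee_wpmul2l ?lee_fin// lee_wpmul2l ?lee_fin ?sqr_ge0.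
apply: le_trans (leeD (lexx _) I2); rewrite -I1.
rewrite -ge0_integralD//; last 4 first.
- by move=> p _; exact: integral_EFin_ge0.
- exact: measurable_integral2.
- by move=> p _; exact: integral_EFin_ge0.
- exact: measurable_integral2.
apply: ge0_le_integral; first exact: measurableT.
- by move=> p _; apply: integral_EFin_ge0 => q; exact: (F00 (p, q)).
- exact: (measurable_integral2 mF0 F00).
- by apply: emeasurable_funD; exact: measurable_integral2.
move=> p _; rewrite -integral_EFinD//; [|exact: (s1 _ _ mF1)|exact: (s1 _ _ mF2)].
apply: integral_EFin_le.
- exact: (s1 _ p mF0).
- by apply: mfD; [exact: (s1 _ _ mF1)|exact: (s1 _ _ mF2)].
- by move=> q; exact: (F00 (p, q)).
(* AM-GM *)
move=> q; rewrite /F1 /F2/=; set x := f q; set y := k _; set z := h p; set s := sk b p q.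
rewrite -subr_ge0 (_ : _ - _ = 2^-1 / lam * (lam * (x * y) - z * s) ^+ 2).
  by rewrite mulr_ge0// sqr_ge0.
by field; rewrite gt_eqF.
Qed.

End BilinearEstimates.

Section ConvolutionEstimates.
Context {R : realType}.
Implicit Types (p q : plane R) (G H : plane R -> R).

Definition econv G H p : \bar R := (\int[leb2 R]_q (G q * H (psub p q))%:E)%E.

Lemma measurable_conv_kernel G H : measurable_fun setT G -> measurable_fun setT H ->
  measurable_fun setT (fun z : plane R * plane R => G z.2 * H (psub z.1 z.2)).
Proof.
move=> mG mH; apply: mfM; first exact: (mf_comp mG (@mf_snd _ _ (plane R) (plane R))).
exact: (mf_comp mH (measurable_psubf (@mf_fst _ _ (plane R) (plane R))
  (@mf_snd _ _ (plane R) (plane R)))).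
Qed.

Lemma measurable_econv G H : measurable_fun setT G -> measurable_fun setT H ->
  (forall p, 0 <= G p) -> (forall p, 0 <= H p) -> measurable_fun setT (econv G H).
Proof.
move=> mG mH G0 H0; apply: (measurable_integral2 (measurable_conv_kernel mG mH)).
by move=> z; rewrite mulr_ge0.
Qed.

Lemma econv_ge0 G H p : (forall p, 0 <= G p) -> (forall p, 0 <= H p) ->
  (0 <= econv G H p)%E.
Proof. by move=> G0 H0; apply: integral_EFin_ge0 => q; rewrite mulr_ge0. Qed.

Lemma sigma_powRK b q (x : R) : sigma q `^ b * x * sigma q `^ (- b) = x.
Proof.
rewrite mulrAC -powRD ?subrr ?powRr0 ?mul1r//.
by rewrite (gt_eqF (sigma_gt0 q)) implybT.
Qed.

Lemma measurable_sigmaM b G : measurable_fun setT G ->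
  measurable_fun setT (fun p => sigma p `^ b * G p).
Proof. by move=> mG; have := @measurable_sigma R; move=> ?; mfun. Qed.

Lemma conv2_le b C G F : kernel_bound b C -> 0 < C ->
  measurable_fun setT G -> (forall p, 0 <= G p) ->
  (\int[leb2 R]_p ((sigma p `^ b * G p) ^+ 2)%:E = F%:E)%E ->
  (\int[leb2 R]_p (econv G G p * econv G G p) <= (C * F ^+ 2)%:E)%E.
Proof.
move=> bC C0 mG G0 GF.
apply: self_bound.
- exact: measurable_econv.
- by move=> p; exact: econv_ge0.
- by rewrite mulr_ge0 ?sqr_ge0// ltW.
move=> h mh h0 hy; pose f p := sigma p `^ b * G p.
have mf : measurable_fun setT f by exact: measurable_sigmaM.
have f0 p : 0 <= f p by rewrite mulr_ge0 ?powR_ge0.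
(* Taking lam = C gives the squared norm of h the coefficient 1/2 required by [self_bound]. *)
have := trilinear_le bC (ltW C0) C0 mh mf mf h0 f0 f0 GF GF.
rewrite [X in (X <= _)%E -> _](_ : _ = \int[leb2 R]_p ((h p)%:E * econv G G p))%E.
  move=> /le_trans; apply.
  have : (0 <= \int[leb2 R]_p (h p ^+ 2)%:E)%E.
    by apply: integral_EFin_ge0 => p; rewrite sqr_ge0.
  case: (\int[leb2 R]_p (h p ^+ 2)%:E)%E hy => [r _ _|//|//].
  rewrite -!EFinM -!EFinD lee_fin le_eqVlt; apply/orP; left; apply/eqP.
  by field; rewrite gt_eqF.
apply: eq_integral => p _.
rewrite -(integral_EFinZ _ _ _ (h0 p)); first last.
- by move=> q; rewrite mulr_ge0.
- exact: (measurableT_comp (measurable_conv_kernel mG mG) (pair1_measurable p)).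
apply: eq_integral => q _; congr (_ * _)%:E.
by rewrite /f /sk -[in RHS](sigma_powRK b q (G q)) -[in RHS](sigma_powRK b (psub p q) (G _)); ring.
Qed.

(** The convolution of H with the reflection of G. *)
Definition ecorr H G q : \bar R := (\int[leb2 R]_p (H p * G (psub p q))%:E)%E.

Lemma measurable_corr_kernel H G : measurable_fun setT G -> measurable_fun setT H ->
  measurable_fun setT (fun z : plane R * plane R => H z.2 * G (psub z.2 z.1)).
Proof.
move=> mG mH; apply: mfM; first exact: (mf_comp mH (@mf_snd _ _ (plane R) (plane R))).
exact: (mf_comp mG (measurable_psubf (@mf_snd _ _ (plane R) (plane R))
  (@mf_fst _ _ (plane R) (plane R)))).
Qed.

Lemma measurable_ecorr H G : measurable_fun setT G -> measurable_fun setT H ->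
  (forall p, 0 <= G p) -> (forall p, 0 <= H p) -> measurable_fun setT (ecorr H G).
Proof.
move=> mG mH G0 H0; apply: (measurable_integral2 (measurable_corr_kernel mG mH)).
by move=> z; rewrite mulr_ge0.
Qed.

Lemma ecorr_ge0 G H p : (forall p, 0 <= G p) -> (forall p, 0 <= H p) ->
  (0 <= ecorr H G p)%E.
Proof. by move=> G0 H0; apply: integral_EFin_ge0 => q; rewrite mulr_ge0. Qed.

(** The trilinear form of [conv2_le] read in another variable: H sits at p and the test function at
    q. The test function must get the coefficient 1/2, which calls for lam = 1 / F'; the positive
    bound F' replaces F, which may vanish. *)
Lemma conv3_le b C H G A F F' : kernel_bound b C -> 0 <= C ->
  measurable_fun setT G -> (forall p, 0 <= G p) ->
  measurable_fun setT H -> (forall p, 0 <= H p) ->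
  (\int[leb2 R]_p ((sigma p `^ b * G p) ^+ 2)%:E = F%:E)%E -> F <= F' -> 0 < F' ->
  (\int[leb2 R]_p (H p ^+ 2)%:E = A%:E)%E ->
  (\int[leb2 R]_q ((sigma q `^ (- b))%:E * ecorr H G q
     * ((sigma q `^ (- b))%:E * ecorr H G q)) <= (C * F' * A)%:E)%E.
Proof.
move=> bC C0 mG G0 mH H0 GF FF F0 HA.
have A0 : 0 <= A by rewrite -lee_fin -HA integral_EFin_ge0// => p; exact: sqr_ge0.
have ms := @measurable_sigma R.
apply: self_bound.
- apply: emeasurable_funM; last exact: measurable_ecorr.
  by apply: mf_EFin; mfun.
- by move=> p; rewrite mule_ge0 ?lee_fin ?powR_ge0// ecorr_ge0.
- by rewrite mulr_ge0// mulr_ge0// ltW.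
move=> h mh h0 hy; pose k p := sigma p `^ b * G p.
have mk : measurable_fun setT k by exact: measurable_sigmaM.
have k0 p : 0 <= k p by rewrite mulr_ge0 ?powR_ge0.
have : (0 <= \int[leb2 R]_p (h p ^+ 2)%:E)%E.
  by apply: integral_EFin_ge0 => p; rewrite sqr_ge0.
case hD : (\int[leb2 R]_p (h p ^+ 2)%:E)%E hy => [r|//|//] _ r0.
have Fi0 : 0 < F'^-1 by rewrite invr_gt0.
have := trilinear_le bC C0 Fi0 mH mh mk H0 h0 k0 hD GF.
rewrite [X in (X <= _)%E -> _](_ : _ = \int[leb2 R]_q ((h q)%:E *
    ((sigma q `^ (- b))%:E * ecorr H G q)))%E.
  move=> /le_trans; apply; rewrite HA -!EFinM -!EFinD lee_fin.
  rewrite invrK (_ : 2^-1 * (r + _) = 2^-1 * r + 2^-1 * F' * C * A); last by ring.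
  rewrite lerD2r -mulrA ler_wpM2l// mulrCA ler_piMr// mulrC ler_pdivrMr// mul1r//.
have m1 := @mf_fst _ _ (plane R) (plane R); have m2 := @mf_snd _ _ (plane R) (plane R).
have mhz := mf_comp mh m2; have mHz := mf_comp mH m1.
have mkz := mf_comp mk (measurable_psubf m1 m2).
have msz := measurable_sk b m1 m2.
rewrite (@tonelli _ (fun z => H z.1 * (h z.2 * k (psub z.1 z.2) * sk b z.1 z.2))); first last.
- by move=> z; rewrite !mulr_ge0 ?powR_ge0.
- by mfun.
apply: eq_integral => q _.
rewrite muleA -EFinM -(integral_EFinZ _ _ _ (mulr_ge0 (h0 q) (powR_ge0 _ _))); first last.
- by move=> p; rewrite mulr_ge0.
- exact: (measurableT_comp (measurable_corr_kernel mG mH) (pair1_measurable q)).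
apply: eq_integral => p _; congr (_)%:E => /=.
by rewrite /k /sk -[in RHS](sigma_powRK b (psub p q) (G _)); ring.
Qed.

End ConvolutionEstimates.

(** * The trilinear estimate with the spatial weight *)

Section TrilinearEstimate.
Context {R : realType}.
Implicit Types (p q : plane R) (G H : plane R -> R) (g : plane R -> R[i]).

Definition jap q : R := 1 + `|q.1|.

Lemma jap_ge1 q : 1 <= jap q.
Proof. by rewrite /jap lerDl. Qed.

Lemma jap_gt0 q : 0 < jap q.
Proof. exact: lt_le_trans ltr01 (jap_ge1 q). Qed.

Lemma jap_psub p q : jap p <= jap q * jap (psub p q).
Proof.
have h : `|p.1| <= `|q.1| + `|p.1 - q.1|.
  by rewrite (le_trans _ (ler_normD _ _))// addrC subrK.
rewrite /jap /psub/=; have := normr_ge0 q.1; have := normr_ge0 (p.1 - q.1).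
move: h; set x := `|p.1|; set y := `|q.1|; set z := `|_ - _|; nra.
Qed.

Lemma measurable_jap : measurable_fun setT jap.
Proof.
by have h := @mf_fst _ _ (measurableTypeR R) (measurableTypeR R); rewrite /jap; mfun.
Qed.

Lemma cabs_cconv_le f g q : cmeas f -> cmeas g ->
  ((cabs (cconv f g q))%:E <= econv (fun p => cabs (f p)) (fun p => cabs (g p)) q)%E.
Proof.
move=> mf mg; have mk := cmeas_comp (cmeas_conv_kernel mf mg) (@pair1_measurable _ _ _ (plane R) q).
apply: (le_trans (cabs_cintg _ mk)); rewrite /econv le_eqVlt; apply/orP; left; apply/eqP.
by apply: eq_integral => p _; rewrite /= cabsM.
Qed.

(** Takes the value 0 where the integral is infinite, a null set in the situation of
    [econv_fin_num]. *)
Definition fconv G p : R := fine (econv G G p).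

Lemma measurable_fconv G : measurable_fun setT G -> (forall p, 0 <= G p) ->
  measurable_fun setT (fconv G).
Proof. by move=> mG G0; apply: measurableT_comp => //; exact: measurable_econv. Qed.

Lemma fconv_ge0 G p : (forall p, 0 <= G p) -> 0 <= fconv G p.
Proof. by move=> G0; rewrite fine_ge0// econv_ge0. Qed.

Section Estimate.
Variables (b C W : R) (G : plane R -> R).
Hypotheses (bC : kernel_bound b C) (C0 : 0 < C).
Hypotheses (mG : measurable_fun setT G) (G0 : forall p, 0 <= G p).
Hypothesis GW : (\int[leb2 R]_p ((sigma p `^ b * G p) ^+ 2)%:E = W%:E)%E.

Lemma mass_ge0 : 0 <= W.
Proof. by rewrite -lee_fin -GW integral_EFin_ge0// => p; rewrite sqr_ge0. Qed.

Lemma econv_fin_num : {ae leb2 R, forall p, econv G G p \is a fin_num}.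
Proof.
have h := conv2_le bC C0 mG G0 GW.
have me := measurable_econv mG mG G0 G0.
have : (leb2 R).-integrable setT (fun p => econv G G p * econv G G p)%E.
  apply/integrableP; split; first exact: emeasurable_funM.
  apply: le_lt_trans (ltry (C * W ^+ 2)); apply: le_trans h.
  rewrite le_eqVlt; apply/orP; left; apply/eqP; apply: eq_integral => p _.
  by rewrite gee0_abs// mule_ge0// econv_ge0.
move/integrable_ae => /(_ measurableT); apply: filterS => p /(_ I).
have := econv_ge0 p G0 G0; case: (econv G G p) => [r|//|//] // _.
Qed.

Lemma fconv2_le : (\int[leb2 R]_p (fconv G p ^+ 2)%:E <= (C * W ^+ 2)%:E)%E.
Proof.
apply: le_trans (conv2_le bC C0 mG G0 GW); apply: ge0_le_integral; first exact: measurableT.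
- by move=> p _; rewrite lee_fin sqr_ge0.
- by apply: mf_EFin; have := measurable_fconv mG G0; move=> ?; mfun.
- by apply: emeasurable_funM; exact: measurable_econv.
move=> p _; rewrite /fconv; have := econv_ge0 p G0 G0.
by case: (econv G G p) => [r|_|//]; rewrite ?expr2 ?EFinM//= mul0e mulyy.
Qed.

Lemma ecorr2_le :
  (\int[leb2 R]_q ((sigma q `^ (- b))%:E * ecorr (fconv G) G q
     * ((sigma q `^ (- b))%:E * ecorr (fconv G) G q)) <= (C ^+ 2 * W ^+ 3)%:E)%E.
Proof.
have := fconv2_le; have : (0 <= \int[leb2 R]_p (fconv G p ^+ 2)%:E)%E.
  by apply: integral_EFin_ge0 => p; rewrite sqr_ge0.
case hA : (\int[leb2 R]_p (fconv G p ^+ 2)%:E)%E => [A|//|//]; rewrite !lee_fin => A0 AW.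
(* [conv3_le] wants a positive bound. The product W' W^2 equals W^3 in either case. *)
pose W' := if W == 0 then 1 else W.
have W0 := mass_ge0; have W'0 : 0 < W'.
  by rewrite /W'; case: eqP => // /eqP W1; rewrite lt_neqAle eq_sym W1.
have WW : W <= W' by rewrite /W'; case: eqP => // ->.
apply: (le_trans (conv3_le bC (ltW C0) mG G0 (measurable_fconv mG G0)
  (fun p => fconv_ge0 p G0) GW WW W'0 hA)).
rewrite lee_fin; apply: (@le_trans _ _ (C * W' * (C * W ^+ 2))).
  by rewrite ler_wpM2l// mulr_ge0// ltW.
rewrite le_eqVlt; apply/orP; left; apply/eqP; rewrite /W'; case: eqP => [->|_]; ring.
Qed.

End Estimate.

Section Weighted.
Variables (b C W : R) (g : plane R -> R[i]).
Hypotheses (bC : kernel_bound b C) (C0 : 0 < C) (mg : cmeas g).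
Hypothesis gW : (\int[leb2 R]_p ((sigma p `^ b * (jap p * cabs (g p))) ^+ 2)%:E = W%:E)%E.

Let G p := cabs (g p).
Let G' p := jap p * G p.

Let mG : measurable_fun setT G. Proof. exact: measurable_cabs. Qed.
Let mG' : measurable_fun setT G'.
Proof. by have := mG; have := measurable_jap => ? ?; rewrite /G'; mfun. Qed.
Let G0 p : 0 <= G p. Proof. exact: cabs_ge0. Qed.
Let G'0 p : 0 <= G' p. Proof. by rewrite mulr_ge0// ltW// jap_gt0. Qed.

Lemma jap_econv p : ((jap p)%:E * econv G G p <= econv G' G' p)%E.
Proof.
have mk := measurableT_comp (measurable_conv_kernel mG mG) (@pair1_measurable _ _ _ (plane R) p).
have mk' := measurableT_comp (measurable_conv_kernel mG' mG') (@pair1_measurable _ _ _ (plane R) p).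
have K0 q : 0 <= G q * G (psub p q) by rewrite mulr_ge0.
rewrite -(integral_EFinZ _ mk K0 (ltW (jap_gt0 p))).
apply: integral_EFin_le => //; first by apply: mfM => //; exact: measurable_cst.
  by move=> q; exact: mulr_ge0 (ltW (jap_gt0 p)) (K0 q).
move=> q; rewrite /= /G' (_ : _ * _ * (_ * _) = jap q * jap (psub p q) * (G q * G (psub p q))).
  by rewrite ler_wpM2r// jap_psub.
by ring.
Qed.

(** Only almost everywhere: where [econv G' G'] is infinite, [fconv G'] falls back to 0 and the
    inequality may fail. *)
Lemma jap_fconv : {ae leb2 R, forall p, jap p * fconv G p <= fconv G' p}.
Proof.
have := econv_fin_num bC C0 mG' G'0 gW; apply: filterS => p h'.
have := jap_econv p; have := econv_ge0 p G0 G0.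
move: h'; rewrite /fconv; case: (econv G' G' p) => [r'|//|//] _.
case: (econv G G p) => [r|_|//]; first by rewrite -EFinM lee_fin.
by rewrite gt0_muley ?lte_fin ?jap_gt0// leye_eq.
Qed.

Lemma jap_ecorr q :
  ((jap q)%:E * ecorr (fconv G) G q <= ecorr (fconv G') G' q)%E.
Proof.
have mH := measurable_fconv mG G0; have mH' := measurable_fconv mG' G'0.
have mk := measurableT_comp (measurable_corr_kernel mG mH) (@pair1_measurable _ _ _ (plane R) q).
have mk' := measurableT_comp (measurable_corr_kernel mG' mH') (@pair1_measurable _ _ _ (plane R) q).
have K0 p : 0 <= fconv G p * G (psub p q) by rewrite mulr_ge0// fconv_ge0.
rewrite -(integral_EFinZ _ mk K0 (ltW (jap_gt0 q))).
apply: ae_ge0_le_integral => //.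
- by move=> p _; rewrite lee_fin; exact: mulr_ge0 (ltW (jap_gt0 q)) (K0 p).
- by apply: mf_EFin; apply: mfM => //; exact: measurable_cst.
- by move=> p _; rewrite lee_fin mulr_ge0// fconv_ge0.
- exact: mf_EFin.
apply: filterS jap_fconv => p hp _; rewrite lee_fin /=.
have jj : jap q <= jap p * jap (psub p q).
  apply: (le_trans (jap_psub q p)); rewrite le_eqVlt; apply/orP; left; apply/eqP.
  by rewrite /jap /psub/= distrC.
apply: (@le_trans _ _ ((jap p * fconv G p) * G' (psub p q))); last by rewrite ler_wpM2r.
rewrite (_ : _ * _ * G' _ = jap p * jap (psub p q) * (fconv G p * G (psub p q))).
  by rewrite ler_wpM2r.
by rewrite /G'; ring.
Qed.

Let X q := ((sigma q `^ (- b) * jap q)%:E * ecorr (fconv G) G q)%E.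

Lemma trilinear_major_le : (\int[leb2 R]_q (X q * X q) <= (C ^+ 2 * W ^+ 3)%:E)%E.
Proof.
have ms := @measurable_sigma R; have mj := measurable_jap.
have mH := measurable_fconv mG G0; have mH' := measurable_fconv mG' G'0.
have H0 p := fconv_ge0 p G0; have H'0 p := fconv_ge0 p G'0.
have mX : measurable_fun setT X.
  by apply: emeasurable_funM; [apply: mf_EFin; mfun|exact: measurable_ecorr].
have X0 q : (0 <= X q)%E.
  by rewrite mule_ge0 ?ecorr_ge0// lee_fin mulr_ge0 ?powR_ge0// ltW// jap_gt0.
apply: le_trans (ecorr2_le bC C0 mG' G'0 gW); apply: ge0_le_integral; first exact: measurableT.
- by move=> q _; rewrite mule_ge0.
- exact: emeasurable_funM.
- by apply: emeasurable_funM; apply: emeasurable_funM;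
    [apply: mf_EFin; mfun|exact: measurable_ecorr|apply: mf_EFin; mfun|exact: measurable_ecorr].
move=> q _; suff h : (X q <= (sigma q `^ (- b))%:E * ecorr (fconv G') G' q)%E.
  by apply: lee_pmul.
by rewrite /X EFinM -muleA lee_wpmul2l ?lee_fin ?powR_ge0// jap_ecorr.
Qed.

Lemma econv_fin p : econv G' G' p \is a fin_num -> econv G G p \is a fin_num.
Proof.
have := jap_econv p; have := econv_ge0 p G0 G0; case: (econv G' G' p) => [r'|//|//].
by case: (econv G G p) => [r|_|//]; rewrite ?gt0_muley ?lte_fin ?jap_gt0// leye_eq.
Qed.

Lemma ae_econv_fin : {ae leb2 R, forall p, econv G G p \is a fin_num}.
Proof. by apply: filterS (econv_fin_num bC C0 mG' G'0 gW) => p; exact: econv_fin. Qed.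

Section Majorants.
Variable f : plane R -> R[i].
Hypotheses (mf : cmeas f) (fg : forall p, cabs (f p) <= G p).

Lemma cabs_cconv_fconv p : econv G G p \is a fin_num -> cabs (cconv f f p) <= fconv G p.
Proof.
move=> h; rewrite -lee_fin; apply: (le_trans (cabs_cconv_le p mf mf)).
have mF := measurable_cabs mf.
rewrite /fconv fineK//; apply: integral_EFin_le.
- exact: (measurableT_comp (measurable_conv_kernel mF mF) (@pair1_measurable _ _ _ (plane R) p)).
- exact: (measurableT_comp (measurable_conv_kernel mG mG) (@pair1_measurable _ _ _ (plane R) p)).
- by move=> q; rewrite mulr_ge0 ?cabs_ge0.
- by move=> q; rewrite ler_pM ?cabs_ge0.
Qed.

Lemma cabs_cref_psub p q : cabs (cref f (psub q p)) = cabs (f (psub p q)).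
Proof. by rewrite /cref cabsJ /popp /psub/= !opprB. Qed.

(** Stated for every f dominated by g, so that a single majorant serves g and all its
    truncations. *)
Lemma cabs_cconv3_le q :
  ((cabs (cconv (cconv f f) (cref f) q))%:E <= ecorr (fconv G) G q)%E.
Proof.
have mH := measurable_fconv mG G0.
have mr : cmeas (cref f) by exact: cmeasJ (cmeas_popp mf).
have mc := cmeas_cconv mf mf.
apply: (le_trans (cabs_cconv_le q mc mr)); apply: ae_ge0_le_integral => //.
- by move=> p _; rewrite lee_fin mulr_ge0 ?cabs_ge0.
- apply: mf_EFin; exact: (measurableT_comp (measurable_conv_kernel (measurable_cabs mc)
    (measurable_cabs mr)) (@pair1_measurable _ _ _ (plane R) q)).
- by move=> p _; rewrite lee_fin mulr_ge0// fconv_ge0.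
- apply: mf_EFin; exact: (measurableT_comp (measurable_corr_kernel mG mH)
   (@pair1_measurable _ _ _ (plane R) q)).
apply: filterS ae_econv_fin => p h' _.
by rewrite lee_fin ler_pM ?cabs_ge0 ?cabs_cconv_fconv// cabs_cref_psub.
Qed.

End Majorants.

End Weighted.

End TrilinearEstimate.

(** * Construction of the function from its transform *)

Section Truncation.
Context {R : realType}.
Implicit Types (p q : plane R) (g : plane R -> R[i]).

Lemma measurable_jap_sigma_powR (r s : R) :
  measurable_fun setT (fun p => jap p `^ r * sigma p `^ s).
Proof. by have h1 := @measurable_jap R; have h2 := @measurable_sigma R; mfun. Qed.

(** For a fixed first coordinate, sigma is a translate of the bracket in the second one, so the
    integral factors as if the variables were separated. *)
Lemma jap_sigma_lty (r s : R) : 1 < r -> 1 < s ->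
  (\int[leb2 R]_p (jap p `^ (- r) * sigma p `^ (- s))%:E < +oo)%E.
Proof.
move=> r1 s1; have mf := measurable_jap_sigma_powR (- r) (- s).
rewrite (@fubini_tonelli1 _ _ _ _ _ _ _ (fun p => (jap p `^ (- r) * sigma p `^ (- s))%:E))/=; first last.
- by move=> p; rewrite lee_fin mulr_ge0 ?powR_ge0.
- exact/measurable_EFinP.
rewrite /fubini_F/=.
rewrite [X in (X < _)%E](_ : _ = \int[@lebesgue_measure R]_x
   (bracket_mass s * (1 + `|x|) `^ (- r))%:E)%E; last first.
  apply: eq_integral => x _; rewrite /jap /sigma/=.
  rewrite mulrC EFinM -(integral_bracket_affine (x ^+ 2) (normr1 _) s1).
  have mk : measurable_fun setT (fun y : R => (1 + `|1 * y + x ^+ 2|) `^ (- s)).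
    apply: (measurableT_comp (measurable_bracket_powR (- s))).
    by apply: measurable_funD => //; apply: measurable_funM.
  have := @integral_EFinZ _ _ _ (@lebesgue_measure R) _ _ mk (fun y => powR_ge0 _ _)
    (powR_ge0 (1 + `|x|) (- r)).
  move=> /= <-; by apply: eq_integral => y _; rewrite mul1r.
rewrite integral_EFinZ; first last.
- exact: bracket_mass_ge0.
- by move=> x; exact: powR_ge0.
- exact: measurable_bracket_powR.
by rewrite lte_mul_pinfty ?lee_fin ?bracket_mass_ge0// integral_bracket_powR_lty.
Qed.

Lemma powR_ge1 (x r : R) : 1 <= x -> 0 <= r -> 1 <= x `^ r.
Proof. by move=> x1 r0; rewrite -[leLHS](congr1 (@^~ r) (@powR1 R)) ge0_ler_powR// nnegrE// (le_trans ler01). Qed.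

(** The integrand of the squared X_{b,1} norm when g is the transform. *)
Definition energy b g p : R := (sigma p `^ b * (jap p * cabs (g p))) ^+ 2.

Lemma energy_ge0 b g p : 0 <= energy b g p. Proof. exact: sqr_ge0. Qed.

Lemma measurable_energy b g : cmeas g -> measurable_fun setT (energy b g).
Proof.
move=> /measurable_cabs mg; have h1 := @measurable_jap R; have h2 := @measurable_sigma R.
by rewrite /energy; mfun.
Qed.

Definition keep (A : plane R -> bool) g p : R[i] := if A p then g p else 0.

Lemma cmeas_keep (A : plane R -> bool) g : measurable_fun setT A -> cmeas g -> cmeas (keep A g).
Proof.
move=> mA [g1 g2]; split.
  rewrite (_ : (fun _ => _) = fun p => if A p then complex.Re (g p) else 0).
    exact: measurable_fun_ifT.
  by apply/funext => p; rewrite /keep; case: (A p).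
rewrite (_ : (fun _ => _) = fun p => if A p then complex.Im (g p) else 0).
  exact: measurable_fun_ifT.
by apply/funext => p; rewrite /keep; case: (A p).
Qed.

Lemma cabs_keep A g p : cabs (keep A g p) = if A p then cabs (g p) else 0.
Proof. by rewrite /keep; case: (A p); rewrite ?cabs0. Qed.

(** Write |g| as (jap |g|) times 1 / jap. The square of the first factor is at most the energy;
    where sigma <= r, the square of the second is at most r^2 jap^(-2) sigma^(-2), which is
    integrable. *)
Lemma L1_keep (b r : R) (A : plane R -> bool) g : 0 <= b -> cmeas g -> measurable_fun setT A ->
  (\int[leb2 R]_p (energy b g p)%:E < +oo)%E ->
  (forall p, A p -> sigma p <= r) -> L1 (leb2 R) (keep A g).
Proof.
move=> b0 mg mA gy Ar.
pose w p : R := jap p `^ (- 2) * sigma p `^ (- 2).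
have mw : measurable_fun setT w by exact: measurable_jap_sigma_powR.
have me := measurable_energy b mg.
have w0 p : 0 <= w p by rewrite mulr_ge0 ?powR_ge0.
apply: (@L1_le _ _ _ _ _ (fun p => 2^-1 * (energy b g p + r ^+ 2 * w p))).
- exact: cmeas_keep.
- by mfun.
- move=> p; rewrite cabs_keep; case: ifPn => [Ap|_]; last first.
    by rewrite mulr_ge0// addr_ge0 ?energy_ge0// mulr_ge0 ?sqr_ge0.
  have j0 := jap_gt0 p; have s0 := sigma_gt0 p; have rp := Ar _ Ap.
  have s1 : 1 <= sigma p `^ b by rewrite powR_ge1// sigma_ge1.
  rewrite /w !powR_invn ?(ltW j0) ?(ltW s0)//.
  have x0 := cabs_ge0 (g p); set x := cabs _ in x0 *.
  have h1 : (jap p * x) ^+ 2 <= energy b g p.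
    by rewrite /energy lerXn2r ?nnegrE ?mulr_ge0 ?powR_ge0 ?(ltW j0)// ler_peMl// mulr_ge0// ltW.
  have h2 : (jap p)^-1 ^+ 2 <= r ^+ 2 * ((jap p ^+ 2)^-1 * (sigma p ^+ 2)^-1).
    rewrite -exprVn mulrCA ler_peMr ?sqr_ge0// -exprVn -exprMn exprn_ege1//.
    by rewrite ler_pdivlMr// mul1r.
  have h3 : x = (jap p * x) * (jap p)^-1 by rewrite mulrAC mulfV ?mul1r// gt_eqF.
  rewrite {1}h3; move: h1 h2; set y := jap p * x; set z := (jap p)^-1 => h1 h2.
  have := sqr_ge0 (y - z); rewrite sqrrB; move: h1 h2.
  by set A1 := energy _ _ _; set A2 := r ^+ 2 * _ => h1 h2 h4; lra.
rewrite integral_EFinZ//; [|by mfun|by move=> p; rewrite addr_ge0 ?energy_ge0// mulr_ge0 ?sqr_ge0].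
rewrite integral_EFinD//; [|by mfun|by move=> p; rewrite energy_ge0|by move=> p; rewrite mulr_ge0 ?sqr_ge0].
rewrite (@integral_EFinZ _ _ _ _ w)// ?sqr_ge0//.
have h1 : 1 < 2 :> R by rewrite ltr1n.
have := jap_sigma_lty h1 h1; rewrite -/w; move: gy.
have : (0 <= \int[leb2 R]_p (energy b g p)%:E)%E by apply: integral_EFin_ge0 => p; exact: energy_ge0.
have : (0 <= \int[leb2 R]_p (w p)%:E)%E by exact: integral_EFin_ge0.
case: (\int[leb2 R]_p (energy b g p)%:E)%E => [x|//|//].
case: (\int[leb2 R]_p (w p)%:E)%E => [y|//|//] *.
exact: (ltry (2^-1 * (x + r ^+ 2 * y))).
Qed.

Lemma integral_popp (f : plane R -> \bar R) : measurable_fun setT f ->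
  (forall x, 0 <= f x)%E -> (\int[leb2 R]_q f (popp q) = \int[leb2 R]_q f q)%E.
Proof.
move=> mf f0; rewrite [RHS](@ge0_integral_paffine _ (-1) (0, 0)); first last.
- exact: f0.
- exact: mf.
- by rewrite oppr_eq0 oner_eq0.
rewrite sqrrN expr1n mul1e; apply: eq_integral => q _.
by rewrite paffine0 /popp !mulN1r.
Qed.

Lemma cmeas_ifourier g : cmeas g -> cmeas (ifourier g).
Proof.
move=> mg; rewrite (_ : ifourier g = fun q => fourier g (popp q)).
  exact: (cmeas_popp (cmeas_fourier mg)).
by apply/funext => q; exact: ifourierE.
Qed.

(* [|F^{-1} g|^4 = |F^{-1} (g * g)|^2]. *)
Lemma ifourier4_le b C F g : kernel_bound b C -> 0 < C -> L1 (leb2 R) g ->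
  (\int[leb2 R]_p ((sigma p `^ b * cabs (g p)) ^+ 2)%:E = F%:E)%E ->
  (\int[leb2 R]_x (cabs (ifourier g x) ^+ 4)%:E <= ((@kappa R) * (C * F ^+ 2))%:E)%E.
Proof.
move=> bC C0 Lg gF; have Lgg := L1_cconv Lg Lg; have mg := measurable_cabs Lg.1.
have g0 p : 0 <= cabs (g p) by exact: cabs_ge0.
rewrite [X in (X <= _)%E](_ : _ = \int[leb2 R]_x (cabs (fourier (cconv g g) x) ^+ 2)%:E)%E.
  apply: (le_trans (plancherel_le Lgg)).
  have k0 := @kappa_gt0 R; rewrite [leRHS]EFinM lee_wpmul2l ?lee_fin ?(ltW k0)//.
  apply: le_trans (conv2_le bC C0 mg g0 gF).
  have mc := measurable_cabs Lgg.1.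
  apply: ge0_le_integral; first exact: measurableT.
  - by move=> p _; rewrite lee_fin sqr_ge0.
  - by apply: mf_EFin; mfun.
  - by apply: emeasurable_funM; exact: measurable_econv.
  move=> p _; have le := cabs_cconv_le p Lg.1 Lg.1; have c0 := cabs_ge0 (cconv g g p).
  by rewrite expr2 EFinM; apply: (lee_pmul _ _ le le); rewrite lee_fin.
have mc := measurable_cabs (cmeas_fourier Lgg.1).
rewrite -(@integral_popp (fun x => (cabs (fourier (cconv g g) x) ^+ 2)%:E)); first last.
- by move=> x; rewrite lee_fin sqr_ge0.
- by apply: mf_EFin; mfun.
apply: eq_integral => x _; rewrite -ifourierE ifourier_cconv// cabsM.
by congr EFin; ring.
Qed.

End Truncation.

Section Sequences.
Context {R : realType}.

Lemma geometric_cvg (a : nat -> R) (s : R) :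
  (forall n, `|a n.+1 - a n| <= s * 2^-1 ^+ n) -> cvgn a.
Proof.
move=> h; have -> : a = fun n => series (fun k => a k.+1 - a k) n + a 0%N.
  by apply/funext => n; rewrite /series/= telescope_sumr// subrK.
apply: is_cvgD; last exact: is_cvg_cst.
apply: normed_cvg; apply: (@series_le_cvg _ _ (geometric s 2^-1)) => //.
- by move=> n; exact: normr_ge0.
- by move=> n; exact: le_trans (normr_ge0 _) (h n).
- by apply: is_cvg_geometric_series; rewrite ger0_norm ?invr_ge0// invf_lt1 ?ltr1n.
Qed.

Lemma geometric_bound (a : nat -> R) (s : R) : 0 <= s -> a 0%N = 0 ->
  (forall n, a n.+1 <= a n + s * 2^-1 ^+ n) -> forall n, a n <= 2 * s.
Proof.
move=> s0 a0 h n; suff : a n <= 2 * s * (1 - 2^-1 ^+ n).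
  have : 0 <= 2^-1 ^+ n :> R by rewrite exprn_ge0.
  by move: (_ ^+ n) => z z0 /le_trans; apply; nra.
elim: n => [|n IH]; first by rewrite expr0 subrr mulr0 a0.
by apply: (le_trans (h n)); rewrite exprSr; set z := _ ^+ n in IH *; lra.
Qed.

(** The majorant v is the sum of the series, integrable by monotone convergence. E, the set where
    the sum is finite, is boolean so that limits can be defined by cases and remain measurable. *)
Lemma summable_domination (t : nat -> plane R -> R) (K : R) : 0 <= K ->
  (forall n, measurable_fun setT (t n)) -> (forall n x, 0 <= t n x) ->
  (forall n, \int[leb2 R]_x (t n x)%:E <= (K * 2^-1 ^+ n)%:E)%E ->
  exists v : plane R -> R, exists E : plane R -> bool,
    [/\ measurable_fun setT v, forall x, 0 <= v x,
        (\int[leb2 R]_x (v x)%:E < +oo)%E, measurable_fun setT E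
      & {ae leb2 R, forall x, E x} /\ (forall x n, E x -> t n x <= v x)].
Proof.
move=> K0 mt t0 tK.
pose V x : \bar R := (\sum_(0 <= n <oo) (t n x)%:E)%E.
have mtE n : measurable_fun setT (fun x => (t n x)%:E) by exact: mf_EFin.
have V0 x : (0 <= V x)%E by apply: nneseries_ge0 => n _ _; rewrite lee_fin.
have mV : measurable_fun setT V.
  by apply: ge0_emeasurable_sum => // n x _ _; rewrite lee_fin.
have iV : (\int[leb2 R]_x V x <= (2 * K)%:E)%E.
  rewrite /V integral_nneseries//; last by move=> n x _; rewrite lee_fin.
  apply: lime_le; first by apply: is_cvg_nneseries => n _ _; exact: integral_EFin_ge0.
  apply: nearW => n.
  apply: (@le_trans _ _ (\sum_(0 <= k < n) (K * 2^-1 ^+ k)%:E)%E).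
    by apply: lee_sum => k _; exact: tK.
  rewrite sumEFin lee_fin; move: n; apply: geometric_bound => //.
    by rewrite big_geq.
  by move=> n; rewrite big_nat_recr.
exists (fun x => fine (V x)), (fun x => (V x < +oo)%E); split.
- exact: measurableT_comp.
- by move=> x; rewrite fine_ge0.
- apply: (@le_lt_trans _ _ (\int[leb2 R]_x V x)%E); last exact: le_lt_trans iV (ltry _).
  apply: ge0_le_integral => //.
  + by move=> x _; rewrite lee_fin fine_ge0.
  + by apply: mf_EFin; exact: measurableT_comp.
  by move=> x _; have := V0 x; case: (V x) => //= _; exact: leey.
- exact: measurable_fun_lte.
split.
  have : (leb2 R).-integrable setT V.
    apply/integrableP; split => //; apply: le_lt_trans (ltry (2 * K)).
    by under eq_integral => x _ do rewrite gee0_abs//.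
  move/integrable_ae => /(_ measurableT); apply: filterS => x /(_ I).
  by rewrite fin_numElt => /andP[].
move=> x n Vy; rewrite -lee_fin fineK ?ge0_fin_numE//.
apply: le_trans (@nneseries_lim_ge _ (fun n => (t n x)%:E) xpredT 0 n.+1 _); last first.
  by move=> k _ _; rewrite lee_fin.
rewrite big_nat_recr//= leeDr// sumEFin lee_fin; exact: sumr_ge0.
Qed.

End Sequences.

(** * Summation of the shells *)

Section Synthesis.
Context {R : realType}.
Variables (b b' C W : R) (g : plane R -> R[i]).
Hypotheses (b'0 : 0 <= b') (bb : b' < b) (bC : kernel_bound b' C) (C0 : 0 < C).
Hypotheses (mg : cmeas g) (gW : (\int[leb2 R]_p (energy b g p)%:E = W%:E)%E).

Let dl := 2 * (b - b').
Let dl0 : 0 < dl. Proof. by rewrite mulr_gt0// subr_gt0. Qed.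

(** On the n-th shell, passing from exponent b to b' gains 8^(-n) in the energy, hence 64^(-n) in
    the fourth power of the L^4 norm of the piece. Of this, 16^n is spent on the pointwise bound |d
    n| <= 2^(-n) v^(1/4), and the remaining 4^(-n) makes the series summable. *)
Definition low (n : nat) (p : plane R) : bool := sigma p `^ dl < 8 ^+ n.
Definition shell (n : nat) (p : plane R) : bool := low n.+1 p && ~~ low n p.

Let measurable_low n : measurable_fun setT (low n).
Proof.
apply: measurable_fun_ltr; last exact: measurable_cst.
by apply: mf_powR; exact: measurable_sigma.
Qed.

Let measurable_shell n : measurable_fun setT (shell n).
Proof. by apply: measurable_and => //; apply: measurable_neg. Qed.

(** Since sigma >= 1, level zero is empty and the partial sums start from 0. *)
Let low0 p : low 0 p = false.
Proof. by apply/negbTE; rewrite -leNgt expr0 powR_ge1 ?sigma_ge1// ltW. Qed.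

Let low_sigma n p : low n p -> sigma p <= (8 ^+ n) `^ dl^-1.
Proof.
move=> h; have s0 := ltW (sigma_gt0 p).
have dn0 : dl != 0 by rewrite gt_eqF.
have -> : sigma p = (sigma p `^ dl) `^ dl^-1 by rewrite -powRrM mulfV// powRr1.
rewrite ge0_ler_powR ?nnegrE ?powR_ge0 ?exprn_ge0 ?invr_ge0 ?(ltW dl0)//.
exact: (ltW h).
Qed.

Let ener_lty : (\int[leb2 R]_p (energy b g p)%:E < +oo)%E.
Proof. by rewrite gW ltry. Qed.

Let b0 : 0 <= b. Proof. exact: le_trans b'0 (ltW bb). Qed.

Lemma L1_low n : L1 (leb2 R) (keep (low n) g).
Proof. exact: (L1_keep b0 mg (measurable_low n) ener_lty (@low_sigma n)). Qed.

Let L1_shell n : L1 (leb2 R) (keep (shell n) g).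
Proof.
apply: (L1_keep b0 mg (measurable_shell n) ener_lty (r := (8 ^+ n.+1) `^ dl^-1)).
by move=> p /andP[/low_sigma].
Qed.

Lemma low_eventually p : exists N, forall n, (N <= n)%N -> low n p.
Proof.
exists (Num.bound (sigma p `^ dl)) => n Nn; rewrite /low.
apply: (lt_le_trans (archi_boundP (powR_ge0 _ _))).
apply: (@le_trans _ _ n%:R); first by rewrite ler_nat.
by rewrite -natrX ler_nat ltnW// ltn_expl.
Qed.

Let lowS n : keep (low n.+1) g = fun p => keep (low n) g p + keep (shell n) g p.
Proof.
apply/funext => p; rewrite /keep /shell.
have h : low n p -> low n.+1 p.
  by move=> h; apply: (lt_le_trans h); rewrite ler_eXn2l ?ltr1n.
have [lp|lp] := boolP (low n p); first by rewrite (h lp) andbF addr0.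
by rewrite andbT add0r.
Qed.

Let S n x := ifourier (keep (low n) g) x.
Let d n x := ifourier (keep (shell n) g) x.

Let SS n x : S n.+1 x = S n x + d n x.
Proof. by rewrite /S /d lowS !ifourierE (fourierD _ (L1_low n) (L1_shell n)). Qed.

Let S0 x : S 0 x = 0.
Proof.
rewrite /S /ifourier (_ : (fun p => _) = fun=> 0).
  by rewrite /cintg /Rintegral !integral0.
by apply/funext => p; rewrite /keep low0 mulr0.
Qed.

Let shell_energy n p :
  (sigma p `^ b' * cabs (keep (shell n) g p)) ^+ 2 <= 8^-1 ^+ n * energy b g p.
Proof.
rewrite cabs_keep; case: ifPn => [/andP[_]|_]; last first.
  by rewrite mulr0 expr0n/= mulr_ge0 ?energy_ge0// exprn_ge0.
rewrite /low -leNgt => h; rewrite exprVn ler_pdivlMl ?exprn_gt0//.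
have j1 := jap_ge1 p; have x0 := cabs_ge0 (g p); have s0 := sigma_gt0 p.
apply: (@le_trans _ _ ((sigma p `^ b * cabs (g p)) ^+ 2)); last first.
  rewrite /energy lerXn2r ?nnegrE ?mulr_ge0 ?powR_ge0// ?(le_trans ler01)//.
  by rewrite ler_wpM2l ?powR_ge0// ler_peMl.
rewrite !exprMn mulrA ler_wpM2r ?sqr_ge0//.
have -> : (sigma p `^ b) ^+ 2 = sigma p `^ dl * (sigma p `^ b') ^+ 2.
  rewrite -!powR_mulrn ?powR_ge0// -!powRrM -powRD ?(gt_eqF s0) ?implybT//.
  by congr (_ `^ _); rewrite /dl; ring.
by rewrite ler_wpM2r ?sqr_ge0.
Qed.

Let W0 : 0 <= W.
Proof. by rewrite -lee_fin -gW integral_EFin_ge0// => p; exact: energy_ge0. Qed.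

Let d4_le n : (\int[leb2 R]_x (16 ^+ n * cabs (d n x) ^+ 4)%:E <=
  ((@kappa R * C * W ^+ 2) * 2^-1 ^+ n)%:E)%E.
Proof.
have me := measurable_energy b mg.
have ms : measurable_fun setT (fun p => (sigma p `^ b' * cabs (keep (shell n) g p)) ^+ 2).
  by have h1 := measurable_cabs (L1_shell n).1; have h2 := @measurable_sigma R; mfun.
have md : measurable_fun setT (fun x => cabs (d n x) ^+ 4).
  by have h1 := measurable_cabs (cmeas_ifourier (L1_shell n).1); mfun.
have k8 : 0 <= 8^-1 ^+ n :> R by rewrite exprn_ge0.
have : (\int[leb2 R]_p ((sigma p `^ b' * cabs (keep (shell n) g p)) ^+ 2)%:E <=
    (8^-1 ^+ n * W)%:E)%E.
  rewrite EFinM -gW -(integral_EFinZ _ me (@energy_ge0 _ b g) k8).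
  apply: integral_EFin_le => //; first by mfun.
  by move=> p; rewrite sqr_ge0.
have : (0 <= \int[leb2 R]_p ((sigma p `^ b' * cabs (keep (shell n) g p)) ^+ 2)%:E)%E.
  by apply: integral_EFin_ge0 => p; exact: sqr_ge0.
case hF : (\int[leb2 R]_p ((sigma p `^ b' * cabs (keep (shell n) g p)) ^+ 2)%:E)%E => [F|//|//].
rewrite !lee_fin => F0 FW.
have k16 : 0 <= 16 ^+ n :> R by rewrite exprn_ge0.
have d40 x : 0 <= cabs (d n x) ^+ 4 by rewrite exprn_ge0// cabs_ge0.
rewrite (integral_EFinZ _ md d40 k16).
apply: (@le_trans _ _ ((16 ^+ n)%:E * (@kappa R * (C * F ^+ 2))%:E)%E).
  by rewrite lee_wpmul2l ?lee_fin//; exact: (ifourier4_le bC C0 (L1_shell n) hF).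
have kC : 0 <= @kappa R * C by rewrite mulr_ge0// ltW// kappa_gt0.
rewrite -EFinM lee_fin.
apply: (@le_trans _ _ (16 ^+ n * (@kappa R * (C * (8^-1 ^+ n * W) ^+ 2)))).
  have k0 := @kappa_gt0 R.
  rewrite ler_wpM2l// ler_wpM2l ?(ltW k0)// ler_wpM2l ?(ltW C0)//.
  by rewrite lerXn2r ?nnegrE// mulr_ge0.
rewrite (_ : _ * _ = (@kappa R * C * W ^+ 2) * (16 ^+ n * 8^-1 ^+ n ^+ 2)); last by ring.
rewrite (ler_wpM2l (mulr_ge0 kC (sqr_ge0 W)))//.
rewrite -exprM mulnC exprM -exprMn lerXn2r ?nnegrE ?mulr_ge0//.
by lra.
Qed.

Lemma cvg_cabs (u : nat -> R[i]) l : ccvg u l -> cabs (u n) @[n --> \oo] --> cabs l.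
Proof.
move=> [h1 h2]; rewrite cabsE; under eq_fun do rewrite cabsE.
apply: (@continuous_cvg _ _ _ _ _ _ (@Num.sqrt R)); first exact: sqrt_continuous.
by apply: cvgD; apply: (@continuous_cvg _ _ _ _ _ _ (fun y : R => y ^+ 2)) => //;
  exact: exprn_continuous.
Qed.

(** Almost everywhere the increments [d n x] decay geometrically, with a constant depending on x
    whose fourth power is integrable. So the truncated inverse transforms converge and are bounded
    by a multiple of that constant. *)
Lemma fourier_synthesis : exists w : plane R -> R[i], exists v : plane R -> R,
  [/\ cmeas w, measurable_fun setT v, (forall x, 0 <= v x),
      (\int[leb2 R]_x (v x)%:E < +oo)%E &
      {ae leb2 R, forall x, [/\ ccvg (fun n => ifourier (keep (low n) g) x) (w x),
        (forall n, cabs (ifourier (keep (low n) g) x) ^+ 4 <= v x) &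
        cabs (w x) ^+ 4 <= v x]}].
Proof.
have mS n := cmeas_ifourier (L1_low n).1.
have md n := cmeas_ifourier (L1_shell n).1.
have K0 : 0 <= @kappa R * C * W ^+ 2.
  by rewrite mulr_ge0 ?sqr_ge0// mulr_ge0 ?(ltW C0)// ltW// kappa_gt0.
have mt n : measurable_fun setT (fun x => 16 ^+ n * cabs (d n x) ^+ 4).
  by have h1 := measurable_cabs (md n); mfun.
have t0 n x : 0 <= 16 ^+ n * cabs (d n x) ^+ 4.
  by rewrite mulr_ge0 ?exprn_ge0 ?cabs_ge0.
have [v [E [mv v0 vy mE [aeE Ev]]]] := summable_domination K0 mt t0 d4_le.
pose s x := Num.sqrt (Num.sqrt (v x)).
have s4 x : s x ^+ 4 = v x.
  by rewrite (_ : 4 = 2 * 2)%N// exprM !sqr_sqrtr// sqrtr_ge0.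
have dle x n : E x -> cabs (d n x) <= s x * 2^-1 ^+ n.
  move=> Ex; rewrite exprVn ler_pdivlMr ?exprn_gt0//.
  rewrite -(@ler_pXn2r _ 4)// ?nnegrE ?mulr_ge0 ?exprn_ge0 ?cabs_ge0 ?sqrtr_ge0//.
  rewrite s4 exprMn mulrC; apply: le_trans (Ev x n Ex).
  by rewrite (_ : (2 ^+ n) ^+ 4 = 16 ^+ n)// -exprM mulnC exprM -natrX.
have Sb x n : E x -> cabs (S n x) <= 2 * s x.
  move=> Ex; move: n; apply: geometric_bound; rewrite ?sqrtr_ge0 ?S0 ?cabs0//.
  by move=> n; rewrite SS; apply: (le_trans (cabsD _ _)); rewrite lerD2l dle.
have cRe x : E x -> cvgn (fun n => complex.Re (S n x)).
  move=> Ex; apply: (@geometric_cvg _ _ (s x)) => n.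
  by rewrite SS cReD addrAC subrr add0r (le_trans (cabs_Re _))// dle.
have cIm x : E x -> cvgn (fun n => complex.Im (S n x)).
  move=> Ex; apply: (@geometric_cvg _ _ (s x)) => n.
  by rewrite SS cImD addrAC subrr add0r (le_trans (cabs_Im _))// dle.
(* The default 0 off E exhibits w as an everywhere limit of measurable functions. *)
pose w x : R[i] := if E x then limn (fun n => complex.Re (S n x)) +i*
   limn (fun n => complex.Im (S n x)) else 0.
(* The partial sums are bounded by 2 s with s^4 = v, whence the factor 2^4. *)
exists w, (fun x => 16 * v x); split.
- split.
    apply: (@measurable_fun_cvg _ _ _ _ (fun n x => if E x then complex.Re (S n x) else 0)).
      by move=> n; exact: (measurable_fun_ifT mE (mS n).1 (measurable_cst _)).
    by move=> x _; rewrite /w; case: ifPn => [/cRe//|_]; exact: cvg_cst.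
  apply: (@measurable_fun_cvg _ _ _ _ (fun n x => if E x then complex.Im (S n x) else 0)).
    by move=> n; exact: (measurable_fun_ifT mE (mS n).2 (measurable_cst _)).
  by move=> x _; rewrite /w; case: ifPn => [/cIm//|_]; exact: cvg_cst.
- by mfun.
- by move=> x; rewrite mulr_ge0.
- by rewrite integral_EFinZ// lte_mul_pinfty.
apply: filterS aeE => x Ex.
have cS : ccvg (fun n => S n x) (w x).
  by rewrite /w Ex; split; [exact: cRe|exact: cIm].
have S4 n : cabs (S n x) ^+ 4 <= 16 * v x.
  rewrite -s4 (_ : 16 = 2 ^+ 4); last by rewrite -natrX.
  by rewrite -exprMn lerXn2r ?nnegrE ?cabs_ge0 ?mulr_ge0 ?sqrtr_ge0// Sb.
split => //; have c4 : cabs (S n x) ^+ 4 @[n --> \oo] --> cabs (w x) ^+ 4.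
  by apply: (@continuous_cvg _ _ _ _ _ _ (fun y : R => y ^+ 4)); [exact: exprn_continuous|exact: cvg_cabs].
rewrite -(cvg_lim (@Rhausdorff R) c4); apply: limr_le; first by apply/cvg_ex; eexists; exact: c4.
by apply: nearW => n; exact: S4.
Qed.

End Synthesis.

(** * Functions as tempered distributions *)

Section TemperedFunctions.
Context {R : realType}.
Implicit Types (p q : plane R) (f g phi psi : plane R -> R[i]).

Definition brk p : R := 1 + `|p.1| + `|p.2|.

Lemma brk_ge1 p : 1 <= brk p. Proof. exact: weight_ge1. Qed.

Lemma brk_gt0 p : 0 < brk p. Proof. exact: lt_le_trans ltr01 (brk_ge1 p). Qed.

Lemma measurable_brkV N : measurable_fun setT (fun p => (brk p ^+ N)^-1).
Proof.
rewrite (_ : (fun p => _) = fun p => brk p `^ (- N%:R)).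
  have h1 := @mf_fst _ _ (measurableTypeR R) (measurableTypeR R).
  have h2 := @mf_snd _ _ (measurableTypeR R) (measurableTypeR R).
  by rewrite /brk; mfun.
by apply/funext => p; rewrite powR_invn// ltW// brk_gt0.
Qed.

Lemma decay_L1_weighted N f phi M : cmeas f -> cmeas phi ->
  (\int[leb2 R]_p (cabs (f p) * (brk p ^+ N)^-1)%:E < +oo)%E ->
  decay_le N phi M ->
  L1 (leb2 R) (fun p => f p * phi p) /\
  ((cabs (cintg (leb2 R) (fun p => f p * phi p)))%:E <=
    M%:E * \int[leb2 R]_p (cabs (f p) * (brk p ^+ N)^-1)%:E)%E.
Proof.
move=> mf mphi fy phiM; have M0 := decay_ge0 phiM.
have mfa := measurable_cabs mf; have mb := measurable_brkV N.
have mk : measurable_fun setT (fun p => cabs (f p) * (brk p ^+ N)^-1) by mfun.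
have k0 p : 0 <= cabs (f p) * (brk p ^+ N)^-1.
  by rewrite mulr_ge0 ?cabs_ge0// invr_ge0 exprn_ge0// ltW// brk_gt0.
have mfp := cmeasM mf mphi.
have le p : cabs (f p * phi p) <= M * (cabs (f p) * (brk p ^+ N)^-1).
  rewrite cabsM mulrCA ler_wpM2l ?cabs_ge0// ler_pdivlMr ?exprn_gt0 ?brk_gt0//.
  by rewrite mulrC; exact: phiM.
have le2 : (\int[leb2 R]_p (cabs (f p * phi p))%:E <=
    M%:E * \int[leb2 R]_p (cabs (f p) * (brk p ^+ N)^-1)%:E)%E.
  rewrite -(integral_EFinZ _ mk k0 M0); apply: integral_EFin_le => //.
  - exact: measurable_cabs.
  - by mfun.
  - by move=> p; exact: cabs_ge0.
split; last exact: le_trans (cabs_cintg _ mfp) le2.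
split => //; apply: (le_lt_trans le2); rewrite lte_mul_pinfty ?lee_fin//.
Qed.

Lemma tempered_funP N f : cmeas f ->
  (\int[leb2 R]_p (cabs (f p) * (brk p ^+ N)^-1)%:E < +oo)%E -> tempered_fun f.
Proof.
move=> mf fy.
have L phi : schwartz phi -> L1 (leb2 R) (fun p => f p * phi p).
  move=> Sp; have [M hM] := schwartz_decay N Sp.
  by have [] := decay_L1_weighted mf (schwartz_cmeas Sp) fy hM.
split => //; first by move=> phi Sp; have h := L _ Sp; split; [exact: L1_Re h|exact: L1_Im h].
split.
  move=> c phi psi Sp Sq.
  have h : pairing f (fun p => c * phi p + psi p) =
      cintg (leb2 R) (fun p => c * (f p * phi p) + f p * psi p).
    by apply: eq_cintg => p; ring.
  by rewrite h (cintgD (L1Z c (L _ Sp)) (L _ Sq)) (cintgZ c (L _ Sp)).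
exists N, (fine (\int[leb2 R]_p (cabs (f p) * (brk p ^+ N)^-1)%:E)) => phi Sp M hM.
have [_] := decay_L1_weighted mf (schwartz_cmeas Sp) fy (hM [::] (leq0n N)).
have i0 : (0 <= \int[leb2 R]_p (cabs (f p) * (brk p ^+ N)^-1)%:E)%E.
  apply: integral_EFin_ge0 => p.
  by rewrite mulr_ge0 ?cabs_ge0// invr_ge0 exprn_ge0// ltW// brk_gt0.
by rewrite -[X in (_ <= _ * X)%E -> _]fineK ?ge0_fin_numE// -EFinM lee_fin mulrC.
Qed.

Lemma tempered_fun_L1 f phi : tempered_fun f -> schwartz phi ->
  L1 (leb2 R) (fun p => f p * phi p).
Proof. by case=> _ /(_ phi) h _ /h [h1 h2]; exact: integrable_L1. Qed.

Lemma fourier2 psi : schwartz psi ->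
  fourier (fourier psi) = fun q => (@kappa R)%:C * psi (popp q).
Proof. by move=> Sp; apply/funext => q; rewrite fourier_popp fourierK. Qed.

(** Two transforms give [kappa] times the reflection and four give kappa^2 times the identity, so
    the preimage is kappa^(-2) times the third iterate. *)
Lemma fourier_onto psi : schwartz psi ->
  exists2 phi, schwartz phi & fourier phi = psi.
Proof.
move=> Sp; have S1 := schwartz_fourier Sp; have S2 := schwartz_fourier S1.
have S3 := schwartz_fourier S2.
exists (fun q => (@kappa R ^- 2)%:C * fourier (fourier (fourier psi)) q).
  exact: schwartzZ.
apply/funext => q; rewrite fourierZ; last exact: schwartz_L1.
rewrite (fourier2 S2) (fourier2 Sp) popK; have k0 := @kappa_gt0 R.
have -> : (@kappa R ^- 2)%:C * ((@kappa R)%:C * ((@kappa R)%:C * psi q)) =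
   (@kappa R ^- 2 * @kappa R ^+ 2)%:C * psi q.
  by apply: eqcP; rewrite !(cReM, cImM)/=; ring.
have kn : @kappa R != 0 by rewrite gt_eqF.
have -> : @kappa R ^- 2 * @kappa R ^+ 2 = 1 by apply: mulVf; rewrite expf_neq0.
by apply: eqcP; rewrite !(cReM, cImM)/=; ring.
Qed.

(** Finiteness is all that is claimed, so k X <= (sigma^(-b) X)^2 + (sigma^b k)^2 is enough, and it
    also makes sense where X is infinite. *)
Lemma cauchy_schwarz_lty (b : R) (X : plane R -> \bar R) (k : plane R -> R) :
  measurable_fun setT X -> (forall p, 0 <= X p)%E ->
  measurable_fun setT k -> (forall p, 0 <= k p) ->
  (\int[leb2 R]_p ((sigma p `^ (- b))%:E * X p * ((sigma p `^ (- b))%:E * X p)) < +oo)%E ->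
  (\int[leb2 R]_p ((sigma p `^ b * k p) ^+ 2)%:E < +oo)%E ->
  (\int[leb2 R]_p ((k p)%:E * X p) < +oo)%E.
Proof.
move=> mX X0 mk k0 h1 h2; have ms := @measurable_sigma R.
pose Y p := ((sigma p `^ (- b))%:E * X p)%E; pose l p := sigma p `^ b * k p.
have mY : measurable_fun setT Y by apply: emeasurable_funM => //; apply: mf_EFin; mfun.
have ml : measurable_fun setT l by exact: measurable_sigmaM.
have Y0 p : (0 <= Y p)%E by rewrite mule_ge0// lee_fin powR_ge0.
have l0 p : 0 <= l p by rewrite mulr_ge0// powR_ge0.
apply: (@le_lt_trans _ _ (\int[leb2 R]_p (Y p * Y p) + \int[leb2 R]_p (l p ^+ 2)%:E)%E); last first.
  exact: lte_add_pinfty.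
rewrite -ge0_integralD//; last 4 first.
- by move=> p _; rewrite mule_ge0.
- exact: emeasurable_funM.
- by move=> p _; rewrite lee_fin sqr_ge0.
- by apply: mf_EFin; mfun.
apply: ge0_le_integral; first exact: measurableT.
- by move=> p _; rewrite mule_ge0// lee_fin.
- by apply: emeasurable_funM => //; exact: mf_EFin.
- by apply: emeasurable_funD; [exact: emeasurable_funM|apply: mf_EFin; mfun].
move=> p _; have -> : ((k p)%:E * X p = (l p)%:E * Y p)%E.
  rewrite /l /Y muleA -EFinM; congr (_%:E * _)%E.
  by rewrite (sigma_powRK b p (k p)).
have := Y0 p; case: (Y p) => [y| |]//= y0; last by rewrite mulyy leey.
rewrite -!EFinM -EFinD lee_fin; have := l0 p; rewrite lee_fin in y0.
by move: (l p) => z z0; have := sqr_ge0 (y - z); nra.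
Qed.

(** As 2b <= 1, sigma^(2b) <= sigma <= brk^2; with N >= 3 the integrand is at most brk^(2 - 2N) <=
    brk^(-4). This fixes the power 3 used in [brk_pair]. *)
Lemma brk_sigma (b : R) N : 0 <= b -> 2 * b <= 1 -> (3 <= N)%N ->
  (\int[leb2 R]_p ((sigma p `^ b * (brk p ^+ N)^-1) ^+ 2)%:E < +oo)%E.
Proof.
move=> b0 b1 N3; apply: le_lt_trans (@pweightV_lty R).
have ms := @measurable_sigma R; have mb := measurable_brkV N.
apply: integral_EFin_le.
- by mfun.
- exact: measurable_pweightV.
- by move=> p; rewrite sqr_ge0.
move=> p; rewrite /pweight -/(brk p).
have m0 := brk_gt0 p; have m1 := brk_ge1 p; have s0 := sigma_gt0 p; have s1 := sigma_ge1 p.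
have h1 : sigma p `^ b ^+ 2 <= brk p ^+ 2.
  apply: (@le_trans _ _ (sigma p)).
    rewrite -powR_mulrn ?powR_ge0// -powRrM -[leRHS]powRr1 ?(ltW s0)//.
    by rewrite ler_powR// mulrC.
  rewrite /sigma /brk; apply: (@le_trans _ _ (1 + (`|p.2| + `|p.1| ^+ 2))).
    by rewrite lerD2l (le_trans (ler_normD _ _))// normrX.
  have := normr_ge0 p.1; have := normr_ge0 p.2.
  by move: (`|p.1|) (`|p.2|) => x y y0 x0; nra.
rewrite exprMn exprVn ler_pdivrMr ?exprn_gt0// ler_pdivlMl ?exprn_gt0//.
apply: (@le_trans _ _ (brk p ^+ 4 * brk p ^+ 2)); first by rewrite ler_wpM2l// exprn_ge0// ltW.
by rewrite -exprD -exprM; apply: ler_weXn2l => //; exact: (leq_mul N3 (leqnn 2)).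
Qed.

End TemperedFunctions.

(** * Uniqueness of the representing function *)

Section Annihilation.
Context {R : realType}.
Implicit Types (p q : plane R) (h k : plane R -> R).

Definition bump h := measurable_fun setT h /\ forall p, 0 <= h p <= 1.

Variable s : plane R -> R[i].
Hypothesis Ls : L1 (leb2 R) s.

Definition kills h := cintg (leb2 R) (fun p => (h p)%:C * s p) = 0.

Lemma bump_L1 h : bump h -> L1 (leb2 R) (fun p => (h p)%:C * s p).
Proof.
move=> [mh h01]; apply: (@L1_mulb _ _ _ _ (fun p => (h p)%:C) 1) => //.
by move=> p; rewrite cabsR; have /andP[h0 h1] := h01 p; rewrite ger0_norm.
Qed.

Lemma bumpM h k : bump h -> bump k -> bump (fun p => h p * k p).
Proof.
move=> [mh h01] [mk k01]; split; first by mfun.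
by move=> p; have /andP[? ?] := h01 p; have /andP[? ?] := k01 p; rewrite mulr_ge0// mulr_ile1.
Qed.

Lemma kills_lim (h_ : nat -> plane R -> R) h : (forall n, bump (h_ n)) -> bump h ->
  (forall p, h_ n p @[n --> \oo] --> h p) -> (forall n, kills (h_ n)) -> kills h.
Proof.
move=> bh_ bh hc kh_; have h0 p := cabs_ge0 (s p).
have : ccvg (fun n => cintg (leb2 R) (fun p => (h_ n p)%:C * s p))
    (cintg (leb2 R) (fun p => (h p)%:C * s p)).
  apply: (@cintg_dominated _ _ _ _ _ _ (fun p => cabs (s p)) _ _ _ _ _ Ls.2 h0).2.
  - by move=> n; exact: (bump_L1 (bh_ n)).1.
  - exact: (bump_L1 bh).1.
  - exact: measurable_cabs Ls.1.
  - by apply: aeW => p; exact: ccvgM (ccvgR (hc p)) (ccvg_cst _).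
  - apply: aeW => p n; rewrite cabsM cabsR; have /andP[a0 a1] := (bh_ n).2 p.
    by rewrite ger0_norm// ler_piMl.
by move/ccvg_unique; apply; apply: ccvg_eq (ccvg_cst 0) => n; rewrite kh_.
Qed.

Lemma killsD h k : bump h -> bump k -> kills h -> kills k -> kills (fun p => h p + k p).
Proof.
move=> bh bk kh kk; rewrite /kills -[RHS]addr0 -{1}kh -kk -cintgD; [|exact: bump_L1..].
by apply: eq_cintg => p; rewrite rmorphD/= mulrDl.
Qed.

Lemma killsB h k : bump h -> bump k -> kills h -> kills k -> kills (fun p => h p - k p).
Proof.
move=> bh bk kh kk.
have L1N := L1Z (-1) (bump_L1 bk).
have e : cintg (leb2 R) (fun p => -1 * ((k p)%:C * s p)) = 0.
  by rewrite cintgZ ?kk ?mulr0//; exact: bump_L1.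
rewrite /kills -[RHS]addr0 -{1}kh -e -cintgD//; last exact: bump_L1.
by apply: eq_cintg => p; rewrite rmorphB/= mulrBl mulN1r.
Qed.

Lemma bump_indic d (T : measurableType d) (e : plane R -> T) (A : set T) :
  measurable_fun setT e -> measurable A -> bump (fun p => \1_A (e p)).
Proof.
move=> me mA; split; first exact: (measurableT_comp (measurable_indic _) me).
by move=> p; rewrite indicE; case: (_ \in _); rewrite ?lexx ?ler01.
Qed.

Lemma sum_indic_disjoint (T : Type) (F : (set T)^nat) x n : trivIset setT F ->
  \sum_(i < n) \1_(F i) x = \1_(\bigcup_(i in [set i | (i < n)%N]) F i) x :> R.
Proof.
move=> tF; have [[m Fm]|nF] := pselect (exists m, F m x); last first.
  rewrite big1 => [|i _].
    by rewrite indicE memNset// => -[m _ Fm]; apply: nF; exists m.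
  by rewrite indicE memNset// => Fm; apply: nF; exists i.
have E i : \1_(F i) x = (i == m)%:R :> R.
  rewrite indicE; congr (_%:R); case: eqP => [->|im]; first by rewrite mem_set.
  by rewrite memNset// => Fi; apply: im; apply: tF => //; exists x.
rewrite (eq_bigr (fun i : 'I_n => ((i : nat) == m)%:R)) => [|i _]; last exact: E.
have [mn|nm] := ltnP m n.
  rewrite (bigD1 (Ordinal mn))//= eqxx big1 ?addr0 => [|i]; last first.
    by rewrite -val_eqE/= => /negbTE ->.
  by rewrite indicE mem_set//; exists m.
rewrite big1 => [|i _].
  rewrite indicE memNset// => -[i /= ni Fi].
  have im : i = m by apply: tF => //; exists x.
  by move: ni; rewrite im ltnNge nm.
by rewrite ltn_eqF// (leq_trans (ltn_ord i)).
Qed.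

(** The fixed factor k and the map e let the induction run in one coordinate while the other is
    frozen. It is used with each projection in turn, and then with the identity of the plane. *)
Lemma dynkin_kills d (T : measurableType d) (G : set (set T)) (e : plane R -> T) k :
  measurable_fun setT e -> bump k -> @measurable _ T = <<s G >> -> setI_closed G ->
  kills k -> (forall A, G A -> kills (fun p => k p * \1_A (e p))) ->
  forall A, measurable A -> kills (fun p => k p * \1_A (e p)).
Proof.
move=> me bk mG GI kk kG A mA.
have bA B : measurable B -> bump (fun p => k p * \1_B (e p)).
  by move=> mB; apply: bumpM => //; exact: bump_indic.
apply: (@dynkin_induction _ T G (fun A => kills (fun p => k p * \1_A (e p)))) => //.
- by rewrite (_ : (fun p => _) = k)//; apply/funext => p; rewrite indicT mulr1.
- move=> S mS kS.
  rewrite (_ : (fun p => _) = (fun p => k p - k p * \1_S (e p))).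
    by apply: killsB => //; exact: bA.
  by apply/funext => p; rewrite indicC indicE; case: (_ \in _); rewrite /= ?mulr1 ?mulr0 ?subr0 ?subrr.
- move=> F mF tF kF.
  have mU n : measurable (\bigcup_(i in [set i | (i < n)%N]) F i).
    exact: bigcup_measurable.
  apply: (@kills_lim (fun n p => k p * \1_(\bigcup_(i in [set i | (i < n)%N]) F i) (e p))).
  + by move=> n; exact: bA.
  + by apply: bA; exact: bigcup_measurable.
  + move=> p; apply: cvgM; first exact: cvg_cst.
    apply: cvg_near_cst; have [[m _ Fm]|nF] := pselect ((\bigcup_k F k) (e p)).
      near=> n; rewrite !indicE !mem_set//; first by exists m.
      by exists m => //=; near: n; exact: nbhs_infty_gt.
    near=> n; rewrite !indicE !memNset// => -[i _ Fi]; by apply: nF; exists i.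
  elim=> [|n IH].
    rewrite /kills (_ : (fun p => _) = (fun p => 0 * s p)).
      by rewrite cintgZ ?mul0r.
    apply/funext => p; congr (_ * _); apply: eqcP => //=.
    by rewrite indicE memNset ?mulr0// => -[].
  rewrite (_ : (fun p => _) = (fun p => k p * \1_(\bigcup_(i in [set i | (i < n)%N]) F i) (e p)
     + k p * \1_(F n) (e p))).
    by apply: killsD => //; exact: bA.
  by apply/funext => p; rewrite -!sum_indic_disjoint// big_ord_recr mulrDr.
- by rewrite -mG.
Unshelve. all: by end_near. Qed.

End Annihilation.

(** * From gaussian tests to all measurable sets *)

Section Rectangles.
Context {R : realType}.
Implicit Types (p q : plane R).
Local Notation mu := (@lebesgue_measure R).

Definition rect (a b c d : R) p : R := \1_(`]a, b]) p.1 * \1_(`]c, d]) p.2.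

Lemma bump_rect a b c d : bump (rect a b c d).
Proof.
by apply: bumpM; apply: bump_indic.
Qed.

Lemma itv_mu_lty (a b : R) : (mu `]a, b] < +oo)%E.
Proof. by rewrite lebesgue_measure_itv /=; case: ifP => // _; rewrite -EFinB ltry. Qed.

Lemma L1_rect a b c d : L1 (leb2 R) (fun p => (rect a b c d p)%:C).
Proof.
have [mr r01] := bump_rect a b c d; split; first exact: cmeasR.
have mA : measurable (`]a, b]%classic : set (measurableTypeR R)) by exact: measurable_itv.
have mB : measurable (`]c, d]%classic : set (measurableTypeR R)) by exact: measurable_itv.
rewrite [ltLHS](_ : _ = \int[leb2 R]_p (\1_(`]a, b]%classic `*` `]c, d]%classic) p)%:E)%E.
  rewrite integral_indic//; last exact: measurableX.
  rewrite setIT; apply: (@le_lt_trans _ _ (mu `]a, b] * mu `]c, d])%E); last first.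
    by rewrite lte_mul_pinfty ?ge0_fin_numE ?itv_mu_lty.
  by rewrite -(@product_measure1E _ _ _ _ _ mu mu _ _ mA mB).
apply: eq_integral => p _; rewrite cabsR ger0_norm ?(andP (r01 p)).1//.
by rewrite /rect !indicE in_setX -natrM mulnb.
Qed.

Lemma ae_fst_neq (a : R) : {ae leb2 R, forall p, p.1 <> a}.
Proof.
exists ([set a] `*` setT); split.
- exact: measurableX.
- by rewrite product_measure1E// [X in (X * _)%E](@lebesgue_measure_set1 R a) mul0e.
- by move=> p /= /contrapT.
Qed.

Lemma ae_snd_neq (a : R) : {ae leb2 R, forall p, p.2 <> a}.
Proof.
exists (setT `*` [set a]); split.
- exact: measurableX.
- by rewrite product_measure1E// [X in (_ * X)%E](@lebesgue_measure_set1 R a) mule0.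
- by move=> p /= /contrapT.
Qed.

Lemma cvg_indic_itv (a b y : R) (x : nat -> R) : x n @[n --> \oo] --> y -> y <> a -> y <> b ->
  (\1_(`]a, b]) (x n) : R) @[n --> \oo] --> (\1_(`]a, b]) y : R).
Proof.
move=> xy /eqP ya /eqP yb; apply: cvg_near_cst.
have [ay|ay] := ltP a y; last first.
  have {}ay : y < a by rewrite lt_neqAle ya.
  near=> n; have xa : x n < a by near: n; exact: cvgr_lt xy _ ay.
  by rewrite !indicE !memNset//= in_itv/=; apply/negP; rewrite negb_and -leNgt ltW.
have [yb'|yb'] := ltP y b; last first.
  have {}yb' : b < y by rewrite lt_neqAle eq_sym yb.
  near=> n; have xb : b < x n by near: n; exact: cvgr_gt xy _ yb'.
  by rewrite !indicE !memNset//= in_itv/=; apply/negP; rewrite negb_and -[X in _ || X]ltNge ?xb ?yb' orbT.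
near=> n; have xa : a < x n by near: n; exact: cvgr_gt xy _ ay.
have xb : x n < b by near: n; exact: cvgr_lt xy _ yb'.
by rewrite !indicE !mem_set//= in_itv/= ?xa ?ay ?ltW.
Unshelve. all: by end_near. Qed.

Lemma cvg_rect a b c d q : q.1 <> a -> q.1 <> b -> q.2 <> c -> q.2 <> d ->
  forall p, rect a b c d (paffine (eps n) q p) @[n --> \oo] --> rect a b c d q.
Proof.
move=> *; rewrite /rect /paffine/=.
have h (x y : R) : eps n * x + y @[n --> \oo] --> y.
  rewrite -[X in _ --> X]add0r; apply: cvgD; last exact: cvg_cst.
  by under eq_fun do rewrite mulrC; exact: cvg_mulr_eps.
by apply: cvgM; exact: cvg_indic_itv.
Qed.

(** Averaging the hypothesis over centres x in the rectangle turns the gaussian tests into the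
    smoothed indicator [J n], which tends to [kappa] times the indicator off the four lines bounding
    the rectangle. *)
Lemma kills_rect (s : plane R -> R[i]) a b c d : L1 (leb2 R) s ->
  (forall n x, cintg (leb2 R) (fun y => s y * (gauss_kernel n (psub y x))%:C) = 0) ->
  kills s (rect a b c d).
Proof.
move=> Ls s0; have [mr r01] := bump_rect a b c d; have LA := L1_rect a b c d.
have r1 p : 0 <= rect a b c d p by have /andP[] := r01 p.
pose k n (z : plane R * plane R) : R[i] := (gauss_kernel n (psub z.2 z.1))%:C.
have mk n : cmeas (k n).
  apply: cmeasR; apply: (measurableT_comp (measurable_gauss_kernel n)).
  exact: (measurable_psubf (@mf_snd _ _ (plane R) (plane R)) (@mf_fst _ _ (plane R) (plane R))).
have gm := ltW (@gauss_mass_gt0 R).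
have kb n z : cabs (k n z) <= gauss_mass * n.+1%:R ^+ 2.
  rewrite cabsR ger0_norm ?gauss_kernel_ge0// /gauss_kernel mulrA ler_piMr ?gauss_le1//.
  by rewrite mulr_ge0 ?sqr_ge0.
have e0 n : eps n != 0 :> R by rewrite gt_eqF ?eps_gt0.
pose I n y := cintg (leb2 R) (fun x => k n (x, y) * (rect a b c d x)%:C).
have mg := @measurable_gauss R.
pose J n y := cintg (leb2 R) (fun z => (rect a b c d (paffine (eps n) y z))%:C * (gauss_mass * gauss z)%:C).
have LI n y : L1 (leb2 R) (fun x => k n (x, y) * (rect a b c d x)%:C).
  apply: (L1_mulb _ (fun x => kb n (x, y))) => //.
  by apply: (cmeas_comp (mk n)); exact: pair2_measurable.
have IJ n y : I n y = J n y.
  rewrite /I /J (@cintg_paffine _ (eps n) y)// -cintgZ; last exact: (L1_paffine y (e0 n) (LI n y)).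
  apply: eq_cintg => z; rewrite mulrA mulrC; congr (_ * _).
  rewrite -rmorphM/= /k /gauss_kernel /eps; congr (_%:C).
  rewrite mulrCA; congr (gauss_mass * _).
  rewrite mulrA -exprMn mulVf ?pnatr_eq0// expr1n mul1r !gaussE paffine0 /psub/=.
  by congr (expR (- (_ / 2))); field; rewrite addrC natr1 pnatr_eq0.
have mJ1 n y : cmeas (fun z => (rect a b c d (paffine (eps n) y z))%:C * (gauss_mass * gauss z)%:C).
  apply: cmeasM; apply: cmeasR; last by mfun.
  exact: (measurableT_comp mr (measurable_paffine _ _)).
have gmy : (\int[leb2 R]_x (gauss_mass * gauss x)%:E = (@kappa R)%:E)%E.
  by rewrite (integral_EFinZ _ mg (fun x => ltW (gauss_gt0 x)) gm) gauss_massE.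
have gg0 (x : plane R) : 0 <= gauss_mass * gauss x :> R by rewrite mulr_ge0// ltW// gauss_gt0.
have J1 n y z : cabs ((rect a b c d (paffine (eps n) y z))%:C * (gauss_mass * gauss z)%:C) <=
    gauss_mass * gauss z.
  rewrite cabsM !cabsR !ger0_norm// ler_piMl//.
  by have /andP[] := r01 (paffine (eps n) y z).
have mgg : measurable_fun setT (fun x : plane R => gauss_mass * gauss x) by mfun.
have Jb n y : cabs (J n y) <= @kappa R.
  rewrite -lee_fin -gmy; apply: (le_trans (cabs_cintg _ (mJ1 n y))).
  apply: integral_EFin_le => //; first exact: measurable_cabs (mJ1 n y).
  by move=> x; exact: cabs_ge0.
have cJ : {ae leb2 R, forall y, ccvg (fun n => J n y) ((rect a b c d y)%:C * (@kappa R)%:C)}.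
  apply: filterS (filterI (filterI (ae_fst_neq a) (ae_fst_neq b))
    (filterI (ae_snd_neq c) (ae_snd_neq d))) => y [[ya yb] [yc yd]].
  have LG : L1 (leb2 R) (fun z : plane R => (gauss_mass * gauss z)%:C).
    split; first exact: cmeasR.
    under eq_integral do rewrite cabsR ger0_norm//.
    by rewrite gmy ltry.
  rewrite (_ : _ * (@kappa R)%:C =
    cintg (leb2 R) (fun z => (rect a b c d y)%:C * (gauss_mass * gauss z)%:C)).
    apply: (@cintg_dominated _ _ _ _
      (fun n z => (rect a b c d (paffine (eps n) y z))%:C * (gauss_mass * gauss z)%:C)
      (fun z => (rect a b c d y)%:C * (gauss_mass * gauss z)%:C)
      (fun z => gauss_mass * gauss z) _ _ _ _ _ _ _).2 => //.
    - by apply: cmeasM; [exact: cmeas_cst|exact: cmeasR].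
    - apply: aeW => z; apply: ccvgM (ccvg_cst _); apply: ccvgR; exact: cvg_rect.
    - by apply: aeW => z n; exact: J1.
    - by rewrite gmy ltry.
  by rewrite cintgZ// cintgR /Rintegral gmy.
have mJ n : cmeas (J n).
  rewrite (_ : J n = I n); last by apply/funext => y; rewrite IJ.
  apply: (@cmeas_cintg2 _ _ _ _ _ sleb2 (fun z => k n z * (rect a b c d z.1)%:C)).
  apply: cmeasM => //; apply: cmeasR; exact: (mf_comp mr (@mf_fst _ _ (plane R) (plane R))).
have k0 := @kappa_gt0 R.
have lim : ccvg (fun n => cintg (leb2 R) (fun y => s y * J n y))
   (cintg (leb2 R) (fun y => s y * ((rect a b c d y)%:C * (@kappa R)%:C))).
  have ms := measurable_cabs Ls.1.
  apply: (@cintg_dominated _ _ _ _ (fun n y => s y * J n y)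
    (fun y => s y * ((rect a b c d y)%:C * (@kappa R)%:C))
    (fun z => @kappa R * cabs (s z)) _ _ _ _ _ _ _).2.
  - by move=> n; exact: (cmeasM Ls.1 (mJ n)).
  - apply: cmeasM; first exact: Ls.1.
    by apply: cmeasM; [exact: cmeasR|exact: cmeas_cst].
  - by mfun.
  - by apply: filterS cJ => y hy; exact: ccvgM (ccvg_cst _) hy.
  - by apply: aeW => y n; rewrite cabsM mulrC ler_wpM2r ?cabs_ge0.
  - rewrite (integral_EFinZ _ ms (fun x => cabs_ge0 _) (ltW k0)).
    by rewrite lte_mul_pinfty ?lee_fin ?(ltW k0)//; exact: Ls.2.
  - by move=> x; rewrite mulr_ge0 ?cabs_ge0// ltW.
have E0 n : cintg (leb2 R) (fun y => s y * J n y) = 0.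
  transitivity (cintg (leb2 R) (fun x => (rect a b c d x)%:C *
      cintg (leb2 R) (fun y => k n (x, y) * s y))); last first.
    rewrite (_ : (fun x => _) = (fun x => 0 * (rect a b c d x)%:C)).
      by rewrite cintgZ ?mul0r.
    apply/funext => x; rewrite (_ : cintg _ _ = 0) ?mulr0 ?mul0r//.
    by rewrite -(s0 n x); apply: eq_cintg => y; rewrite mulrC.
  rewrite (fubini_kernel (mk n) (kb n) LA Ls).
  by apply: eq_cintg => y; rewrite -IJ.
have := ccvg_unique lim (ccvg_eq (fun n => esym (E0 n)) (ccvg_cst 0)).
rewrite (_ : (fun y => _) = (fun y => (@kappa R)%:C * ((rect a b c d y)%:C * s y))).
  rewrite cintgZ; last exact: (bump_L1 Ls (bump_rect a b c d)).
  move/eqP; rewrite mulf_eq0 => /orP[/eqP/(congr1 (@complex.Re R))/= h|/eqP//].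
  by rewrite h ltxx in k0.
by apply/funext => y; rewrite mulrC mulrAC mulrC.
Qed.

Lemma annihilator_ae0 (s : plane R -> R[i]) : L1 (leb2 R) s ->
  (forall n x, cintg (leb2 R) (fun y => s y * (gauss_kernel n (psub y x))%:C) = 0) ->
  {ae leb2 R, forall p, s p = 0}.
Proof.
move=> Ls s0; have kr a b c d := @kills_rect s a b c d Ls s0.
have mfst : measurable_fun [set: plane R] (fun p => p.1) := measurable_fst.
have msnd : measurable_fun [set: plane R] (fun p => p.2) := measurable_snd.
have mN n : measurable (`](- n%:R), n%:R] : set (measurableTypeR R)) by exact: measurable_itv.
have cN (x : R) : (\1_(`](- n%:R), n%:R]) x : R) @[n --> \oo] --> (1 : R).
  apply: cvg_near_cst; near=> n; rewrite indicE mem_set//= in_itv/=.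
  have : `|x| < n%:R by near: n; exact: nbhs_infty_gtr.
  by rewrite ltr_norml => /andP[-> /ltW ->].
have oc : setI_closed (@ocitv R) by exact: ocitvI.
have oE : @measurable _ (measurableTypeR R) = <<s @ocitv R >> by [].
have moc (A : set (measurableTypeR R)) : ocitv A -> measurable A.
  by move=> ?; rewrite oE; exact: sub_sigma_algebra.
have bf (A : set (measurableTypeR R)) : measurable A -> bump (fun p => \1_A p.1 : R).
  by move=> mA; exact: bump_indic.
have bs (A : set (measurableTypeR R)) : measurable A -> bump (fun p => \1_A p.2 : R).
  by move=> mA; exact: bump_indic.
have k1 (J : set R) : ocitv J -> forall A : set (measurableTypeR R), measurable A ->
    kills s (fun p => \1_J p.2 * \1_A p.1).
  move=> oJ; have [[c d] _ /= JE] := oJ.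
  apply: (@dynkin_kills _ s Ls _ _ (@ocitv R)) => //; first exact: (bs _ (moc _ oJ)).
    apply: (@kills_lim _ s Ls (fun n p => \1_J p.2 * \1_(`](- n%:R), n%:R]) p.1)).
    - by move=> n; apply: bumpM; [exact: (bs _ (moc _ oJ))|exact: bf].
    - exact: (bs _ (moc _ oJ)).
    - by move=> p; rewrite -[X in _ --> X]mulr1; apply: cvgM => //; exact: cvg_cst.
    - move=> n; rewrite -JE (_ : (fun p => _) = rect (- n%:R) n%:R c d)//.
      by apply/funext => p; rewrite /rect mulrC.
  move=> A [[a b] _ /= <-]; rewrite -JE (_ : (fun p => _) = rect a b c d)//.
  by apply/funext => p; rewrite /rect mulrC.
have mT : measurable (setT : set (measurableTypeR R)) by exact: measurableT.
have k2 (A : set (measurableTypeR R)) : measurable A ->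
    forall B : set (measurableTypeR R), measurable B -> kills s (fun p => \1_A p.1 * \1_B p.2).
  move=> mA; have swap J : ocitv J -> kills s (fun p => \1_A p.1 * \1_J p.2).
    move=> oJ; rewrite (_ : (fun p => _) = (fun p => \1_J p.2 * \1_A p.1)); first exact: k1.
    by apply/funext => p; rewrite mulrC.
  apply: (@dynkin_kills _ s Ls _ _ (@ocitv R)) => //; first exact: bf.
  apply: (@kills_lim _ s Ls (fun n p => \1_A p.1 * \1_(`](- n%:R), n%:R]) p.2)).
  - by move=> n; apply: bumpM; [exact: bf|exact: bs].
  - exact: bf.
  - by move=> p; rewrite -[X in _ --> X]mulr1; apply: cvgM; [exact: cvg_cst|exact: cN].
  - by move=> n; apply: swap; exact: is_ocitv.
have k3 (E : set (plane R)) : measurable E -> kills s (\1_E).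
  move=> mE; rewrite (_ : \1_E = fun p => 1 * \1_E p :> R); last first.
    by apply/funext => p; rewrite mul1r.
  have b1 : bump (fun=> 1 : R) by split => // p; rewrite ler01 lexx.
  have mid : measurable_fun [set: plane R] (fun p : plane R => p) by exact: measurable_id.
  apply: (@dynkin_kills _ s Ls _ (plane R) _ (fun p => p) (fun=> 1) mid b1
    (measurable_prod_measurableType _ _)) => //.
  - move=> _ _ [A1 mA1 [A2 mA2 <-]] [B1 mB1 [B2 mB2 <-]].
    exists (A1 `&` B1); first exact: measurableI.
    by exists (A2 `&` B2); [exact: measurableI|rewrite setXI].
  - rewrite (_ : (fun=> 1) = fun p => \1_(setT : set (measurableTypeR R)) p.1 *
      \1_(setT : set (measurableTypeR R)) p.2 :> R); first exact: k2.
    by apply/funext => p; rewrite !indicT mulr1.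
  - move=> _ [A mA [B mB <-]].
    rewrite (_ : (fun p => _) = (fun p => \1_A p.1 * \1_B p.2 :> R)); first exact: k2.
    by apply/funext => p; rewrite mul1r !indicE in_setX -natrM mulnb.
(* Vanishing integrals over all measurable sets force a real function to vanish almost everywhere;
   this is applied to both parts of s. *)
have key (r : plane R -> R) : (leb2 R).-integrable setT (fun p => (r p)%:E) ->
    (forall E, measurable E -> Rintegral (leb2 R) setT (fun p => \1_E p * r p) = 0) ->
    {ae leb2 R, forall p, r p = 0}.
  move=> ir hr; have mr := measurable_int _ ir.
  have := @integral_ae_eq _ _ _ (leb2 R) setT measurableT (cst 0%E) _ ir (measurable_cst _).
  move=> h; suff h2 : ae_eq (leb2 R) setT (fun p => (r p)%:E) (cst 0%E).
    by apply: filterS h2 => p /(_ I) [].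
  apply: h => E _ mE; rewrite integral_cst// mul0e.
  have iE : (leb2 R).-integrable E (fun p => (r p)%:E) by exact: integrableS ir.
  have := hr E mE; rewrite /Rintegral.
  rewrite (_ : (fun p => _) = ((fun p => (r p)%:E) \_ E)%E); last first.
    apply/funext => p; rewrite patchE indicE; case: (p \in E); first by rewrite mul1r.
    by rewrite mul0r.
  rewrite -integral_mkcond => h0.
  by rewrite -[LHS]fineK ?h0//; exact: integrable_fin_num.
have hRe : {ae leb2 R, forall p, complex.Re (s p) = 0}.
  apply: key; first exact: L1_Re.
  move=> E mE; have := congr1 (@complex.Re R) (k3 E mE); rewrite /= => h.
  by rewrite -[RHS]h; apply: eq_Rintegral => p _; rewrite cReM/= mul0r subr0.
have hIm : {ae leb2 R, forall p, complex.Im (s p) = 0}.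
  apply: key; first exact: L1_Im.
  move=> E mE; have := congr1 (@complex.Im R) (k3 E mE); rewrite /= => h.
  by rewrite -[RHS]h; apply: eq_Rintegral => p _; rewrite cImM/= mul0r addr0.
by apply: filterS2 hRe hIm => p h1 h2; apply: eqcP.
Unshelve. all: by end_near. Qed.

End Rectangles.

Section Uniqueness.
Context {R : realType}.
Implicit Types (p q : plane R).

(** Completing the square. It makes the product of the two gaussians a Schwartz test function. *)
Lemma gauss_mul_kernel n (x : plane R) : exists al c : R, exists a : plane R, 0 < al /\
  forall y, gauss y * gauss_kernel n (psub y x) = c * gauss2 al al a y.
Proof.
pose m : R := n.+1%:R; pose D := 1 + m ^+ 2.
have D0 : 0 < D by rewrite ltr_pwDl// sqr_ge0.
exists (D / 2), (gauss_mass * m ^+ 2 * expR (- (m ^+ 2 / (2 * D) * (x.1 ^+ 2 + x.2 ^+ 2)))),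
  (m ^+ 2 / D * x.1, m ^+ 2 / D * x.2).
split; first by rewrite divr_gt0.
move=> y; rewrite /gauss_kernel -/m paffine0 !gaussE /gauss2 /psub/=.
have h (u v w z : R) : u * (w * (z * v)) = w * z * (u * v) by ring.
rewrite h -[RHS]mulrA; congr (_ * _); rewrite -!expRD; congr expR.
by rewrite /D; field; rewrite -/D gt_eqF.
Qed.

(** d need not be integrable, but [d * gaussc] is. Its averages against gaussian kernels are
    pairings of d with products of two gaussians, hence zero, and [gaussc] has no zeros. *)
Lemma pairing_ae0 (d : plane R -> R[i]) : cmeas d ->
  (forall phi, schwartz phi -> L1 (leb2 R) (fun p => d p * phi p)) ->
  (forall phi, schwartz phi -> cintg (leb2 R) (fun p => d p * phi p) = 0) ->
  {ae leb2 R, forall p, d p = 0}.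
Proof.
move=> md Ld d0; have SG := @schwartz_gaussc R.
have : {ae leb2 R, forall p, d p * gaussc p = 0}.
  apply: annihilator_ae0; first exact: Ld.
  move=> n x; have [al [c [a [al0 E]]]] := gauss_mul_kernel n x.
  have SE := schwartz_gauss2 a al0 al0.
  rewrite -[RHS](mulr0 (c%:C)) -(d0 _ SE) -cintgZ; last exact: Ld.
  apply: eq_cintg => y; rewrite -mulrA [RHS]mulrCA; congr (_ * _).
  by rewrite /gaussc -!rmorphM/= E.
apply: filterS => p /eqP; rewrite mulf_eq0 => /orP[/eqP//|/eqP/(congr1 (@complex.Re R))/= h].
by have := gauss_gt0 p; rewrite h ltxx.
Qed.

Lemma is_function_unique (U : (plane R -> R[i]) -> R[i]) u v :
  is_function U u -> is_function U v -> {ae leb2 R, forall p, u p = v p}.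
Proof.
move=> [tu hu] [tv hv];
have cu : cmeas u by case: tu. have cv : cmeas v by case: tv.
have Lu phi Sp := @tempered_fun_L1 _ u phi tu Sp.
have Lv phi Sp := @tempered_fun_L1 _ v phi tv Sp.
have e phi p : (u p - v p) * phi p = u p * phi p + (-1) * (v p * phi p).
  by ring.
have Ln phi Sp := L1Z (-1) (Lv phi Sp).
have : {ae leb2 R, forall p, u p - v p = 0}.
  apply: pairing_ae0.
  - have := cmeasD cu (cmeasM (@cmeas_cst _ (plane R) R (-1)) cv).
    by under eq_fun do rewrite mulN1r.
  - move=> phi Sp; under eq_fun do rewrite e.
    exact: L1D (Lu _ Sp) (Ln _ Sp).
  - move=> phi Sp; rewrite (eq_cintg (leb2 R) (e phi)) (cintgD (Lu _ Sp) (Ln _ Sp)) (cintgZ (-1) (Lv _ Sp)).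
    by have := hu _ Sp; rewrite hv// /pairing /cint => h; rewrite /cintg -h mulN1r subrr.
by apply: filterS => p /eqP; rewrite subr_eq0 => /eqP.
Qed.

End Uniqueness.

(** * The transform of the cubic term *)

Section Domination.
Context {R : realType}.
Implicit Types (p q : plane R).

Lemma weight_lty (v : plane R -> R) (c : R) N : measurable_fun setT v -> (forall p, 0 <= v p) ->
  0 <= c -> (\int[leb2 R]_p (v p)%:E < +oo)%E ->
  forall k : plane R -> R, measurable_fun setT k -> (forall p, 0 <= k p <= N) ->
  (\int[leb2 R]_p (k p)%:E < +oo)%E ->
  (\int[leb2 R]_p (c * (1 + v p) * k p)%:E < +oo)%E.
Proof.
move=> mv v0 c0 vy k mk k0 ky.
have N0 : 0 <= N by have /andP[a0] := k0 (0, 0); exact: le_trans.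
have kk p : 0 <= k p by have /andP[] := k0 p.
apply: (@le_lt_trans _ _ (\int[leb2 R]_p (c * (k p + N * v p))%:E)%E).
  apply: integral_EFin_le; [by mfun|by mfun|by move=> p; rewrite !mulr_ge0 ?addr_ge0|].
  move=> p; rewrite -mulrA ler_wpM2l// mulrDl mul1r lerD2l mulrC ler_wpM2r//.
  by have /andP[] := k0 p.
rewrite integral_EFinZ//; [|by mfun|by move=> p; rewrite addr_ge0 ?mulr_ge0].
rewrite integral_EFinD//; [|by mfun|by move=> p; rewrite mulr_ge0].
have hNv : (\int[leb2 R]_p (N * v p)%:E < +oo)%E.
  by rewrite (integral_EFinZ _ mv v0 N0) lte_mul_pinfty.
rewrite lte_mul_pinfty ?lee_fin//; last exact: lte_add_pinfty.
Qed.

Lemma pow_le_1_4 (x v : R) n : (n <= 4)%N -> 0 <= x -> x ^+ 4 <= v -> x ^+ n <= 1 + v.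
Proof.
move=> n4 x0 h; have x40 : 0 <= x ^+ 4 by rewrite exprn_ge0.
have [x1|x1] := leP x 1.
  by apply: (@le_trans _ _ 1); [rewrite exprn_ile1|rewrite lerDl (le_trans x40)].
apply: (@le_trans _ _ (x ^+ 4)); first by rewrite ler_weXn2l// ltW.
by rewrite (le_trans h)// lerDr.
Qed.

(** A bounded part plus an integrable part is tempered. This covers u as well as |u|^2 u, by
    [pow_le_1_4]. *)
Lemma tempered_of_dominated (v : plane R -> R) (c : R) (f : plane R -> R[i]) :
  measurable_fun setT v -> (forall p, 0 <= v p) -> 0 <= c ->
  (\int[leb2 R]_p (v p)%:E < +oo)%E -> cmeas f ->
  {ae leb2 R, forall p, cabs (f p) <= c * (1 + v p)} -> tempered_fun f.
Proof.
move=> mv v0 c0 vy mf fv; apply: (@tempered_funP _ 4) => //.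
have mb := @measurable_brkV R 4; have mfa := measurable_cabs mf.
have b0 p : 0 <= (@brk R p ^+ 4)^-1 <= 1.
  rewrite invr_ge0 exprn_ge0 ?(ltW (brk_gt0 p))//=.
  by rewrite invf_le1 ?exprn_gt0 ?brk_gt0// exprn_ege1// brk_ge1.
have b00 p : 0 <= (@brk R p ^+ 4)^-1 by have /andP[] := b0 p.
have hw := weight_lty mv v0 c0 vy mb b0 (@pweightV_lty R).
apply: (le_lt_trans _ hw).
apply: ae_ge0_le_integral => //.
- by move=> p _; rewrite lee_fin mulr_ge0 ?cabs_ge0.
- by mfun.
- by move=> p _; rewrite lee_fin !mulr_ge0 ?addr_ge0.
- by mfun.
by apply: filterS fv => p h _; rewrite lee_fin ler_wpM2r.
Qed.

End Domination.

Section FourierPairings.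
Context {R : realType}.
Implicit Types (p q : plane R) (phi psi : plane R -> R[i]).

Lemma ifourier_pairing f phi : L1 (leb2 R) f -> schwartz phi ->
  cintg (leb2 R) (fun p => ifourier f p * fourier phi p) =
  (@kappa R)%:C * cintg (leb2 R) (fun p => f p * phi p).
Proof.
move=> Lf Sp; have LF := schwartz_L1 (schwartz_fourier Sp).
transitivity (cintg (leb2 R) (fun p => fourier phi p * ifourier f p)).
  by apply: eq_cintg => p; rewrite mulrC.
rewrite (ifourier_mult LF Lf) -cintgZ; last first.
  have [N [N0 hN]] := schwartz_bounded Sp.
  under eq_fun do rewrite mulrC; exact: (L1_mulb (schwartz_cmeas Sp) hN).
by apply: eq_cintg => p; rewrite fourierK// mulrCA.
Qed.

Lemma cabs_cubic (f : plane R -> R[i]) p : cabs (cubic f p) = cabs (f p) ^+ 3.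
Proof. by rewrite cubicE !cabsM cabsJ; ring. Qed.

Lemma cmeas_cubic (f : plane R -> R[i]) : cmeas f -> cmeas (cubic f).
Proof.
move=> mf; rewrite (_ : cubic f = fun p => f p * f p * (f p)^*%C).
  by apply: cmeasM; [exact: cmeasM|exact: cmeasJ].
by apply/funext => p; rewrite cubicE.
Qed.

Lemma dominated_pairing (v : plane R -> R) (h_ : nat -> plane R -> R[i]) h psi :
  measurable_fun setT v -> (forall p, 0 <= v p) -> (\int[leb2 R]_p (v p)%:E < +oo)%E ->
  (forall n, cmeas (h_ n)) -> cmeas h ->
  {ae leb2 R, forall p, ccvg (fun n => h_ n p) (h p) /\ forall n, cabs (h_ n p) <= 1 + v p} ->
  schwartz psi ->
  ccvg (fun n => cintg (leb2 R) (fun p => h_ n p * psi p))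
    (cintg (leb2 R) (fun p => h p * psi p)).
Proof.
move=> mv v0 vy mh_ mh hc Sp; have [N [N0 hN]] := schwartz_bounded Sp.
have mp := schwartz_cmeas Sp; have mpa := measurable_cabs mp; have [_ Ly] := schwartz_L1 Sp.
have kN p : 0 <= cabs (psi p) <= N by rewrite cabs_ge0 hN.
have y := weight_lty mv v0 ler01 vy mpa kN Ly.
apply: (@cintg_dominated _ _ _ _ (fun n p => h_ n p * psi p)
    (fun p => h p * psi p) (fun p => 1 * (1 + v p) * cabs (psi p)) _ _ _ _ _ _ _).2 => //.
- by move=> n; exact: cmeasM.
- exact: cmeasM.
- by mfun.
- by apply: filterS hc => p [hp _]; exact: ccvgM hp (ccvg_cst _).
- by apply: filterS hc => p [_ hp] n; rewrite cabsM mul1r ler_wpM2r ?cabs_ge0.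
- by move=> p; rewrite !mulr_ge0 ?cabs_ge0 ?addr_ge0.
Qed.

End FourierPairings.

(** * Removal of the truncation *)

Section Representation.
Context {R : realType}.
Implicit Types (p q : plane R) (phi psi : plane R -> R[i]).
Variables (b b' C C' W : R) (g : plane R -> R[i]).
Hypotheses (b'0 : 0 <= b') (bb : b' < b) (bh : 2 * b <= 1).
Hypotheses (bC : kernel_bound b C) (C0 : 0 < C) (bC' : kernel_bound b' C') (C'0 : 0 < C').
Hypotheses (tg : tempered_fun g) (gW : (\int[leb2 R]_p (energy b g p)%:E = W%:E)%E).

Let mg : cmeas g. Proof. by case: tg. Qed.

Let gn n : plane R -> R[i] := keep (low b b' n) g.

Let L1_gn n : L1 (leb2 R) (gn n). Proof. exact: (L1_low b'0 bb mg gW). Qed.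

Let gn_le n p : cabs (gn n p) <= cabs (g p).
Proof. by rewrite cabs_keep; case: ifP => // _; exact: cabs_ge0. Qed.

Let gn_cvg p : ccvg (fun n => gn n p) (g p).
Proof.
have [N hN] := low_eventually b b' p.
by split; apply: cvg_near_cst; near=> n; rewrite /gn /keep hN//; near: n; exact: nbhs_infty_ge.
Unshelve. all: by end_near. Qed.

Definition cubic_conv f : plane R -> R[i] := cconv (cconv f f) (cref f).

Let G p := cabs (g p).
Let G0 p : 0 <= G p. Proof. exact: cabs_ge0. Qed.
Let mG : measurable_fun setT G. Proof. exact: measurable_cabs. Qed.
Let M q := ecorr (fconv G) G q.

Let M0 q : (0 <= M q)%E. Proof. by apply: ecorr_ge0 => // p; exact: fconv_ge0. Qed.
Let mM : measurable_fun setT M.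
Proof. by apply: measurable_ecorr => //; [exact: measurable_fconv|move=> p; exact: fconv_ge0]. Qed.

Let b0 : 0 <= b. Proof. exact: le_trans b'0 (ltW bb). Qed.

Lemma major_lty :
  (\int[leb2 R]_q ((sigma q `^ (- b))%:E * M q * ((sigma q `^ (- b))%:E * M q)) < +oo)%E.
Proof.
apply: le_lt_trans (ltry (C ^+ 2 * W ^+ 3)).
apply: le_trans (trilinear_major_le bC C0 mg gW).
have ms := @measurable_sigma R; have mj := @measurable_jap R.
have h (k : plane R -> R) : measurable_fun setT k ->
    measurable_fun setT (fun q => (k q)%:E * M q)%E.
  by move=> mk; apply: emeasurable_funM => //; exact: mf_EFin.
have h1 : measurable_fun setT (fun q => (sigma q `^ (- b))%:E * M q)%E by apply: h; mfun.
have h2 : measurable_fun setT (fun q => (sigma q `^ (- b) * jap q)%:E * M q)%E.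
  by apply: h; mfun.
have pos q : (0 <= (sigma q `^ (- b))%:E * M q)%E by rewrite mule_ge0 ?lee_fin ?powR_ge0.
apply: ge0_le_integral; first exact: measurableT.
- by move=> q _; rewrite mule_ge0.
- exact: emeasurable_funM.
- exact: emeasurable_funM.
move=> q _; suff le : ((sigma q `^ (- b))%:E * M q <= (sigma q `^ (- b) * jap q)%:E * M q)%E.
  exact: lee_pmul.
by rewrite lee_wpmul2r// lee_fin ler_peMr ?powR_ge0// jap_ge1.
Qed.

Lemma major_pair (k : plane R -> R) : measurable_fun setT k -> (forall p, 0 <= k p) ->
  (\int[leb2 R]_p ((sigma p `^ b * k p) ^+ 2)%:E < +oo)%E ->
  (\int[leb2 R]_q ((k q)%:E * M q) < +oo)%E.
Proof. by move=> mk k0; exact: (cauchy_schwarz_lty mM M0 mk k0 major_lty). Qed.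

Lemma brk_pair : (\int[leb2 R]_q (((brk q ^+ 3)^-1)%:E * M q) < +oo)%E.
Proof.
apply: major_pair; [exact: measurable_brkV| |exact: brk_sigma].
by move=> p; rewrite invr_ge0 exprn_ge0// ltW// brk_gt0.
Qed.

Lemma cmeas_cubic_conv (f : plane R -> R[i]) : cmeas f -> cmeas (cubic_conv f).
Proof. by move=> mf; apply: cmeas_cconv; [exact: cmeas_cconv|exact: cmeasJ (cmeas_popp mf)]. Qed.

Lemma tempered_cubic_conv : tempered_fun (cubic_conv g).
Proof.
have mc := cmeas_cubic_conv mg; apply: (@tempered_funP _ 3) => //.
have mb := @measurable_brkV R 3; have mca := measurable_cabs mc.
have bp (p : plane R) : 0 <= (brk p ^+ 3)^-1 by rewrite invr_ge0 exprn_ge0// ltW// brk_gt0.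
apply: le_lt_trans brk_pair; apply: ge0_le_integral; first exact: measurableT.
- by move=> p _; rewrite lee_fin mulr_ge0 ?cabs_ge0.
- by mfun.
- by apply: emeasurable_funM => //; exact: mf_EFin.
move=> p _; rewrite mulrC EFinM lee_wpmul2l ?lee_fin//.
by apply: (cabs_cconv3_le bC C0 mg gW mg).
Qed.

Lemma ae_major_fin : {ae leb2 R, forall q, M q \is a fin_num}.
Proof.
have h := brk_pair; pose X q := (((brk q ^+ 3)^-1)%:E * M q)%E.
have mb := @measurable_brkV R 3.
have bp (p : plane R) : 0 < (brk p ^+ 3)^-1 by rewrite invr_gt0 exprn_gt0// brk_gt0.
have : (leb2 R).-integrable setT X.
  apply/integrableP; split; first by apply: emeasurable_funM => //; exact: mf_EFin.
  under eq_integral => q _ do rewrite gee0_abs ?mule_ge0 ?lee_fin ?(ltW (bp q))//.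
  exact: h.
move/integrable_ae => /(_ measurableT); apply: filterS => q /(_ I); rewrite /X.
have := M0 q; case: (M q) => [r|_|//] //.
by rewrite gt0_muley// lte_fin.
Qed.

(** Two nested dominated convergences: the inner one at points where [econv G G] is finite, the
    outer one at points where [M] is finite. Both hold almost everywhere. *)
Lemma cubic_conv_cvg : {ae leb2 R, forall q, ccvg (fun n => cubic_conv (gn n) q) (cubic_conv g q)}.
Proof.
have mgn n : cmeas (gn n) := (L1_gn n).1.
have c2 p : econv G G p \is a fin_num ->
    ccvg (fun n => cconv (gn n) (gn n) p) (cconv g g p).
  move=> h.
  have mk (f : plane R -> R[i]) : cmeas f -> cmeas (fun q => f q * f (psub p q)).
    by move=> mf; exact: (cmeas_comp (cmeas_conv_kernel mf mf) (@pair1_measurable _ _ _ (plane R) p)).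
  apply: (@cintg_dominated _ _ _ _ (fun n q => gn n q * gn n (psub p q))
    (fun q => g q * g (psub p q)) (fun q => G q * G (psub p q)) _ _ _ _ _ _ _).2.
  - by move=> n; exact: mk.
  - exact: mk.
  - exact: (measurableT_comp (measurable_conv_kernel mG mG) (@pair1_measurable _ _ _ (plane R) p)).
  - by apply: aeW => q; exact: ccvgM.
  - by apply: aeW => q n; rewrite cabsM ler_pM ?cabs_ge0 ?gn_le.
  - by move: h; rewrite ge0_fin_numE// econv_ge0.
  - by move=> q; rewrite mulr_ge0.
apply: filterS ae_major_fin => q hq.
have mk (f : plane R -> R[i]) : cmeas f -> cmeas (fun p => cconv f f p * cref f (psub q p)).
  move=> mf; exact: (cmeas_comp (cmeas_conv_kernel (cmeas_cconv mf mf) (cmeasJ (cmeas_popp mf)))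
    (@pair1_measurable _ _ _ (plane R) q)).
have aef := ae_econv_fin bC C0 mg gW.
apply: (@cintg_dominated _ _ _ _ (fun n p => cconv (gn n) (gn n) p * cref (gn n) (psub q p))
    (fun p => cconv g g p * cref g (psub q p)) (fun p => fconv G p * G (psub p q)) _ _ _ _ _ _ _).2.
- by move=> n; exact: mk.
- exact: mk.
- exact: (measurableT_comp (measurable_corr_kernel mG (measurable_fconv mG G0)) (@pair1_measurable _ _ _ (plane R) q)).
- apply: filterS aef => p hp; apply: ccvgM; first exact: c2.
  exact: ccvgJ (gn_cvg _).
- apply: filterS aef => p hp n; rewrite cabsM ler_pM ?cabs_ge0//.
    exact: (cabs_cconv_fconv mg (mgn n) (gn_le n) hp).
  by rewrite cabs_cref_psub.
- by move: hq; rewrite ge0_fin_numE.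
- by move=> p; rewrite mulr_ge0// fconv_ge0.
Qed.

Let L1_cubic_conv n : L1 (leb2 R) (cubic_conv (gn n)).
Proof. by apply: L1_cconv; [exact: L1_cconv|exact: L1_cref]. Qed.

Let cvg_gn phi : schwartz phi ->
  ccvg (fun n => cintg (leb2 R) (fun p => gn n p * phi p)) (cintg (leb2 R) (fun p => g p * phi p)).
Proof.
move=> Sp; have L := tempered_fun_L1 tg Sp; have mp := schwartz_cmeas Sp.
apply: (@cintg_dominated _ _ _ _ (fun n p => gn n p * phi p)
    (fun p => g p * phi p) (fun p => cabs (g p * phi p)) _ _ _ _ _ _ _).2 => //.
- by move=> n; apply: cmeasM => //; exact: (L1_gn n).1.
- exact: L.1.
- exact: measurable_cabs L.1.
- by apply: aeW => p; exact: ccvgM (gn_cvg p) (ccvg_cst _).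
- by apply: aeW => p n; rewrite !cabsM ler_wpM2r ?cabs_ge0 ?gn_le.
- exact: L.2.
- by move=> p; exact: cabs_ge0.
Qed.

Let cvg_cubic phi : schwartz phi ->
  ccvg (fun n => cintg (leb2 R) (fun p => cubic_conv (gn n) p * phi p))
    (cintg (leb2 R) (fun p => cubic_conv g p * phi p)).
Proof.
move=> Sp; have mp := schwartz_cmeas Sp; have mpa := measurable_cabs mp.
have Mfin := ae_major_fin.
have mfM : measurable_fun setT (fun q => fine (M q)) by exact: measurableT_comp.
have fM0 q : 0 <= fine (M q) by rewrite fine_ge0.
have hy : (\int[leb2 R]_p (fine (M p) * cabs (phi p))%:E < +oo)%E.
  have [D hD] := schwartz_decay 3 Sp; have D0 := decay_ge0 hD.
  have b3 (p : plane R) : 0 < brk p ^+ 3 by rewrite exprn_gt0// brk_gt0.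
  apply: (@le_lt_trans _ _ (\int[leb2 R]_p (D%:E * (((brk p ^+ 3)^-1)%:E * M p)))%E).
    have mb := @measurable_brkV R 3.
    have mbM : measurable_fun setT (fun p => ((brk p ^+ 3)^-1)%:E * M p)%E.
      by apply: emeasurable_funM => //; exact: mf_EFin.
    have bM0 p : (0 <= ((brk p ^+ 3)^-1)%:E * M p)%E.
      by rewrite mule_ge0// lee_fin invr_ge0 ltW.
    apply: ge0_le_integral; first exact: measurableT.
    - by move=> p _; rewrite lee_fin mulr_ge0 ?cabs_ge0.
    - by mfun.
    - exact: measurable_funeM.
    move=> p _; rewrite muleA [(fine _ * _)%R]mulrC EFinM.
    apply: lee_pmul; rewrite ?lee_fin ?cabs_ge0//.
      by rewrite ler_pdivlMr// mulrC; exact: hD.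
    by have := M0 p; case: (M p) => //= _; exact: leey.
  rewrite ge0_integralZl//; last 2 first.
  - by apply: emeasurable_funM => //; apply: mf_EFin; exact: measurable_brkV.
  - by move=> p _; rewrite mule_ge0// lee_fin invr_ge0 ltW.
  rewrite lte_mul_pinfty//; exact: brk_pair.
have mc := cmeas_cubic_conv.
apply: (@cintg_dominated _ _ _ _ (fun n p => cubic_conv (gn n) p * phi p)
    (fun p => cubic_conv g p * phi p) (fun p => fine (M p) * cabs (phi p)) _ _ _ _ _ _ _).2.
- by move=> n; exact: (cmeasM (L1_cubic_conv n).1 mp).
- exact: (cmeasM (mc _ mg) mp).
- by mfun.
- have := cubic_conv_cvg; apply: filterS => q hq.
  exact: ccvgM hq (ccvg_cst _).
- apply: filterS Mfin => q hq n; rewrite cabsM ler_wpM2r ?cabs_ge0//.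
  rewrite -lee_fin fineK//.
  exact: (cabs_cconv3_le bC C0 mg gW (L1_gn n).1 (gn_le n)).
- exact: hy.
- by move=> q; rewrite mulr_ge0 ?cabs_ge0.
Qed.

(** w is the unnormalized inverse transform of g, whence the factor [kappa] in both identities. In
    the limit, the left sides are dominated through 1 + v; the right sides are dominated by |g phi|
    for the first identity and by [M] times |phi| for the second. *)
Lemma synthesis_pairing : exists w : plane R -> R[i], exists v : plane R -> R,
  [/\ cmeas w /\ {ae leb2 R, forall x, cabs (w x) ^+ 4 <= v x},
      measurable_fun setT v /\ (forall x, 0 <= v x),
      (\int[leb2 R]_x (v x)%:E < +oo)%E,
      forall phi, schwartz phi -> cintg (leb2 R) (fun p => w p * fourier phi p) =
        (@kappa R)%:C * cintg (leb2 R) (fun p => g p * phi p) &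
      forall phi, schwartz phi -> cintg (leb2 R) (fun p => cubic w p * fourier phi p) =
        (@kappa R)%:C * cintg (leb2 R) (fun p => cubic_conv g p * phi p)].
Proof.
have [w [v [mw mv v0 vy wv]]] := fourier_synthesis b'0 bb bC' C'0 mg gW.
have mS n : cmeas (ifourier (gn n)) := cmeas_ifourier (L1_gn n).1.
exists w, v; split => //.
- by split => //; apply: filterS wv => x [].
- move=> phi Sp; have SF := schwartz_fourier Sp.
  have c1 : ccvg (fun n => cintg (leb2 R) (fun p => ifourier (gn n) p * fourier phi p))
      (cintg (leb2 R) (fun p => w p * fourier phi p)).
    apply: (dominated_pairing mv v0 vy) => //.
    apply: filterS wv => x [h1 h2 _]; split => // n.
    by have := @pow_le_1_4 _ _ _ 1 isT (cabs_ge0 _) (h2 n); rewrite expr1.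
  apply: (ccvg_unique c1); apply: ccvg_eq (ccvgM (ccvg_cst _) (cvg_gn Sp)) => n.
  by rewrite ifourier_pairing.
move=> phi Sp; have SF := schwartz_fourier Sp.
have c1 : ccvg (fun n => cintg (leb2 R) (fun p => cubic (ifourier (gn n)) p * fourier phi p))
    (cintg (leb2 R) (fun p => cubic w p * fourier phi p)).
  apply: (dominated_pairing mv v0 vy) => //.
  - by move=> n; exact: cmeas_cubic.
  - exact: cmeas_cubic.
  apply: filterS wv => x [h1 h2 _]; split => [|n].
    rewrite cubicE; apply: ccvg_eq (ccvgM (ccvgM h1 h1) (ccvgJ h1)) => n.
    by rewrite cubicE.
  by rewrite cabs_cubic; exact: (pow_le_1_4 _ (cabs_ge0 _) (h2 n)).
apply: (ccvg_unique c1); apply: ccvg_eq (ccvgM (ccvg_cst _) (cvg_cubic Sp)) => n.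
by rewrite (cubic_ifourier (L1_gn n)) (ifourier_pairing (L1_cubic_conv n) Sp).
Qed.

End Representation.

(** * Norm estimate *)

Section FinalEstimate.
Context {R : realType}.
Implicit Types (p q : plane R) (phi psi : plane R -> R[i]).

Lemma tempered_funZ (c : R[i]) (f : plane R -> R[i]) :
  tempered_fun f -> tempered_fun (fun p => c * f p).
Proof.
move=> tf; have L phi Sp := @tempered_fun_L1 _ f phi tf Sp.
have [cf _ [lin [N [C hC]]]] := tf.
have E phi : schwartz phi -> pairing (fun p => c * f p) phi = c * pairing f phi.
  move=> Sp; rewrite /pairing -[RHS](cintgZ c (L phi Sp)).
  by apply: eq_cintg => p; rewrite mulrA.
split.
- exact: (cmeasM (@cmeas_cst _ (plane R) R c) cf).
- move=> phi Sp; have h := L1Z c (L phi Sp).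
  rewrite (_ : (fun p => _) = (fun p => c * (f p * phi p))).
    by split; [exact: L1_Re h|exact: L1_Im h].
  by apply/funext => p; rewrite mulrA.
split.
- move=> k phi psi Sp Sq; rewrite !E//; last by apply: schwartzD => //; exact: schwartzZ.
  by rewrite lin//; ring.
exists N, (cabs c * C) => phi Sp M hM; rewrite E// cabsM -mulrA.
by rewrite ler_wpM2l ?cabs_ge0// hC.
Qed.

Lemma energyE b (g : plane R -> R[i]) q :
  (1 + `|q.1|) `^ (2 * 1) * (1 + `|q.2 + q.1 ^+ 2|) `^ (2 * b) * cabs (g q) ^+ 2 = energy b g q.
Proof.
rewrite /energy -/(jap q) -/(sigma q) mulr1 powR_mulrn ?(ltW (jap_gt0 q))//.
rewrite (_ : sigma q `^ (2 * b) = (sigma q `^ b) ^+ 2); first by ring.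
by rewrite mulrC powRrM powR_mulrn ?powR_ge0.
Qed.

Lemma weighted_normE b (g : plane R -> R[i]) :
  weighted_norm b 1 g = ((\int[leb2 R]_q (energy b g q)%:E) `^ 2^-1)%E.
Proof. by congr (_ `^ _)%E; apply: eq_integral => q _; rewrite energyE. Qed.

Lemma weighted_norm_lty b (g : plane R -> R[i]) : (weighted_norm b 1 g < +oo)%E ->
  exists2 W, (\int[leb2 R]_q (energy b g q)%:E = W%:E)%E &
    weighted_norm b 1 g = (Num.sqrt W)%:E.
Proof.
rewrite weighted_normE.
have : (0 <= \int[leb2 R]_q (energy b g q)%:E)%E by apply: integral_EFin_ge0 => q; exact: energy_ge0.
case: (\int[leb2 R]_q (energy b g q)%:E)%E => [W W0 _|_|//].
  by exists W => //; rewrite poweR_EFin powR12_sqrt.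
by rewrite poweRyr.
Qed.

Lemma bourgain_normE b (U : (plane R -> R[i]) -> R[i]) g :
  is_function (fourier_distr U) g -> bourgain_norm b 1 U = weighted_norm b 1 g.
Proof.
move=> hg; have cg : cmeas g by case: hg => -[].
apply/eqP; rewrite eq_le; apply/andP; split; first by apply: ereal_inf_lbound; exists g.
apply: le_ereal_inf_tmp => _ [g' hg' <-]; have cg' : cmeas g' by case: hg' => -[].
rewrite !weighted_normE le_eqVlt; apply/orP; left; apply/eqP; congr (_ `^ _)%E.
apply: ae_eq_integral => //.
- by apply: mf_EFin; exact: measurable_energy.
- by apply: mf_EFin; exact: measurable_energy.
by apply: filterS (is_function_unique hg hg') => p h _; rewrite /energy h.
Qed.

Lemma energy_le b b1 (g : plane R -> R[i]) q : b <= b1 -> energy b g q <= energy b1 g q.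
Proof.
move=> bb; have s0 := sigma_gt0 q; have j0 := jap_gt0 q.
rewrite /energy lerXn2r ?nnegrE ?mulr_ge0 ?powR_ge0 ?cabs_ge0 ?(ltW j0)//.
rewrite ler_wpM2r ?mulr_ge0 ?cabs_ge0 ?(ltW j0)//.
by rewrite ler_powR// sigma_ge1.
Qed.

(** Two relaxations are built in: b <= a lets the estimate at exponent -b control the norm at -a,
    and W <= W' lets the energy at the lowered exponent be replaced by that of the data. *)
Lemma weighted_norm_cubic_conv (a b c C W W' : R) (g : plane R -> R[i]) :
  kernel_bound b C -> 0 < C -> b <= a -> 0 <= c -> cmeas g ->
  (\int[leb2 R]_q (energy b g q)%:E = W%:E)%E -> W <= W' ->
  (weighted_norm (- a) 1 (fun q => (c%:C * cubic_conv g q)%R) <=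
    (c * C * Num.sqrt W' ^+ 3)%:E)%E.
Proof.
move=> bC C0 ba c0 mg gW WW.
have W0 : 0 <= W by rewrite -lee_fin -gW integral_EFin_ge0// => p; exact: energy_ge0.
have W'0 := le_trans W0 WW.
have mc := cmeas_cubic_conv mg.
pose G p := cabs (g p).
have G0 p : 0 <= G p by exact: cabs_ge0.
have mG : measurable_fun setT G by exact: measurable_cabs.
have mM : measurable_fun setT (ecorr (fconv G) G).
  by apply: measurable_ecorr => //; [exact: measurable_fconv|move=> p; exact: fconv_ge0].
have M0 q : (0 <= ecorr (fconv G) G q)%E by apply: ecorr_ge0 => // p; exact: fconv_ge0.
pose X q := ((sigma q `^ (- b) * jap q)%:E * ecorr (fconv G) G q)%E.
have k0 q : 0 <= sigma q `^ (- b) * jap q by rewrite mulr_ge0 ?powR_ge0// ltW// jap_gt0.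
have X0 q : (0 <= X q)%E by rewrite mule_ge0 ?lee_fin.
have mX : measurable_fun setT X.
  apply: emeasurable_funM => //; apply: mf_EFin.
  by have h1 := @measurable_sigma R; have h2 := @measurable_jap R; mfun.
have mcc : cmeas (fun q => (c%:C * cubic_conv g q)%R).
  exact: (cmeasM (@cmeas_cst _ (plane R) R c%:C) mc).
have key : (\int[leb2 R]_q (energy (- a) (fun q => (c%:C * cubic_conv g q)%R) q)%:E <=
    ((c * C * Num.sqrt W' ^+ 3) ^+ 2)%:E)%E.
  apply: (@le_trans _ _ (\int[leb2 R]_q ((c ^+ 2)%:E * (X q * X q)))%E).
    have mXX : measurable_fun setT (fun q => X q * X q)%E by exact: emeasurable_funM.
    apply: ge0_le_integral; first exact: measurableT.
    - by move=> q _; rewrite lee_fin energy_ge0.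
    - by apply: mf_EFin; exact: measurable_energy.
    - exact: measurable_funeM.
    move=> q _; apply: (@le_trans _ _ (energy (- b) (fun q => (c%:C * cubic_conv g q)%R) q)%:E).
      by rewrite lee_fin energy_le// lerN2.
    have -> : energy (- b) (fun q => (c%:C * cubic_conv g q)%R) q =
        c ^+ 2 * ((sigma q `^ (- b) * jap q * cabs (cubic_conv g q)) *
          (sigma q `^ (- b) * jap q * cabs (cubic_conv g q))).
      by rewrite /energy cabsM cabsR ger0_norm//; ring.
    rewrite EFinM lee_wpmul2l ?lee_fin ?sqr_ge0// EFinM.
    have le : ((sigma q `^ (- b) * jap q * cabs (cubic_conv g q))%:E <= X q)%E.
      rewrite EFinM lee_wpmul2l ?lee_fin//.
      exact: (cabs_cconv3_le bC C0 mg gW mg).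
    by apply: lee_pmul => //; rewrite lee_fin mulr_ge0 ?cabs_ge0.
  rewrite ge0_integralZl//; last 3 first.
  - exact: emeasurable_funM.
  - by move=> q _; rewrite mule_ge0.
  - by rewrite lee_fin sqr_ge0.
  apply: (@le_trans _ _ ((c ^+ 2)%:E * (C ^+ 2 * W ^+ 3)%:E)%E).
    by rewrite lee_wpmul2l ?lee_fin ?sqr_ge0//; exact: (trilinear_major_le bC C0 mg gW).
  rewrite -EFinM lee_fin.
  rewrite (_ : (c * C * Num.sqrt W' ^+ 3) ^+ 2 = c ^+ 2 * (C ^+ 2 * (Num.sqrt W' ^+ 2) ^+ 3)); last by ring.
  rewrite sqr_sqrtr// ler_wpM2l ?sqr_ge0// ler_wpM2l ?sqr_ge0//.
  by rewrite lerXn2r.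
rewrite weighted_normE.
have : (0 <= \int[leb2 R]_q (energy (- a) (fun q => (c%:C * cubic_conv g q)%R) q)%:E)%E.
  by apply: integral_EFin_ge0 => q; exact: energy_ge0.
move: key; case: (\int[leb2 R]_q _)%E => [r|//|//]; rewrite !lee_fin => rK r0.
rewrite powR12_sqrt//.
have K0 : 0 <= c * C * Num.sqrt W' ^+ 3 by rewrite !mulr_ge0 ?exprn_ge0 ?sqrtr_ge0// ltW.
by rewrite -[leRHS](ger0_norm K0) -sqrtr_sqr ler_wsqrtr.
Qed.

End FinalEstimate.

Theorem lemma3p3 (R : realType) (a b : R)
    (ha : 3 / 8 < a < 1 / 2) (hb : 3 / 8 < b < 1 / 2) :
  exists C : R, forall U : (plane R -> R[i]) -> R[i],
    bourgain_space b 1 U ->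
    (exists u : plane R -> R[i], is_function U u) /\
    (forall u : plane R -> R[i], is_function U u ->
       tempered_fun (cubic u) /\
       (bourgain_norm (- a) 1 (pairing (cubic u))
          <= C%:E * bourgain_norm b 1 U ^+ 3)%E).
Proof.
have [a1 a2] := andP ha; have [b1 b2] := andP hb.
(* [b0] is the common exponent of the trilinear estimate; the midpoint b' keeps both b' > 3/8 and a
   positive gap b0 - b' for the synthesis. *)
pose b0 := Num.min a b; pose b' := (3 / 8 + b0) / 2.
have b01 : 3 / 8 < b0 by rewrite lt_min a1.
have b02 : b0 < 1 / 2 by rewrite gt_min a2.
have b0a : b0 <= a by rewrite ge_min lexx.
have b0b : b0 <= b by rewrite ge_min lexx orbT.
have b'1 : 3 / 8 < b' by rewrite /b'; lra.
have b'b : b' < b0 by rewrite /b'; lra.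
have b'2 : b' < 1 / 2 by lra.
have b'0 : 0 <= b' by lra.
have b0h : 2 * b0 <= 1 by lra.
have [C C0 bC] := kernel_boundP b01 b02; have [C' C'0 bC'] := kernel_boundP b'1 b'2.
have k0 := @kappa_gt0 R; have kn : @kappa R != 0 by rewrite gt_eqF.
(* With u = w / kappa, the cubic term carries kappa^(-3) and the pairing identity for w returns one
   factor [kappa]. *)
exists (@kappa R ^- 2 * C) => U [_ Uy].
have [_ [g hg <-] gy] := ereal_inf_lt Uy.
have [W gW nW] := weighted_norm_lty gy.
have [tg hgU] := hg; have mg : cmeas g by case: tg.
have : (\int[leb2 R]_q (energy b0 g q)%:E <= W%:E)%E.
  rewrite -gW; apply: integral_EFin_le; [exact: measurable_energy..| |].
    by move=> q; exact: energy_ge0.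
  by move=> q; exact: energy_le.
have : (0 <= \int[leb2 R]_q (energy b0 g q)%:E)%E.
  by apply: integral_EFin_ge0 => q; exact: energy_ge0.
case gW0 : (\int[leb2 R]_q (energy b0 g q)%:E)%E => [W0|//|//]; rewrite !lee_fin => W00 WW.
have [w [v [[mw wv] [mv v0] vy hw hw3]]] :=
  synthesis_pairing b'0 b'b b0h bC C0 bC' C'0 tg gW0.
pose ki : R[i] := (@kappa R)^-1%:C.
have kiK z : ki * ((@kappa R)%:C * z) = z.
  by rewrite mulrA -rmorphM/= mulVf// mul1r.
have cki : cabs ki = (@kappa R)^-1 by rewrite cabsR ger0_norm// invr_ge0 ltW.
have ki0 : 0 <= (@kappa R)^-1 by rewrite invr_ge0 ltW.
have wn n x : (n <= 4)%N -> cabs (w x) ^+ 4 <= v x -> cabs (w x) ^+ n <= 1 + v x.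
  by move=> n4; exact: (pow_le_1_4 n4 (cabs_ge0 _)).
have mkw : cmeas (fun p => ki * w p) by exact: (cmeasM (@cmeas_cst _ (plane R) R ki) mw).
have tkw : tempered_fun (fun p => ki * w p).
  apply: (tempered_of_dominated mv v0 ki0 vy) => //.
  by apply: filterS wv => x h; rewrite cabsM cki ler_wpM2l//; have := wn 1%N x isT h; rewrite expr1.
have Lw psi Sp := tempered_fun_L1 tkw Sp : L1 (leb2 R) (fun p => ki * w p * psi p).
have kkK z : (@kappa R)%:C * (ki * z) = z :> R[i].
  by rewrite mulrCA kiK.
have Uw : is_function U (fun p => ki * w p).
  (* The function g describes U on transforms of Schwartz functions; as every test function is such
     a transform, U is determined. *)
  split => // psi Sp; have [phi Sphi <-] := fourier_onto Sp.
  rewrite [LHS](hgU phi Sphi) -[LHS]kiK -(hw _ Sphi).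
  have SF := schwartz_fourier Sphi.
  have Lw' : L1 (leb2 R) (fun p => w p * fourier phi p).
    have := L1Z ((@kappa R)%:C) (Lw _ SF).
    by under eq_fun do rewrite -mulrA kkK.
  by rewrite -(cintgZ ki Lw'); apply: eq_cintg => p; rewrite mulrA.
split; first by exists (fun p => ki * w p).
(* An arbitrary representative agrees almost everywhere with the constructed one and inherits its
   majorant. *)
move=> u Uu; have uw := is_function_unique Uu Uw.
have mu : cmeas u by case: Uu => -[].
have mcu := cmeas_cubic mu.
have tcu : tempered_fun (cubic u).
  have c0 : 0 <= (@kappa R)^-1 ^+ 3 by rewrite exprn_ge0.
  apply: (tempered_of_dominated mv v0 c0 vy) => //.
  apply: filterS2 uw wv => x h1 h2; rewrite cabs_cubic h1 cabsM cki exprMn.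
  by rewrite ler_wpM2l// wn.
split => //.
have cu3 : {ae leb2 R, forall x, cubic u x = ki ^+ 3 * cubic w x}.
  apply: filterS uw => x h; rewrite !cubicE h cJM.
  have -> : ki^*%C = ki by apply: eqcP; rewrite ?cReJ ?cImJ//= oppr0.
  by ring.
pose g3 p : R[i] := (@kappa R ^- 2)%:C * cubic_conv g p.
have tcc : tempered_fun (cubic_conv g).
  exact: (tempered_cubic_conv b'0 b'b b0h bC C0 tg gW0).
have tcw : tempered_fun (cubic w).
  apply: (tempered_of_dominated mv v0 ler01 vy); first exact: cmeas_cubic.
  by apply: filterS wv => x h; rewrite cabs_cubic mul1r wn.
have tg3 : tempered_fun g3 by exact: tempered_funZ.
have k3 z : ki ^+ 3 * ((@kappa R)%:C * z) = (@kappa R ^- 2)%:C * z.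
  rewrite exprSr -mulrA kiK; congr (_ * _).
  by rewrite /ki -rmorphXn/= exprVn.
have h3 : is_function (fourier_distr (pairing (cubic u))) g3.
  split => // phi Sphi; have SF := schwartz_fourier Sphi.
  have mF := schwartz_cmeas SF.
  have Lc := tempered_fun_L1 tcu SF.
  transitivity (cintg (leb2 R) (fun p => ki ^+ 3 * (cubic w p * fourier phi p))).
    apply: ae_eq_cintg; first exact: Lc.1.
      apply: cmeasM; first exact: cmeas_cst.
      exact: (cmeasM (cmeas_cubic mw) mF).
    by apply: filterS cu3 => x ->; rewrite mulrA.
  have Lcw : L1 (leb2 R) (fun p => cubic w p * fourier phi p).
    exact: (tempered_fun_L1 tcw SF).
  rewrite (cintgZ _ Lcw) hw3// k3 -(cintgZ _ (tempered_fun_L1 tcc Sphi)).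
  by apply: eq_cintg => p; rewrite /g3 mulrA.
rewrite (bourgain_normE _ h3) (bourgain_normE _ hg) nW.
apply: (le_trans (weighted_norm_cubic_conv bC C0 b0a _ mg gW0 WW)).
  by rewrite invr_ge0 sqr_ge0.
by rewrite -EFin_expe -EFinM.
Qed.
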